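(* Fix constants $a>0$ and $g>0$. The initial value problem \[ \partial_t \rho + u\,\partial_x \rho = 0,\qquad u = g\,H_a\rho,\qquad \rho(\cdot,0)=\rho_0, \] posed on the circle $\mathbb{T}$, is locally well-posed in time in the class $C^\infty(\mathbb{T})$: for every $\rho_0\in C^\infty(\mathbb{T})$ there exist a time $T>0$ and a solution $\rho$ that is smooth and bounded on $\mathbb{T}\times[0,T)$ with $\rho(\cdot,t)\in C^\infty(\mathbb{T})$ for all $t\in[0,T)$, and this solution is unique among solutions in $C^\infty(\mathbb{T})$ with the same initial data.
   Context: $\mathbb{T}=[-\pi,\pi)$ denotes the circle; functions on $\mathbb{T}$ are identified with $2\pi$-periodic functions on $\mathbb{R}$, and $C^\infty(\mathbb{T})$ denotes smooth $2\pi$-periodic functions (bounded, with all derivatives bounded). For $a>0$, the operator $H_a$ acts on (the periodic extension to $\mathbb{R}$ of) a function $f$ by \[ H_a f(x) := \mathrm{P.V.}\int_{\mathbb{R}} f(x-y)\,K_a(y)\,dy,\qquad K_a(y) := \frac{1}{\pi y}\,\frac{a^2}{y^2+a^2}. \] *)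

(* Defs.v *)
From Stdlib Require Import Reals List.
From Coquelicot Require Import Coquelicot.
Open Scope R_scope.

Definition Ka (a y : R) : R := / (PI * y) * (a ^ 2 / (y ^ 2 + a ^ 2)).

Definition trunc_Ha (a : R) (f : R -> R) (x eps I : R) : Prop :=
  exists I1 I2 : R,
    is_RInt_gen (fun y => f (x - y) * Ka a y)
      (Rbar_locally m_infty) (at_point (- eps)) I1 /\
    is_RInt_gen (fun y => f (x - y) * Ka a y)
      (at_point eps) (Rbar_locally p_infty) I2 /\
    I = I1 + I2.

Definition is_Ha (a : R) (f : R -> R) (x v : R) : Prop :=
  exists I : R -> R,
    (forall eps, 0 < eps -> trunc_Ha a f x eps (I eps)) /\
    filterlim I (at_right 0) (locally v).

Definition Cinf_T (f : R -> R) : Prop :=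
  (forall x, f (x + 2 * PI) = f x) /\
  (forall n : nat,
     (forall x, ex_derive (Derive_n f n) x) /\
     exists M, forall x, Rabs (Derive_n f n x) <= M).

Inductive dir := Dx | Dt.

Fixpoint iterD (l : list dir) (f : R -> R -> R) : R -> R -> R :=
  match l with
  | nil => f
  | Dx :: l' => fun x t => Derive (fun y => iterD l' f y t) x
  | Dt :: l' => fun x t => Derive (fun s => iterD l' f x s) t
  end.

(** Smooth on R x [0,T): every iterated partial derivative exists and is
    jointly continuous on the open strip R x (0,T), and extends continuously
    to the boundary t = 0. *)
Definition smooth_strip (T : R) (f : R -> R -> R) : Prop :=
  forall l : list dir,
    (forall x t, 0 < t < T ->
       ex_derive (fun y => iterD l f y t) x /\
       ex_derive (fun s => iterD l f x s) t /\
       continuous (fun p : R * R => iterD l f (fst p) (snd p)) (x, t)) /\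
    (forall x0, exists L,
       filterlim (fun p : R * R => iterD l f (fst p) (snd p))
         (within (fun p : R * R => 0 < snd p) (locally (x0, 0))) (locally L)).

Definition is_solution (a g : R) (rho0 : R -> R) (T : R) (rho : R -> R -> R)
  : Prop :=
  smooth_strip T rho /\
  (exists M, forall x t, 0 <= t < T -> Rabs (rho x t) <= M) /\
  (forall t, 0 <= t < T -> Cinf_T (fun x => rho x t)) /\
  (forall x, rho x 0 = rho0 x) /\
  (forall x, filterlim (fun t => rho x t) (at_right 0) (locally (rho0 x))) /\
  (forall x t, 0 < t < T ->
     exists v, is_Ha a (fun y => rho y t) x v /\
       Derive (fun s => rho x s) t
       + (g * v) * Derive (fun y => rho y t) x = 0).

(* Main.v *)
Require Import Defs.
From Stdlib Require Import Reals Ranalysis5 List Lra Lia ZArith Classical IndefiniteDescription.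
From Coquelicot Require Import Coquelicot.
Open Scope R_scope.

(** Expand in the real orthogonal system [cas (k x) = cos (k x) + sin (k x)],
    [k] in [Z]. [H_a] maps [cas (k x)] to [- mu_k cas (- k x)] with [mu_k]
    bounded, so the equation becomes a quadratic system for the coefficients,
    [h_k' = - sum_l A_kl l h_l], where [A] is linear in [h]. In the energies
    [sum k^(2s) h_k^2] exchanging [k] and [l] turns the unbounded factor
    [k^(2s) l] into the commutator [l k^(2s) - k l^(2s)], whence
    [E_s' <= K_s (sum |j| |h_j|) E_s] for every [s], also for the truncations to
    [|k| <= N]. The case [s = 2] fixes the existence time, the others propagate
    smoothness on the same interval. The estimate for [s = 0] applied to
    differences shows that the truncated solutions form a Cauchy sequence, and
    that they converge to the coefficients of any smooth solution with the same
    initial data: this gives existence and uniqueness at once. *)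

(** * Sums and series over the integers *)

(** The factor [l] in [l h_l] loses one derivative, so the infinite system has no Lipschitz field on
    a space of coefficients; existence passes through finite systems whose bounds do not see [N].
    From the kernel one fact is extracted, [|mu_k| <= 3] uniformly in [k]: near zero [2 Ka] is at
    most [1 / y], beyond [y = 1 / |k|] it decreases against an oscillating sine. Velocity and
    density thus have the same regularity. The energies [s = 0] and [s = 2] together dominate
    [sum |k| |h_k|], by comparison with [sum 1 / (1 + k^2)], so their sum obeys a closed inequality.
    For a difference of two solutions and [s = 0], the term transporting the difference is again a
    commutator, and in the other term the derivative falls on a family that is already bounded. The
    equation is imposed for [t > 0], and derivatives at [t = 0] are given as limits from the
    interior. The comparison of an arbitrary solution with the truncated ones therefore uses
    derivatives on open time intervals and continuity at the ends; bounds uniform down to [t = 0]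
    come from compactness of a closed rectangle. *)

Fixpoint zsum (N : nat) (f : Z -> R) : R :=
  match N with
  | O => f 0%Z
  | S n => zsum n f + (f (Z.of_nat (S n)) + f (- Z.of_nat (S n))%Z)
  end.

Lemma zsum_ext N f g :
  (forall k, (Z.abs k <= Z.of_nat N)%Z -> f k = g k) -> zsum N f = zsum N g.
Proof.
  induction N as [|N IH]; intros H; cbn [zsum].
  - apply H; lia.
  - rewrite IH by (intros; apply H; lia).
    rewrite (H (Z.of_nat (S N))), (H (- Z.of_nat (S N))%Z) by lia. reflexivity.
Qed.

Lemma zsum_plus N f g : zsum N (fun k => f k + g k) = zsum N f + zsum N g.
Proof. induction N as [|N IH]; cbn [zsum]; [ring|]. rewrite IH; ring. Qed.

Lemma zsum_minus N f g : zsum N (fun k => f k - g k) = zsum N f - zsum N g.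
Proof. induction N as [|N IH]; cbn [zsum]; [ring|]. rewrite IH; ring. Qed.

Lemma zsum_scal N c f : zsum N (fun k => c * f k) = c * zsum N f.
Proof. induction N as [|N IH]; cbn [zsum]; [ring|]. rewrite IH; ring. Qed.

Lemma zsum_scal_r N c f : zsum N (fun k => f k * c) = zsum N f * c.
Proof. induction N as [|N IH]; cbn [zsum]; [ring|]. rewrite IH; ring. Qed.

Lemma zsum_opp N f : zsum N (fun k => - f k) = - zsum N f.
Proof. induction N as [|N IH]; cbn [zsum]; [ring|]. rewrite IH; ring. Qed.

Lemma zsum_le N f g :
  (forall k, (Z.abs k <= Z.of_nat N)%Z -> f k <= g k) -> zsum N f <= zsum N g.
Proof.
  induction N as [|N IH]; intros H; cbn [zsum].
  - apply H; lia.
  - pose proof (IH ltac:(intros; apply H; lia)).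
    pose proof (H (Z.of_nat (S N)) ltac:(lia)).
    pose proof (H (- Z.of_nat (S N))%Z ltac:(lia)). lra.
Qed.

Lemma zsum_0 N : zsum N (fun _ => 0) = 0.
Proof. induction N as [|N IH]; cbn [zsum]; [ring|]. rewrite IH; ring. Qed.

Lemma zsum_nonneg N f :
  (forall k, (Z.abs k <= Z.of_nat N)%Z -> 0 <= f k) -> 0 <= zsum N f.
Proof. intros H. rewrite <- (zsum_0 N). apply zsum_le; auto. Qed.

Lemma zsum_Rabs N f : Rabs (zsum N f) <= zsum N (fun k => Rabs (f k)).
Proof.
  induction N as [|N IH]; cbn [zsum]; [lra|].
  eapply Rle_trans; [apply Rabs_triang|].
  apply Rplus_le_compat; [exact IH|apply Rabs_triang].
Qed.

Lemma zsum_reflect N f : zsum N (fun k => f (- k)%Z) = zsum N f.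
Proof.
  induction N as [|N IH]; cbn [zsum]; [reflexivity|].
  rewrite IH, Z.opp_involutive; ring.
Qed.

Lemma zsum_swap N M (f : Z -> Z -> R) :
  zsum N (fun k => zsum M (fun l => f k l)) = zsum M (fun l => zsum N (fun k => f k l)).
Proof.
  induction N as [|N IH]; cbn [zsum]; [reflexivity|].
  rewrite IH, !zsum_plus. reflexivity.
Qed.

Lemma zsum_mono N M f :
  (N <= M)%nat -> (forall k, 0 <= f k) -> zsum N f <= zsum M f.
Proof.
  intros HNM Hf. induction HNM as [|M HNM IH]; [lra|]. cbn [zsum].
  pose proof (Hf (Z.of_nat (S M))). pose proof (Hf (- Z.of_nat (S M))%Z). lra.
Qed.

Lemma zsum_term_le N f k :
  (Z.abs k <= Z.of_nat N)%Z -> (forall j, 0 <= f j) -> f k <= zsum N f.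
Proof.
  intros Hk Hf. induction N as [|N IH]; cbn [zsum].
  - replace k with 0%Z by lia. lra.
  - pose proof (Hf (Z.of_nat (S N))). pose proof (Hf (- Z.of_nat (S N))%Z).
    destruct (Z_le_gt_dec (Z.abs k) (Z.of_nat N)).
    + specialize (IH ltac:(lia)); lra.
    + assert (0 <= zsum N f) by (apply zsum_nonneg; auto).
      assert (k = Z.of_nat (S N) \/ k = - Z.of_nat (S N))%Z as [->| ->] by lia; lra.
Qed.

Lemma zsum_const N c : zsum N (fun _ => c) = (2 * INR N + 1) * c.
Proof.
  induction N as [|N IH]; cbn [zsum]; [simpl; ring|].
  rewrite IH, S_INR; ring.
Qed.

Lemma zsum_single N k f :
  (Z.abs k <= Z.of_nat N)%Z -> (forall j, j <> k -> f j = 0) -> zsum N f = f k.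
Proof.
  intros Hk Hf. induction N as [|N IH]; cbn [zsum].
  - f_equal; lia.
  - destruct (Z_le_gt_dec (Z.abs k) (Z.of_nat N)).
    + rewrite IH, (Hf (Z.of_nat (S N))), (Hf (- Z.of_nat (S N))%Z) by lia; ring.
    + assert (zsum N f = 0) as ->.
      { rewrite <- (zsum_0 N). apply zsum_ext. intros j Hj. apply Hf; lia. }
      assert (k = Z.of_nat (S N) \/ k = - Z.of_nat (S N))%Z as [->| ->] by lia.
      * rewrite (Hf (- Z.of_nat (S N))%Z) by lia; ring.
      * rewrite (Hf (Z.of_nat (S N))%Z) by lia; ring.
Qed.

(** Sums over consecutive integers starting at [a]. They serve to compare a translated symmetric
    window with a centred one, which the pairing of [k] and [-k] in [zsum] hides. *)
Fixpoint isum (a : Z) (n : nat) (f : Z -> R) : R :=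
  match n with
  | O => 0
  | S n => f a + isum (a + 1) n f
  end.

Lemma isum_app a n m f :
  isum a (n + m) f = isum a n f + isum (a + Z.of_nat n) m f.
Proof.
  revert a. induction n as [|n IH]; intros a; cbn [isum Nat.add].
  - rewrite Z.add_0_r; ring.
  - rewrite IH. replace (a + 1 + Z.of_nat n)%Z with (a + Z.of_nat (S n))%Z by lia. ring.
Qed.

Lemma isum_nonneg a n f : (forall k, 0 <= f k) -> 0 <= isum a n f.
Proof.
  intros H. revert a. induction n as [|n IH]; intros a; cbn [isum]; [lra|].
  pose proof (H a). pose proof (IH (a + 1)%Z). lra.
Qed.

Lemma isum_zsum_shift N k f :
  zsum N (fun l => f (k + l)%Z) = isum (k - Z.of_nat N) (2 * N + 1) f.
Proof.
  induction N as [|N IH]; cbn [zsum].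
  - simpl. replace (k - 0)%Z with (k + 0)%Z by lia. ring.
  - rewrite IH. replace (2 * S N + 1)%nat with (1 + ((2 * N + 1) + 1))%nat by lia.
    rewrite !isum_app. cbn [isum].
    replace (k - Z.of_nat (S N) + Z.of_nat 1)%Z with (k - Z.of_nat N)%Z by lia.
    replace (k - Z.of_nat N + Z.of_nat (2 * N + 1))%Z with (k + Z.of_nat (S N))%Z by lia.
    replace (k + - Z.of_nat (S N))%Z with (k - Z.of_nat (S N))%Z by lia. ring.
Qed.

(** The window of radius [N] around [k] lies inside the window of radius [N + |k|] around zero; the
    leftovers on its two sides have [|k| + k] and [|k| - k] terms, all nonnegative. *)
Lemma zsum_shift_le N k f :
  (forall j, 0 <= f j) ->
  zsum N (fun l => f (k + l)%Z) <= zsum (N + Z.abs_nat k) f.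
Proof.
  intros Hf. rewrite isum_zsum_shift.
  rewrite (zsum_ext (N + Z.abs_nat k) f (fun l => f (0 + l)%Z)) by (intros; f_equal; lia).
  rewrite isum_zsum_shift.
  set (M := (N + Z.abs_nat k)%nat).
  replace (2 * M + 1)%nat
    with (Z.to_nat (k + Z.abs k) + ((2 * N + 1) + Z.to_nat (Z.abs k - k)))%nat by lia.
  rewrite !isum_app.
  replace (0 - Z.of_nat M + Z.of_nat (Z.to_nat (k + Z.abs k)))%Z
    with (k - Z.of_nat N)%Z by lia.
  pose proof (isum_nonneg (0 - Z.of_nat M) (Z.to_nat (k + Z.abs k)) f Hf).
  pose proof (isum_nonneg (k - Z.of_nat N + Z.of_nat (2 * N + 1)) (Z.to_nat (Z.abs k - k)) f Hf).
  lra.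
Qed.

Lemma zsum_shift_bound N k f G :
  (forall j, 0 <= f j) -> (forall n, zsum n f <= G) ->
  zsum N (fun l => f (k + l)%Z) <= G.
Proof. intros Hf HG. eapply Rle_trans; [apply zsum_shift_le; auto|apply HG]. Qed.

Lemma zsum_shift_bound' N k f G :
  (forall j, 0 <= f j) -> (forall n, zsum n f <= G) ->
  zsum N (fun l => f (k - l)%Z) <= G.
Proof.
  intros Hf HG. rewrite <- (zsum_reflect N (fun l => f (k - l)%Z)).
  erewrite zsum_ext; [apply (zsum_shift_bound N k f G Hf HG)|].
  intros; simpl; f_equal; lia.
Qed.

(** * Quadratic weights and absolutely summable families *)

Definition wt (k : Z) : R := 1 + IZR k * IZR k.

Lemma wt_ge_1 k : 1 <= wt k.
Proof. unfold wt. nra. Qed.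

Lemma wt_pos k : 0 < wt k.
Proof. pose proof (wt_ge_1 k); lra. Qed.

Lemma wt_opp k : wt (- k) = wt k.
Proof. unfold wt. rewrite opp_IZR. ring. Qed.

(** Telescoping: [2 / (1 + n^2) <= 4 / (n (n + 1)) = 4 / n - 4 / (n + 1)] with [n = M + 1]. *)
Lemma zsum_inv_wt_diff N M :
  (N <= M)%nat ->
  zsum M (fun k => / wt k) - zsum N (fun k => / wt k) <= 4 / (INR N + 1) - 4 / (INR M + 1).
Proof.
  intros H. induction H as [|M HM IH]; [lra|]. cbn [zsum].
  rewrite wt_opp.
  cut (2 * / wt (Z.of_nat (S M)) <= 4 / (INR M + 1) - 4 / (INR (S M) + 1)); [lra|].
  unfold wt. rewrite <- INR_IZR_INZ, !S_INR.
  pose proof (pos_INR M). set (x := INR M) in *.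
  replace (4 / (x + 1) - 4 / (x + 1 + 1)) with (4 / ((x + 1) * (x + 1 + 1))) by (field; lra).
  replace (2 * / (1 + (x + 1) * (x + 1))) with (4 / (2 * (1 + (x + 1) * (x + 1)))) by (field; nra).
  apply Rmult_le_compat_l; [lra|]. apply Rinv_le_contravar; nra.
Qed.

(** [5 = 1 + 4]: the term [k = 0] and the telescoped rest. *)
Lemma zsum_inv_wt N : zsum N (fun k => / wt k) <= 5.
Proof.
  pose proof (zsum_inv_wt_diff 0 N ltac:(lia)) as H. cbn [zsum] in H.
  unfold wt in H at 2. simpl in H.
  assert (0 < 4 / (INR N + 1)) by (apply Rdiv_lt_0_compat; [lra|pose proof (pos_INR N); lra]).
  lra.
Qed.

(** An explicit majorant instead of mere convergence: [C] yields the tail rate [4 C / (N + 1)], and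
    one [C] for all values of a parameter yields convergence uniform in that parameter. *)
Definition summable (f : Z -> R) (C : R) := forall k, Rabs (f k) <= C * / wt k.

(** Total in [f], as the limit of symmetric partial sums; the value is meaningful once these
    converge, for instance under [summable]. *)
Definition zser (f : Z -> R) : R := real (Lim_seq (fun N => zsum N f)).

Lemma zsum_diff_Rabs N M f :
  (N <= M)%nat ->
  Rabs (zsum M f - zsum N f) <=
  zsum M (fun k => Rabs (f k)) - zsum N (fun k => Rabs (f k)).
Proof.
  intros H. induction H as [|M HM IH].
  - rewrite !Rminus_diag, Rabs_R0. lra.
  - cbn [zsum].
    pose proof (Rabs_triang (zsum M f - zsum N f)
      (f (Z.of_nat (S M)) + f (- Z.of_nat (S M))%Z)).
    pose proof (Rabs_triang (f (Z.of_nat (S M))) (f (- Z.of_nat (S M))%Z)).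
    match goal with |- Rabs ?a <= _ => replace a with
      (zsum M f - zsum N f + (f (Z.of_nat (S M)) + f (- Z.of_nat (S M))%Z)) by ring end.
    lra.
Qed.

Lemma zsum_diff_mono N M f g :
  (N <= M)%nat ->
  (forall k, (Z.of_nat N < Z.abs k)%Z -> f k <= g k) ->
  zsum M f - zsum N f <= zsum M g - zsum N g.
Proof.
  intros H Hfg. induction H as [|M HM IH]; [lra|]. cbn [zsum].
  pose proof (Hfg (Z.of_nat (S M)) ltac:(lia)).
  pose proof (Hfg (- Z.of_nat (S M))%Z ltac:(lia)). lra.
Qed.

Lemma zsum_tail N M f C :
  (N <= M)%nat -> 0 <= C ->
  (forall k, (Z.of_nat N < Z.abs k)%Z -> Rabs (f k) <= C * / wt k) ->
  Rabs (zsum M f - zsum N f) <= 4 * C / (INR N + 1).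
Proof.
  intros H HC Hf.
  eapply Rle_trans; [apply zsum_diff_Rabs; exact H|].
  eapply Rle_trans; [apply (zsum_diff_mono N M _ (fun k => C * / wt k) H Hf)|].
  rewrite !zsum_scal.
  pose proof (zsum_inv_wt_diff N M H).
  assert (0 < 4 / (INR M + 1)) by (apply Rdiv_lt_0_compat; [lra|pose proof (pos_INR M); lra]).
  replace (4 * C / (INR N + 1)) with (C * (4 / (INR N + 1))) by (unfold Rdiv; ring). nra.
Qed.

Lemma inv_INR_small (C eps : R) : 0 < eps ->
  exists N, forall n, (N <= n)%nat -> C / (INR n + 1) < eps.
Proof.
  intros He. destruct (nfloor_ex (Rabs C / eps)) as [N [H1 H2]].
  { apply Rdiv_le_0_compat; [apply Rabs_pos|lra]. }
  exists (S N). intros n Hn. apply le_INR in Hn. rewrite S_INR in Hn.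
  pose proof (Rle_abs C). pose proof (pos_INR N).
  apply Rmult_lt_reg_r with (INR n + 1); [lra|].
  unfold Rdiv. rewrite Rmult_assoc, Rinv_l, Rmult_1_r by lra.
  apply (Rmult_lt_compat_r eps) in H2; [|lra].
  unfold Rdiv in H2. rewrite Rmult_assoc, Rinv_l, Rmult_1_r in H2 by lra. nra.
Qed.

Lemma summable_nonneg f C : summable f C -> 0 <= C.
Proof.
  intros H. specialize (H 0%Z). unfold wt in H.
  pose proof (Rabs_pos (f 0%Z)). replace (1 + 0 * 0) with 1 in H by ring.
  rewrite Rinv_1 in H. lra.
Qed.

Lemma zser_lim f C : summable f C -> is_lim_seq (fun N => zsum N f) (zser f).
Proof.
  intros Hf. pose proof (summable_nonneg f C Hf) as HC.
  assert (ex_finite_lim_seq (fun N => zsum N f)) as [l Hl].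
  { apply ex_lim_seq_cauchy_corr. intros eps.
    destruct (inv_INR_small (4 * C) eps (cond_pos eps)) as [N HN].
    exists N. intros n m Hn Hm.
    assert (forall n m, (N <= n)%nat -> (n <= m)%nat -> Rabs (zsum m f - zsum n f) < eps) as H.
    { intros n' m' Hn' Hm'. eapply Rle_lt_trans; [apply (zsum_tail n' m' f C Hm' HC); intros; apply Hf|].
      apply HN; auto. }
    destruct (Nat.le_ge_cases n m).
    - rewrite Rabs_minus_sym. apply H; auto.
    - apply H; auto. }
  unfold zser. rewrite (is_lim_seq_unique _ _ Hl). exact Hl.
Qed.

Lemma zser_unique f (l : R) : is_lim_seq (fun N => zsum N f) l -> zser f = l.
Proof. intros H. unfold zser. rewrite (is_lim_seq_unique _ _ H). reflexivity. Qed.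

Lemma zser_tail N f C :
  summable f C -> Rabs (zser f - zsum N f) <= 4 * C / (INR N + 1).
Proof.
  intros Hf. pose proof (summable_nonneg f C Hf) as HC.
  apply (is_lim_seq_le_loc (fun M => Rabs (zsum M f - zsum N f)) (fun _ => 4 * C / (INR N + 1))
    (Finite (Rabs (zser f - zsum N f))) (Finite (4 * C / (INR N + 1)))).
  - exists N. intros n Hn. apply zsum_tail; auto.
  - apply (is_lim_seq_abs _ (Finite (zser f - zsum N f))).
    apply (is_lim_seq_minus' _ _ (zser f) (zsum N f)); [apply (zser_lim f C Hf)|apply is_lim_seq_const].
  - apply is_lim_seq_const.
Qed.

Lemma zser_ext f g : (forall k, f k = g k) -> zser f = zser g.
Proof. intros H. unfold zser. f_equal. apply Lim_seq_ext. intros n. apply zsum_ext; auto. Qed.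

Lemma zser_plus f g C D : summable f C -> summable g D ->
  zser (fun k => f k + g k) = zser f + zser g.
Proof.
  intros Hf Hg. apply zser_unique.
  eapply is_lim_seq_ext; [intros n; symmetry; apply zsum_plus|].
  apply (is_lim_seq_plus' _ _ (zser f) (zser g)); eapply zser_lim; eauto.
Qed.

Lemma zser_scal f c C : summable f C -> zser (fun k => c * f k) = c * zser f.
Proof.
  intros Hf. apply zser_unique.
  eapply is_lim_seq_ext; [intros n; symmetry; apply zsum_scal|].
  apply (is_lim_seq_scal_l _ c (zser f)). eapply zser_lim; eauto.
Qed.

Lemma zser_bound f C : summable f C -> Rabs (zser f) <= 5 * C.
Proof.
  intros Hf. pose proof (zser_tail 0 f C Hf) as H. cbn [zsum] in H. simpl INR in H.
  pose proof (Hf 0%Z) as H0. unfold wt in H0. replace (1 + 0 * 0) with 1 in H0 by ring.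
  rewrite Rinv_1 in H0.
  pose proof (Rabs_triang (zser f - f 0%Z) (f 0%Z)).
  replace (zser f - f 0%Z + f 0%Z) with (zser f) in H1 by ring. lra.
Qed.

Lemma zser_reflect f : zser (fun k => f (- k)%Z) = zser f.
Proof. unfold zser. f_equal. apply Lim_seq_ext. intros n. apply zsum_reflect. Qed.

(** * Calculus of series of functions *)

Lemma ex_RInt_cont (f : R -> R) a b : (forall x, continuous f x) -> ex_RInt f a b.
Proof. intros H. apply (@ex_RInt_continuous R_CompleteNormedModule). intros; apply H. Qed.

Lemma is_RInt_cont (f : R -> R) a b :
  (forall x, continuous f x) -> is_RInt f a b (RInt f a b).
Proof. intros H. apply (@RInt_correct R_CompleteNormedModule). apply ex_RInt_cont, H. Qed.

Lemma is_RInt_Rplus (f g : R -> R) a b I J :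
  is_RInt f a b I -> is_RInt g a b J -> is_RInt (fun x => f x + g x) a b (I + J).
Proof. intros; apply (@is_RInt_plus R_NormedModule); assumption. Qed.

Lemma is_RInt_Rminus (f g : R -> R) a b I J :
  is_RInt f a b I -> is_RInt g a b J -> is_RInt (fun x => f x - g x) a b (I - J).
Proof. intros; apply (@is_RInt_minus R_NormedModule); assumption. Qed.

Lemma is_RInt_Rscal (f : R -> R) c a b I :
  is_RInt f a b I -> is_RInt (fun x => c * f x) a b (c * I).
Proof. intros; apply (@is_RInt_scal R_NormedModule); assumption. Qed.

Lemma is_RInt_Rext (f g : R -> R) a b I :
  (forall x, f x = g x) -> is_RInt f a b I -> is_RInt g a b I.
Proof. intros H. apply is_RInt_ext. intros; apply H. Qed.

Lemma is_RInt_abs_le (f : R -> R) a b I M :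
  a <= b -> is_RInt f a b I -> (forall x, a <= x <= b -> Rabs (f x) <= M) ->
  Rabs I <= (b - a) * M.
Proof.
  intros Hab HI HM. rewrite <- (is_RInt_unique _ _ _ _ HI).
  apply abs_RInt_le_const; auto. eexists; exact HI.
Qed.

Lemma is_derive_zsum N (f : Z -> R -> R) (f' : Z -> R) x :
  (forall k, (Z.abs k <= Z.of_nat N)%Z -> is_derive (f k) x (f' k)) ->
  is_derive (fun y => zsum N (fun k => f k y)) x (zsum N f').
Proof.
  induction N as [|N IH]; intros H; cbn [zsum].
  - apply H; lia.
  - apply (is_derive_plus (fun y => zsum N (fun k => f k y))
      (fun y => f (Z.of_nat (S N)) y + f (- Z.of_nat (S N))%Z y)).
    + apply IH. intros; apply H; lia.
    + apply (is_derive_plus (f (Z.of_nat (S N))) (f (- Z.of_nat (S N))%Z)); apply H; lia.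
Qed.

Lemma continuous_zsum {U : UniformSpace} N (f : Z -> U -> R) x :
  (forall k, (Z.abs k <= Z.of_nat N)%Z -> continuous (f k) x) ->
  continuous (fun y => zsum N (fun k => f k y)) x.
Proof.
  induction N as [|N IH]; intros H; cbn [zsum].
  - apply H; lia.
  - apply (continuous_plus (fun y => zsum N (fun k => f k y))
      (fun y => f (Z.of_nat (S N)) y + f (- Z.of_nat (S N))%Z y)).
    + apply IH. intros; apply H; lia.
    + apply (continuous_plus (f (Z.of_nat (S N))) (f (- Z.of_nat (S N))%Z)); apply H; lia.
Qed.

Lemma is_RInt_zsum N (f : Z -> R -> R) (I : Z -> R) a b :
  (forall k, is_RInt (f k) a b (I k)) ->
  is_RInt (fun y => zsum N (fun k => f k y)) a b (zsum N I).
Proof.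
  intros H. induction N as [|N IH]; cbn [zsum].
  - apply H; lia.
  - apply (is_RInt_plus (fun y => zsum N (fun k => f k y))
      (fun y => f (Z.of_nat (S N)) y + f (- Z.of_nat (S N))%Z y)); [apply IH|].
    apply (is_RInt_plus (f (Z.of_nat (S N))) (f (- Z.of_nat (S N))%Z)); apply H; lia.
Qed.

Lemma zser_CVU (f : Z -> R -> R) C c (r : posreal) :
  (forall y, Rabs (y - c) < r -> summable (fun k => f k y) C) ->
  CVU (fun N y => zsum N (fun k => f k y)) (fun y => zser (fun k => f k y)) c r.
Proof.
  intros Hf eps Heps.
  destruct (inv_INR_small (4 * C) eps Heps) as [N HN].
  exists N. intros n y Hn Hy.
  eapply Rle_lt_trans; [apply zser_tail; apply Hf; exact Hy|]. apply HN; exact Hn.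
Qed.

Lemma zser_continuous (f : Z -> R -> R) C x (r : posreal) :
  (forall y, Rabs (y - x) < r -> summable (fun k => f k y) C) ->
  (forall k y, Rabs (y - x) < r -> continuous (f k) y) ->
  continuous (fun y => zser (fun k => f k y)) x.
Proof.
  intros Hf Hc. apply continuity_pt_filterlim.
  apply (CVU_continuity (fun N y => zsum N (fun k => f k y)) _ x r).
  - apply zser_CVU with C; exact Hf.
  - intros n y Hy. apply continuity_pt_filterlim. apply continuous_zsum. intros; apply Hc; exact Hy.
  - unfold Boule. rewrite Rminus_diag, Rabs_R0. apply cond_pos.
Qed.

Lemma is_derive_zser (f f' : Z -> R -> R) C C' x (r : posreal) :
  (forall y, Rabs (y - x) < r -> summable (fun k => f k y) C) ->
  (forall y, Rabs (y - x) < r -> summable (fun k => f' k y) C') ->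
  (forall k y, Rabs (y - x) < r -> is_derive (f k) y (f' k y)) ->
  (forall k y, Rabs (y - x) < r -> continuous (f' k) y) ->
  is_derive (fun y => zser (fun k => f k y)) x (zser (fun k => f' k x)).
Proof.
  intros Hf Hf' Hd Hc. apply is_derive_Reals.
  assert (Boule x r x) as Hx by (unfold Boule; rewrite Rminus_diag, Rabs_R0; apply cond_pos).
  apply (derivable_pt_lim_CVU (fun N y => zsum N (fun k => f k y))
    (fun N y => zsum N (fun k => f' k y)) _ (fun y => zser (fun k => f' k y)) x x r Hx).
  - intros y n Hy. apply is_derive_Reals. apply is_derive_zsum. intros; apply Hd; exact Hy.
  - intros y Hy. apply is_lim_seq_Reals. apply zser_lim with C. apply Hf; exact Hy.
  - apply zser_CVU with C'. exact Hf'.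
  - intros y Hy. unfold Boule in Hy.
    assert (0 < r - Rabs (y - x)) as Hr by lra.
    assert (forall z, Rabs (z - y) < mkposreal _ Hr -> Rabs (z - x) < r) as Hz.
    { intros z Hz. simpl in Hz. pose proof (Rabs_triang (z - y) (y - x)).
      replace (z - y + (y - x)) with (z - x) in H by ring. lra. }
    apply continuity_pt_filterlim.
    apply (zser_continuous f' C' y (mkposreal _ Hr)).
    + intros z Hz1. apply Hf', Hz, Hz1.
    + intros k z Hz1. apply Hc, Hz, Hz1.
Qed.

Lemma is_lim_seq_of_bound (u : nat -> R) (l C : R) :
  (forall n, Rabs (u n - l) <= C / (INR n + 1)) -> is_lim_seq u l.
Proof.
  intros H. apply is_lim_seq_Reals. intros eps Heps.
  destruct (inv_INR_small C eps Heps) as [N HN]. exists N. intros n Hn.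
  unfold Rdist. eapply Rle_lt_trans; [apply H|]. apply HN; lia.
Qed.

Lemma RInt_zser (f : Z -> R -> R) C a b :
  a <= b ->
  (forall y, summable (fun k => f k y) C) ->
  (forall k y, continuous (f k) y) ->
  is_RInt (fun y => zser (fun k => f k y)) a b (zser (fun k => RInt (f k) a b)).
Proof.
  intros Hab Hf Hc.
  assert (forall k, is_RInt (f k) a b (RInt (f k) a b)) as HI.
  { intros k. apply is_RInt_cont. intros; apply Hc. }
  assert (is_RInt (fun y => zser (fun k => f k y)) a b
    (RInt (fun y => zser (fun k => f k y)) a b)) as Hex.
  { apply is_RInt_cont. intros z.
    apply (zser_continuous f C z (mkposreal 1 Rlt_0_1)); auto. }
  replace (zser (fun k => RInt (f k) a b)) with (RInt (fun y => zser (fun k => f k y)) a b).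
  { exact Hex. }
  symmetry. apply zser_unique.
  apply is_lim_seq_of_bound with ((b - a) * (4 * C)). intros N.
  pose proof (is_RInt_zsum N f _ a b HI) as HN.
  rewrite Rabs_minus_sym.
  eapply Rle_trans.
  { apply (is_RInt_abs_le _ a b _ (4 * C / (INR N + 1)) Hab (is_RInt_Rminus _ _ _ _ _ _ Hex HN)).
    intros t _. apply zser_tail; auto. }
  right. unfold Rdiv. ring.
Qed.

Lemma mvt_le (f f' : R -> R) a b M :
  a <= b ->
  (forall x, a < x < b -> is_derive f x (f' x)) ->
  (forall x, a <= x <= b -> continuity_pt f x) ->
  (forall x, a < x < b -> f' x <= M) ->
  f b - f a <= M * (b - a).
Proof.
  intros Hab Hd Hc HM.
  (* [MVT_gen] places [c] in the closed interval, while [f'] is controlled only in its interior; the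
     default value [M] makes the bound hold at the ends too. *)
  set (g := fun x => if Rlt_dec a x then if Rlt_dec x b then f' x else M else M).
  destruct (MVT_gen f a b g) as [c [_ Hc2]].
  - rewrite Rmin_left, Rmax_right by lra. intros x Hx. unfold g.
    destruct (Rlt_dec a x); [|lra]. destruct (Rlt_dec x b); [|lra]. apply Hd; lra.
  - rewrite Rmin_left, Rmax_right by lra. exact Hc.
  - rewrite Hc2. apply Rmult_le_compat_r; [lra|]. unfold g.
    destruct (Rlt_dec a c); [|lra]. destruct (Rlt_dec c b); [|lra]. apply HM; lra.
Qed.

Lemma mvt_Rabs_le (f f' : R -> R) a b M :
  a <= b ->
  (forall x, a < x < b -> is_derive f x (f' x)) ->
  (forall x, a <= x <= b -> continuity_pt f x) ->
  (forall x, a < x < b -> Rabs (f' x) <= M) ->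
  Rabs (f b - f a) <= M * (b - a).
Proof.
  intros Hab Hd Hc HM. apply Rabs_le. split.
  - cut ((fun x => - f x) b - (fun x => - f x) a <= M * (b - a)); [simpl; lra|].
    apply (mvt_le (fun x => - f x) (fun x => - f' x)); auto.
    + intros x Hx. apply (@is_derive_opp R_AbsRing R_NormedModule). auto.
    + intros x Hx. apply continuity_pt_opp. auto.
    + intros x Hx. pose proof (HM x Hx). pose proof (Rle_abs (- f' x)).
      rewrite Rabs_Ropp in H0. lra.
  - apply mvt_le with f'; auto.
    intros x Hx. pose proof (HM x Hx). pose proof (Rle_abs (f' x)). lra.
Qed.

Lemma is_derive_continuity_pt (f : R -> R) x l : is_derive f x l -> continuity_pt f x.
Proof.
  intros H. apply continuity_pt_filterlim. apply (@ex_derive_continuous R_AbsRing R_NormedModule).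
  eexists; exact H.
Qed.

Lemma is_derive_cont (f : R -> R) x l : is_derive f x l -> continuous f x.
Proof. intros H. apply (@ex_derive_continuous R_AbsRing R_NormedModule). eexists; exact H. Qed.

(** * Hartley coefficients *)

(** The kernel of the Hartley transform. Its derivative at [t] is [cas (- t)], the same function at
    the reflected argument. *)
Definition cas (t : R) : R := cos t + sin t.

Lemma cas_bound t : Rabs (cas t) <= 2.
Proof.
  unfold cas. pose proof (COS_bound t). pose proof (SIN_bound t). apply Rabs_le; lra.
Qed.

Lemma is_derive_cas (c d x : R) :
  is_derive (fun x => cas (c * x + d)) x (c * cas (c * x + (d + PI / 2))).
Proof.
  unfold cas. auto_derive; [trivial|].
  replace (c * x + (d + PI / 2)) with (PI / 2 + (c * x + d)) by ring.
  rewrite (sin_plus (PI / 2)), (cos_plus (PI / 2)), cos_PI2, sin_PI2. ring.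
Qed.

Lemma is_derive_cas0 (c x : R) :
  is_derive (fun x => cas (c * x)) x (c * cas (- (c * x))).
Proof. unfold cas. auto_derive; [trivial|]. rewrite cos_neg, sin_neg. ring. Qed.

Lemma continuous_cas (c d x : R) : continuous (fun x => cas (c * x + d)) x.
Proof. eapply is_derive_cont. apply is_derive_cas. Qed.

Lemma continuous_cas0 (c x : R) : continuous (fun x => cas (c * x)) x.
Proof. eapply is_derive_cont. apply is_derive_cas0. Qed.

(** The counterpart of [exp (i s) exp (i t) = exp (i (s + t))]. Four terms appear instead of one,
    which is why both sums and differences of frequencies enter [Amat]. *)
Lemma cas_mult s t :
  cas s * cas t = (cas (s - t) + cas (t - s) + cas (s + t) - cas (- (s + t))) / 2.
Proof.
  unfold cas. rewrite !cos_neg, !sin_neg, !cos_minus, !sin_minus, cos_plus, sin_plus. field.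
Qed.

Lemma sin_IZR_PI k : sin (IZR k * PI) = 0.
Proof. apply sin_eq_0_1. exists k. reflexivity. Qed.

Lemma cas_period k x : cas (IZR k * (x + 2 * PI)) = cas (IZR k * x).
Proof.
  unfold cas. replace (IZR k * (x + 2 * PI)) with (IZR k * x + 2 * (IZR k * PI)) by ring.
  rewrite sin_plus, cos_plus, sin_2a, cos_2a, sin_IZR_PI.
  assert (cos (IZR k * PI) * cos (IZR k * PI) = 1) as ->.
  { pose proof (sin2_cos2 (IZR k * PI)) as H. rewrite sin_IZR_PI in H. unfold Rsqr in H. lra. }
  ring.
Qed.

Lemma RInt_cas k :
  is_RInt (fun x => cas (IZR k * x)) (- PI) PI (if Z.eq_dec k 0 then 2 * PI else 0).
Proof.
  destruct (Z.eq_dec k 0) as [->|Hk].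
  - apply is_RInt_Rext with (fun _ => 1).
    { intros x. unfold cas. rewrite Rmult_0_l, cos_0, sin_0. ring. }
    replace (2 * PI) with (scal (PI - - PI) 1) by (unfold scal; simpl; unfold mult; simpl; ring).
    apply (@is_RInt_const R_NormedModule).
  - assert (IZR k <> 0) as Hk' by (apply not_0_IZR; exact Hk).
    replace 0 with (minus ((sin (IZR k * PI) - cos (IZR k * PI)) / IZR k)
      ((sin (IZR k * - PI) - cos (IZR k * - PI)) / IZR k)).
    + apply (@is_RInt_derive R_CompleteNormedModule (fun x => (sin (IZR k * x) - cos (IZR k * x)) / IZR k)).
      * intros x _. unfold cas. auto_derive; [trivial|]. field; exact Hk'.
      * intros x _. apply continuous_cas0.
    + replace (IZR k * - PI) with (- (IZR k * PI)) by ring.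
      rewrite sin_neg, cos_neg, sin_IZR_PI. unfold minus, plus, opp; simpl. field; exact Hk'.
Qed.

(** Hartley coefficients: the system [cas (k x)], [k] in [Z], is orthogonal over
    a period, so real functions have unconstrained real coefficients. *)
Definition fc (f : R -> R) (k : Z) : R :=
  / (2 * PI) * RInt (fun x => f x * cas (IZR k * x)) (- PI) PI.

Lemma two_PI_pos : 0 < 2 * PI.
Proof. pose proof PI_RGT_0; lra. Qed.

Lemma continuous_Rmult {U : UniformSpace} (f g : U -> R) x :
  continuous f x -> continuous g x -> continuous (fun y => f y * g y) x.
Proof. intros Hf Hg. apply (@continuous_mult U R_AbsRing); assumption. Qed.

Lemma continuous_Rplus {U : UniformSpace} (f g : U -> R) x :
  continuous f x -> continuous g x -> continuous (fun y => f y + g y) x.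
Proof. intros Hf Hg. apply (@continuous_plus U R_AbsRing R_NormedModule); assumption. Qed.

Lemma continuous_Rminus {U : UniformSpace} (f g : U -> R) x :
  continuous f x -> continuous g x -> continuous (fun y => f y - g y) x.
Proof. intros Hf Hg. apply (@continuous_minus U R_AbsRing R_NormedModule); assumption. Qed.

Lemma is_RInt_fc f k :
  (forall x, continuous f x) ->
  is_RInt (fun x => f x * cas (IZR k * x)) (- PI) PI (2 * PI * fc f k).
Proof.
  intros Hf. unfold fc. rewrite <- Rmult_assoc, Rinv_r, Rmult_1_l
    by (pose proof two_PI_pos; lra).
  apply is_RInt_cont. intros x. apply continuous_Rmult; [apply Hf|apply continuous_cas0].
Qed.

Lemma fc_unique f k I :
  is_RInt (fun x => f x * cas (IZR k * x)) (- PI) PI I -> fc f k = / (2 * PI) * I.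
Proof. intros H. unfold fc. rewrite (is_RInt_unique _ _ _ _ H). reflexivity. Qed.

Lemma fc_ext f g k : (forall x, - PI < x < PI -> f x = g x) -> fc f k = fc g k.
Proof.
  intros H. unfold fc. f_equal. apply RInt_ext. intros x Hx.
  pose proof PI_RGT_0. rewrite Rmin_left, Rmax_right in Hx by lra.
  rewrite H by lra. reflexivity.
Qed.

Lemma fc_bound f k M :
  (forall x, continuous f x) -> (forall x, - PI <= x <= PI -> Rabs (f x) <= M) ->
  Rabs (fc f k) <= 2 * M.
Proof.
  intros Hc HM. pose proof two_PI_pos.
  pose proof (is_RInt_abs_le _ (- PI) PI _ (2 * M) ltac:(lra) (is_RInt_fc f k Hc)) as Hb.
  assert (Rabs (2 * PI * fc f k) <= (PI - - PI) * (2 * M)) as H1.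
  { apply Hb. intros x Hx. rewrite Rabs_mult. pose proof (cas_bound (IZR k * x)).
    rewrite (Rmult_comm 2 M). apply Rmult_le_compat; auto using Rabs_pos. }
  rewrite Rabs_mult, (Rabs_pos_eq (2 * PI)) in H1 by lra.
  apply Rmult_le_reg_l with (2 * PI); lra.
Qed.

Lemma fc_minus f g k :
  (forall x, continuous f x) -> (forall x, continuous g x) ->
  fc (fun x => f x - g x) k = fc f k - fc g k.
Proof.
  intros Hf Hg. pose proof two_PI_pos.
  rewrite (fc_unique _ k (2 * PI * fc f k - 2 * PI * fc g k)); [field; lra|].
  eapply is_RInt_Rext; [|apply is_RInt_Rminus; apply is_RInt_fc; assumption].
  intros x; simpl; ring.
Qed.

Lemma fc_plus f g k :
  (forall x, continuous f x) -> (forall x, continuous g x) ->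
  fc (fun x => f x + g x) k = fc f k + fc g k.
Proof.
  intros Hf Hg. pose proof two_PI_pos.
  rewrite (fc_unique _ k (2 * PI * fc f k + 2 * PI * fc g k)); [field; lra|].
  eapply is_RInt_Rext; [|apply is_RInt_Rplus; apply is_RInt_fc; assumption].
  intros x; simpl; ring.
Qed.

Lemma fc_scal c f k :
  (forall x, continuous f x) -> fc (fun x => c * f x) k = c * fc f k.
Proof.
  intros Hf. pose proof two_PI_pos.
  rewrite (fc_unique _ k (c * (2 * PI * fc f k))); [field; lra|].
  eapply is_RInt_Rext; [|apply is_RInt_Rscal; apply is_RInt_fc; assumption].
  intros x; simpl; ring.
Qed.

(** Integration by parts: periodicity cancels the boundary values, and the derivative
    [k cas (- k x)] of [cas (k x)] reflects the frequency. *)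
Lemma fc_derive (f f' : R -> R) k :
  (forall x, is_derive f x (f' x)) -> (forall x, continuous f' x) ->
  (forall x, f (x + 2 * PI) = f x) ->
  fc f' k = - IZR k * fc f (- k).
Proof.
  intros Hd Hc Hp. pose proof two_PI_pos.
  assert (forall x, continuous f x) as Hcf by (intros x; eapply is_derive_cont; apply Hd).
  rewrite (fc_unique _ k (0 - IZR k * (2 * PI * fc f (- k)))); [field; lra|].
  eapply is_RInt_Rext; [|apply is_RInt_Rminus;
    [|apply is_RInt_Rscal; apply (is_RInt_fc f (- k)); exact Hcf]].
  2:{ replace 0 with (minus (f PI * cas (IZR k * PI)) (f (- PI) * cas (IZR k * - PI))).
      apply (@is_RInt_derive R_CompleteNormedModule (fun x => f x * cas (IZR k * x))
        (fun x => f' x * cas (IZR k * x) + f x * (IZR k * cas (- (IZR k * x))))).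
      - intros x _. apply (is_derive_mult f (fun x => cas (IZR k * x))); [apply Hd|apply is_derive_cas0|].
        intros; apply Rmult_comm.
      - intros x _. apply continuous_Rplus; apply continuous_Rmult; auto using continuous_cas0.
        apply continuous_Rmult; [apply continuous_const|].
        apply continuous_ext with (fun x => cas ((- IZR k) * x)); [|apply continuous_cas0].
        intros y. f_equal; ring.
      - replace (f PI) with (f (- PI)) by (rewrite <- Hp; f_equal; ring).
        replace (cas (IZR k * PI)) with (cas (IZR k * - PI))
          by (rewrite <- cas_period; do 2 f_equal; ring).
        unfold minus, plus, opp; simpl; ring. }
  intros x; simpl. rewrite opp_IZR. replace (- IZR k * x) with (- (IZR k * x)) by ring. ring.
Qed.

(** By [cas_mult], [Amat (fc u) k l] is the [k]-th coefficient of
    [u x * cas (- (l x))]. *)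
Definition Amat (G : Z -> R) (k l : Z) : R :=
  (G (k - l)%Z - G (l - k)%Z + G (k + l)%Z + G (- k - l)%Z) / 2.

Lemma summable_mult_bounded (f g : Z -> R) C B :
  summable f C -> (forall k, Rabs (g k) <= B) -> summable (fun k => f k * g k) (C * B).
Proof.
  intros Hf Hg k. rewrite Rabs_mult. specialize (Hf k). specialize (Hg k).
  replace (C * B * / wt k) with ((C * / wt k) * B) by ring.
  apply Rmult_le_compat; auto using Rabs_pos.
Qed.

Lemma continuous_cas_opp (c x : R) : continuous (fun x => cas (- (c * x))) x.
Proof.
  apply continuous_ext with (fun x => cas ((- c) * x)); [|apply continuous_cas0].
  intros y. f_equal; ring.
Qed.

(** The bound on [u] and the decay of [V] dominate the series uniformly in [x], so it may be
    integrated term by term; [cas_mult] then expands each term into four coefficients of [u]. *)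
Lemma fc_mult_zser (u : R -> R) (V : Z -> R) C B k :
  (forall x, continuous u x) -> (forall x, Rabs (u x) <= B) -> summable V C ->
  fc (fun x => u x * zser (fun l => V l * cas (- (IZR l * x)))) k
  = zser (fun l => V l * Amat (fc u) k l).
Proof.
  intros Hu HB HV. pose proof two_PI_pos as Hpi.
  assert (0 <= B) as HB0 by (pose proof (HB 0); pose proof (Rabs_pos (u 0)); lra).
  assert (forall l, is_RInt (fun x => V l * (u x * (cas (- (IZR l * x)) * cas (IZR k * x))))
    (- PI) PI (2 * PI * (V l * Amat (fc u) k l))) as HI.
  { intros l.
    apply is_RInt_Rext with (fun x => V l / 2 *
      ((u x * cas (IZR (k - l) * x) - u x * cas (IZR (l - k) * x)) +
       (u x * cas (IZR (k + l) * x) + u x * cas (IZR (- k - l) * x)))).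
    { intros x. rewrite cas_mult.
      repeat (rewrite ?minus_IZR, ?plus_IZR, ?opp_IZR).
      replace (- (IZR l * x) - IZR k * x) with ((- IZR k - IZR l) * x) by ring.
      replace (IZR k * x - - (IZR l * x)) with ((IZR k + IZR l) * x) by ring.
      replace (- (IZR l * x) + IZR k * x) with ((IZR k - IZR l) * x) by ring.
      replace (- ((IZR k - IZR l) * x)) with ((IZR l - IZR k) * x) by ring. field. }
    replace (2 * PI * (V l * Amat (fc u) k l)) with
      (V l / 2 * ((2 * PI * fc u (k - l) - 2 * PI * fc u (l - k)) +
        (2 * PI * fc u (k + l) + 2 * PI * fc u (- k - l)))) by (unfold Amat; field).
    apply is_RInt_Rscal, is_RInt_Rplus;
      [apply is_RInt_Rminus|apply is_RInt_Rplus]; apply is_RInt_fc; exact Hu. }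
  assert (forall l, Rabs (Amat (fc u) k l) <= 4 * B) as HA.
  { intros l. pose proof (fun j => fc_bound u j B Hu (fun x _ => HB x)) as Hb.
    pose proof (Hb (k - l)%Z) as H1. pose proof (Hb (l - k)%Z) as H2.
    pose proof (Hb (k + l)%Z) as H3. pose proof (Hb (- k - l)%Z) as H4.
    apply Rabs_le_between in H1, H2, H3, H4. unfold Amat. apply Rabs_le; lra. }
  rewrite (fc_unique _ k (2 * PI * zser (fun l => V l * Amat (fc u) k l))).
  { field; lra. }
  rewrite <- (zser_scal _ _ (C * (4 * B))) by (apply summable_mult_bounded; assumption).
  rewrite (zser_ext _ (fun l => RInt (fun x => V l * (u x * (cas (- (IZR l * x)) * cas (IZR k * x)))) (- PI) PI)).
  2:{ intros l. symmetry. apply is_RInt_unique. apply HI. }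
  assert (forall y l, Rabs (u y * (cas (- (IZR l * y)) * cas (IZR k * y))) <= B * (2 * 2)) as Hb.
  { intros y l. rewrite !Rabs_mult.
    apply Rmult_le_compat; try apply Rabs_pos; auto.
    - apply Rmult_le_pos; apply Rabs_pos.
    - apply Rmult_le_compat; auto using Rabs_pos, cas_bound. }
  eapply is_RInt_Rext; [|apply (RInt_zser _ (C * (B * (2 * 2))))].
  - intros x. simpl.
    rewrite (zser_ext _ (fun l => (u x * cas (IZR k * x)) * (V l * cas (- (IZR l * x))))) by (intros; ring).
    rewrite (zser_scal _ _ (C * 2)) by (apply summable_mult_bounded; auto using cas_bound). ring.
  - lra.
  - intros y. apply summable_mult_bounded; auto.
  - intros l y. apply continuous_Rmult; [apply continuous_const|].
    apply continuous_Rmult; [apply Hu|].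
    apply continuous_Rmult; [apply continuous_cas_opp|apply continuous_cas0].
Qed.

Lemma zser_single k f : (forall j, j <> k -> f j = 0) -> zser f = f k.
Proof.
  intros H. apply zser_unique.
  apply is_lim_seq_ext_loc with (fun _ => f k); [|apply is_lim_seq_const].
  exists (Z.abs_nat k). intros n Hn. symmetry. apply zsum_single; [lia|exact H].
Qed.

(** Orthogonality, after termwise integration: for [j = k] the two differences of frequencies
    contribute [2 PI] each, and for [j = - k] the two sums contribute with opposite signs and
    cancel. *)
Lemma fc_zser (U : Z -> R) C k :
  summable U C -> fc (fun x => zser (fun j => U j * cas (IZR j * x))) k = U k.
Proof.
  intros HU. pose proof two_PI_pos as Hpi.
  rewrite (fc_unique _ k (2 * PI * U k)); [field; lra|].
  assert (forall j, is_RInt (fun x => U j * (cas (IZR j * x) * cas (IZR k * x))) (- PI) PI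
    (if Z.eq_dec j k then 2 * PI * U k else 0)) as HI.
  { intros j.
    apply is_RInt_Rext with (fun x => U j / 2 *
      ((cas (IZR (j - k) * x) + cas (IZR (k - j) * x)) +
       (cas (IZR (j + k) * x) - cas (IZR (- (j + k)) * x)))).
    { intros x. rewrite cas_mult.
      repeat (rewrite ?minus_IZR, ?plus_IZR, ?opp_IZR).
      replace (- (IZR j + IZR k) * x) with (- (IZR j * x + IZR k * x)) by ring.
      rewrite !Rmult_plus_distr_r, !Rmult_minus_distr_r. field. }
    match goal with |- is_RInt _ _ _ ?v => replace v with (U j / 2 *
      (((if Z.eq_dec (j - k) 0 then 2 * PI else 0) + (if Z.eq_dec (k - j) 0 then 2 * PI else 0)) +
       ((if Z.eq_dec (j + k) 0 then 2 * PI else 0) - (if Z.eq_dec (- (j + k)) 0 then 2 * PI else 0)))) end.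
    { apply is_RInt_Rscal, is_RInt_Rplus; [apply is_RInt_Rplus|apply is_RInt_Rminus]; apply RInt_cas. }
    destruct (Z.eq_dec j k) as [->|Hne].
    - destruct (Z.eq_dec (k - k) 0); [|lia].
      destruct (Z.eq_dec (k + k) 0); destruct (Z.eq_dec (- (k + k)) 0); try lia; field.
    - destruct (Z.eq_dec (j - k) 0); [lia|]. destruct (Z.eq_dec (k - j) 0); [lia|].
      destruct (Z.eq_dec (j + k) 0); destruct (Z.eq_dec (- (j + k)) 0); try lia; field. }
  assert (2 * PI * U k = zser (fun j => RInt (fun x => U j * (cas (IZR j * x) * cas (IZR k * x))) (- PI) PI)) as ->.
  { rewrite (zser_ext _ (fun j => if Z.eq_dec j k then 2 * PI * U k else 0))
      by (intros j; apply is_RInt_unique, HI).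
    rewrite (zser_single k).
    - destruct (Z.eq_dec k k); [reflexivity|lia].
    - intros j Hj. destruct (Z.eq_dec j k); [lia|reflexivity]. }
  eapply is_RInt_Rext; [|apply (RInt_zser _ (C * (2 * 2)))].
  - intros x. simpl.
    rewrite (zser_ext _ (fun j => cas (IZR k * x) * (U j * cas (IZR j * x)))) by (intros; ring).
    rewrite (zser_scal _ _ (C * 2)) by (apply summable_mult_bounded; auto using cas_bound). ring.
  - lra.
  - intros y. apply summable_mult_bounded; auto. intros j. rewrite Rabs_mult.
    apply Rmult_le_compat; auto using Rabs_pos, cas_bound.
  - intros j y. apply continuous_Rmult; [apply continuous_const|].
    apply continuous_Rmult; apply continuous_cas0.
Qed.

(** * Fourier inversion *)

(** [sin y >= y - y^3 / 6 = y (1 - y^2 / 6)], and [y^2 <= 4]. *)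
Lemma sin_ge_third y : 0 <= y <= 2 -> y / 3 <= sin y.
Proof.
  intros Hy. pose proof (pre_sin_bound y 0 ltac:(lra) ltac:(lra)) as [H _].
  unfold sin_approx, sin_term in H. simpl in H. nra.
Qed.

Lemma sin_le_id y : 0 <= y -> sin y <= y.
Proof.
  intros Hy. destruct (Req_dec y 0) as [->|H]; [rewrite sin_0; lra|].
  left. apply sin_lt_x. lra.
Qed.

Definition dirichlet (N : nat) (z : R) : R := zsum N (fun k => cos (IZR k * z)).

Lemma dirichlet_mult_sin N z :
  dirichlet N z * sin (z / 2) = sin ((INR N + / 2) * z).
Proof.
  unfold dirichlet. induction N as [|N IH]; cbn [zsum].
  - simpl. rewrite Rmult_0_l, cos_0. rewrite Rmult_1_l. f_equal; field.
  - rewrite Rmult_plus_distr_r, IH, opp_IZR, <- INR_IZR_INZ, S_INR.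
    replace (- (INR N + 1) * z) with (- ((INR N + 1) * z)) by ring. rewrite cos_neg.
    replace ((INR N + / 2) * z) with ((INR N + 1) * z - z / 2) by field.
    replace ((INR N + 1 + / 2) * z) with ((INR N + 1) * z + z / 2) by field.
    rewrite sin_minus, sin_plus. ring.
Qed.

Lemma dirichlet_bound N z : Rabs (dirichlet N z) <= 2 * INR N + 1.
Proof.
  unfold dirichlet. eapply Rle_trans; [apply zsum_Rabs|].
  eapply Rle_trans; [apply (zsum_le N _ (fun _ => 1))|].
  - intros k _. pose proof (COS_bound (IZR k * z)). apply Rabs_le; lra.
  - rewrite zsum_const. lra.
Qed.

Lemma continuous_dirichlet N z : continuous (dirichlet N) z.
Proof.
  apply continuous_zsum. intros k _. apply is_derive_cont with (- sin (IZR k * z) * IZR k).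
  auto_derive; [trivial|ring].
Qed.

(** On [[0, de]] with [de = 1 / (N + 1)], the quadratic vanishing of [phi] outweighs the crude bound
    [2 N + 1] of the kernel. Beyond [de] the kernel is [sin (m z) / sin (z / 2)] with [m = N + 1/2],
    and one integration by parts gains [1 / m], because [psi = phi / sin (z / 2)] and its derivative
    stay bounded. The constant [400] rounds up [2 + 2 * 192]. *)
Lemma dirichlet_decay (phi phi' : R -> R) B N :
  (forall z, is_derive phi z (phi' z)) ->
  (forall z, 0 <= z <= PI -> Rabs (phi' z) <= B * z) ->
  (forall z, 0 <= z <= PI -> Rabs (phi z) <= B * (z * z)) ->
  Rabs (RInt (fun z => phi z * dirichlet N z) 0 PI) <= 400 * B / (INR N + 1).
Proof.
  intros Hd Hp' Hp.
  pose proof PI_RGT_0 as Hpi. pose proof PI_4 as Hpi4. pose proof (pos_INR N) as HN.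
  assert (0 <= B) as HB.
  { pose proof (Hp' PI ltac:(lra)). pose proof (Rabs_pos (phi' PI)). nra. }
  assert (1 < PI) as Hpi1 by (pose proof PI2_1; lra).
  set (de := / (INR N + 1)).
  assert (0 < de <= 1) as Hde.
  { split; [apply Rinv_0_lt_compat; lra|]. rewrite <- Rinv_1. apply Rinv_le_contravar; lra. }
  assert (de * (INR N + 1) = 1) as Hde1 by (apply Rinv_l; lra).
  assert (forall z, continuous (fun z => phi z * dirichlet N z) z) as Hc.
  { intros z. apply continuous_Rmult; [eapply is_derive_cont, Hd|apply continuous_dirichlet]. }
  rewrite <- (RInt_Chasles (fun z => phi z * dirichlet N z) 0 de PI) by (apply ex_RInt_cont, Hc).
  assert (Rabs (RInt (fun z => phi z * dirichlet N z) 0 de) <= 2 * B * de) as H1.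
  { eapply Rle_trans; [apply (is_RInt_abs_le _ 0 de _ (B * (de * de) * (2 * INR N + 1)) ltac:(lra) (is_RInt_cont _ _ _ Hc))|].
    - intros x Hx. rewrite Rabs_mult. apply Rmult_le_compat; auto using Rabs_pos, dirichlet_bound.
      eapply Rle_trans; [apply Hp; lra|]. apply Rmult_le_compat_l; [lra|].
      apply Rmult_le_compat; lra.
    - assert (2 * INR N + 1 <= 2 * (INR N + 1)) by lra.
      assert (de * (2 * INR N + 1) <= 2) by nra.
      replace ((de - 0) * (B * (de * de) * (2 * INR N + 1)))
        with (B * de * (de * (de * (2 * INR N + 1)))) by ring.
      replace (2 * B * de) with (B * de * 2) by ring.
      apply Rmult_le_compat_l; nra. }
  set (m := INR N + / 2).
  assert (0 < m) as Hm by (unfold m; lra).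
  set (psi := fun z => phi z / sin (z / 2)).
  set (psi' := fun z => (phi' z * sin (z / 2) - phi z * (cos (z / 2) / 2)) / (sin (z / 2) * sin (z / 2))).
  assert (forall z, 0 < z <= PI -> z / 6 <= sin (z / 2) <= z / 2) as Hs.
  { intros z Hz. split.
    - pose proof (sin_ge_third (z / 2) ltac:(lra)). lra.
    - apply sin_le_id; lra. }
  assert (forall z, 0 < z <= PI -> Rabs (psi z) <= 24 * B) as Hpsi.
  { intros z Hz. unfold psi, Rdiv. pose proof (Hs z Hz) as Hsz. rewrite Rabs_mult, Rabs_inv.
    rewrite (Rabs_pos_eq (sin _)) by lra.
    apply Rmult_le_reg_r with (sin (z / 2)); [lra|].
    unfold Rdiv. rewrite Rmult_assoc, Rinv_l, Rmult_1_r by (unfold Rdiv in Hsz; lra).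
    pose proof (Hp z ltac:(lra)). fold (z / 2).
    assert (B * (z * z) <= 24 * B * (z / 6)).
    { replace (24 * B * (z / 6)) with (B * (z * 4)) by field.
      apply Rmult_le_compat_l; [lra|]. apply Rmult_le_compat_l; lra. }
    assert (24 * B * (z / 6) <= 24 * B * sin (z / 2)) by (apply Rmult_le_compat_l; lra). lra. }
  assert (forall z, 0 < z <= PI -> Rabs (psi' z) <= 36 * B) as Hpsi'.
  { intros z Hz. unfold psi', Rdiv. pose proof (Hs z Hz) as Hsz.
    fold (z / 2). fold (cos (z / 2) / 2).
    set (s := sin (z / 2)) in *. assert (0 < s) by lra. assert (0 < s * s) by nra.
    rewrite Rabs_mult, Rabs_inv, (Rabs_pos_eq (s * s)) by lra.
    apply Rmult_le_reg_r with (s * s); [lra|].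
    rewrite Rmult_assoc, Rinv_l, Rmult_1_r by lra.
    pose proof (Hp z ltac:(lra)). pose proof (Hp' z ltac:(lra)).
    pose proof (Rabs_triang (phi' z * s) (- (phi z * (cos (z / 2) / 2)))) as Ht.
    fold (phi' z * s - phi z * (cos (z / 2) / 2)) in Ht.
    rewrite Rabs_Ropp, !Rabs_mult, (Rabs_pos_eq s) in Ht by lra.
    assert (Rabs (cos (z / 2) / 2) <= / 2) by (pose proof (COS_bound (z / 2)); apply Rabs_le; lra).
    assert (Rabs (phi' z) * s <= B * z * (z / 2)) by (apply Rmult_le_compat; auto using Rabs_pos; lra).
    assert (Rabs (phi z) * Rabs (cos (z / 2) / 2) <= B * (z * z) * / 2)
      by (apply Rmult_le_compat; auto using Rabs_pos).
    assert (B * (z * z) <= 36 * B * (s * s)).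
    { replace (B * (z * z)) with (36 * B * (z / 6 * (z / 6))) by field.
      apply Rmult_le_compat_l; [lra|]. apply Rmult_le_compat; lra. }
    lra. }
  (* Integration by parts cast as a mean value estimate: differentiating the cosine cancels the
     integrand, so the derivative of [Q] is [psi' z cos (m z) / m] and no integral of [psi'] is
     formed. *)
  set (Q := fun z => RInt (fun z => phi z * dirichlet N z) de z + psi z * cos (m * z) / m).
  assert (Rabs (Q PI - Q de) <= 36 * B / m * (PI - de)) as HQ.
  { assert (forall z, de <= z <= PI -> is_derive Q z (psi' z * cos (m * z) / m)) as HQd.
    { intros z Hz. pose proof (Hs z ltac:(lra)) as Hsz. unfold Q.
      assert (psi' z * cos (m * z) / m =
        phi z * dirichlet N z + (psi' z * (cos (m * z) / m) + psi z * - sin (m * z))) as ->.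
      { pose proof (dirichlet_mult_sin N z) as Hdz. fold m in Hdz. rewrite <- Hdz.
        unfold psi. field. lra. }
      apply (is_derive_plus (fun z => RInt (fun z => phi z * dirichlet N z) de z)
        (fun z => psi z * cos (m * z) / m)).
      - apply (is_derive_RInt (fun z => phi z * dirichlet N z) _ de).
        + apply filter_forall. intros y. apply is_RInt_cont, Hc.
        + apply Hc.
      - apply is_derive_ext with (fun z => psi z * (cos (m * z) / m)).
        { intros t; unfold Rdiv; simpl; ring. }
        apply (is_derive_mult psi (fun z => cos (m * z) / m)); [| |intros; apply Rmult_comm].
        + unfold psi, psi'.
          assert (is_derive (fun z => sin (z / 2)) z (cos (z / 2) / 2)) as Hsd
            by (auto_derive; [trivial|unfold Rdiv; field]).
          evar_last; [apply (is_derive_div phi (fun z => sin (z / 2)) z _ _ (Hd z) Hsd); lra|].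
          simpl. field. lra.
        + auto_derive; [trivial|]. field; lra. }
    apply (mvt_Rabs_le Q (fun z => psi' z * cos (m * z) / m)); [lra| | |].
    - intros x Hx. apply HQd; lra.
    - intros x Hx. eapply is_derive_continuity_pt, HQd; lra.
    - intros x Hx. unfold Rdiv. rewrite !Rabs_mult, Rabs_inv, (Rabs_pos_eq m) by lra.
      apply Rmult_le_compat_r; [left; apply Rinv_0_lt_compat; lra|].
      rewrite <- (Rmult_1_r (36 * B)). apply Rmult_le_compat; auto using Rabs_pos.
      + apply Hpsi'; lra.
      + pose proof (COS_bound (m * x)). apply Rabs_le; lra. }
  assert (forall z, 0 < z <= PI -> Rabs (psi z * cos (m * z) / m) <= 24 * B / m) as Hb.
  { intros z Hz. unfold Rdiv. rewrite !Rabs_mult, Rabs_inv, (Rabs_pos_eq m) by lra.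
    apply Rmult_le_compat_r; [left; apply Rinv_0_lt_compat; lra|].
    rewrite <- (Rmult_1_r (24 * B)). apply Rmult_le_compat; auto using Rabs_pos.
    pose proof (COS_bound (m * z)). apply Rabs_le; lra. }
  assert (Rabs (RInt (fun z => phi z * dirichlet N z) de PI) <= 192 * B / m) as H2.
  { unfold Q in HQ. rewrite RInt_point in HQ. unfold zero in HQ; simpl in HQ.
    pose proof (Hb PI ltac:(lra)) as Hb1. pose proof (Hb de ltac:(lra)) as Hb2.
    assert (0 <= B / m) by (apply Rdiv_le_0_compat; lra).
    assert (36 * B / m * (PI - de) <= 144 * (B / m)).
    { replace (36 * B / m * (PI - de)) with (36 * (B / m) * (PI - de)) by (unfold Rdiv; ring). nra. }
    replace (24 * B / m) with (24 * (B / m)) in * by (unfold Rdiv; ring).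
    replace (192 * B / m) with (192 * (B / m)) in * by (unfold Rdiv; ring).
    apply Rabs_le_between in Hb1, Hb2, HQ. apply Rabs_le.
    lra. }
  assert (B / m <= 2 * (B * de)).
  { unfold Rdiv. replace (2 * (B * de)) with (B * (2 * de)) by ring.
    apply Rmult_le_compat_l; [lra|]. unfold de.
    replace (2 * / (INR N + 1)) with (/ ((INR N + 1) / 2)) by (field; lra).
    apply Rinv_le_contravar; unfold m; lra. }
  replace (192 * B / m) with (192 * (B / m)) in H2 by (unfold Rdiv; ring).
  unfold plus; simpl.
  eapply Rle_trans; [apply Rabs_triang|].
  replace (400 * B / (INR N + 1)) with (400 * (B * de)) by (unfold de, Rdiv; ring).
  assert (0 <= B * de) by (apply Rmult_le_pos; lra).
  lra.
Qed.

Lemma RInt_period_shift (F : R -> R) P a x :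
  (forall y, continuous F y) -> (forall y, F (y + P) = F y) ->
  is_RInt (fun z => F (x + z)) a (a + P) (RInt F a (a + P)).
Proof.
  intros Hc Hp.
  assert (forall u v, ex_RInt F u v) as Hex by (intros; apply ex_RInt_cont, Hc).
  assert (forall x u v, is_RInt (fun z => F (x + z)) u v (RInt F (x + u) (x + v))) as Hsh.
  { clear x. intros x u v. eapply is_RInt_Rext; [|apply (is_RInt_comp_lin F 1 x u v)].
    - intros y. unfold scal; simpl; unfold mult; simpl. rewrite Rmult_1_l. f_equal; ring.
    - rewrite !Rmult_1_l, (Rplus_comm u), (Rplus_comm v). apply is_RInt_cont, Hc. }
  replace (RInt F a (a + P)) with (RInt F (x + a) (x + (a + P))); [apply Hsh|].
  assert (RInt F (a + P) (x + (a + P)) = RInt F a (x + a)) as H1.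
  { replace (a + P) with (P + a) by ring. replace (x + (P + a)) with (P + (x + a)) by ring.
    rewrite <- (is_RInt_unique _ _ _ _ (Hsh P a (x + a))).
    apply RInt_ext. intros z _. rewrite Rplus_comm. apply Hp. }
  rewrite <- (RInt_Chasles F (x + a) a (x + (a + P))), <- (RInt_Chasles F a (a + P) (x + (a + P))) by auto.
  rewrite H1, <- (opp_RInt_swap F) by auto. unfold plus, opp; simpl. ring.
Qed.

Lemma RInt_cos_half k :
  is_RInt (fun z => cos (IZR k * z)) 0 PI (if Z.eq_dec k 0 then PI else 0).
Proof.
  destruct (Z.eq_dec k 0) as [->|Hk].
  - apply is_RInt_Rext with (fun _ => 1).
    { intros x. rewrite Rmult_0_l, cos_0. ring. }
    replace PI with (scal (PI - 0) 1) at 2 by (unfold scal; simpl; unfold mult; simpl; ring).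
    apply (@is_RInt_const R_NormedModule).
  - assert (IZR k <> 0) as Hk' by (apply not_0_IZR; exact Hk).
    replace 0 with (minus (sin (IZR k * PI) / IZR k) (sin (IZR k * 0) / IZR k)) at 2.
    + apply (@is_RInt_derive R_CompleteNormedModule (fun x => sin (IZR k * x) / IZR k)).
      * intros x _. auto_derive; [trivial|]. field; exact Hk'.
      * intros x _. apply is_derive_cont with (- sin (IZR k * x) * IZR k).
        auto_derive; [trivial|ring].
    + rewrite sin_IZR_PI, Rmult_0_r, sin_0. unfold minus, plus, opp; simpl. field; exact Hk'.
Qed.

Lemma RInt_dirichlet N : is_RInt (dirichlet N) 0 PI PI.
Proof.
  pose proof (is_RInt_zsum N _ _ 0 PI RInt_cos_half) as H.
  rewrite (zsum_single N 0%Z) in H; [exact H|lia|].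
  intros j Hj. destruct (Z.eq_dec j 0); [lia|reflexivity].
Qed.

Lemma dirichlet_opp N z : dirichlet N (- z) = dirichlet N z.
Proof.
  apply zsum_ext. intros k _. rewrite <- (cos_neg (IZR k * z)). f_equal; ring.
Qed.

Lemma dirichlet_period N z : dirichlet N (z + 2 * PI) = dirichlet N z.
Proof.
  apply zsum_ext. intros k _.
  pose proof (cas_period k z) as H1. pose proof (cas_period (- k) z) as H2.
  unfold cas in *. rewrite opp_IZR in H2.
  replace (- IZR k * (z + 2 * PI)) with (- (IZR k * (z + 2 * PI))) in H2 by ring.
  replace (- IZR k * z) with (- (IZR k * z)) in H2 by ring.
  rewrite !cos_neg, !sin_neg in H2. lra.
Qed.

(** Partial sums are integrals against the Dirichlet kernel. Folding the period onto [[0, PI]] by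
    evenness, and using that the kernel has integral [PI] there, brings out the second difference of
    [f] at [x]. *)
Lemma fc_partial_sum f x N :
  (forall y, continuous f y) -> (forall y, f (y + 2 * PI) = f y) ->
  2 * PI * (zsum N (fun k => fc f k * cas (IZR k * x)) - f x)
  = RInt (fun z => (f (x + z) + f (x - z) - 2 * f x) * dirichlet N z) 0 PI.
Proof.
  intros Hc Hp. pose proof PI_RGT_0 as Hpi.
  set (F := fun y => f y * dirichlet N (y - x)).
  assert (forall y, continuous F y) as HFc.
  { intros y. apply continuous_Rmult; [apply Hc|].
    apply (continuous_comp (fun y => y - x) (dirichlet N)).
    - apply continuous_Rminus; [apply continuous_id|apply continuous_const].
    - apply continuous_dirichlet. }
  assert (forall y, F (y + 2 * PI) = F y) as HFp.
  { intros y. unfold F. rewrite Hp. f_equal.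
    replace (y + 2 * PI - x) with (y - x + 2 * PI) by ring. apply dirichlet_period. }
  assert (is_RInt F (- PI) PI (2 * PI * zsum N (fun k => fc f k * cas (IZR k * x)))) as H1.
  { rewrite <- zsum_scal.
    eapply is_RInt_Rext; [|apply (is_RInt_zsum N
      (fun k y => cas (IZR k * x) * (f y * cas (IZR k * y))))].
    - intros y. unfold F, dirichlet. simpl. rewrite <- zsum_scal.
      rewrite <- (Rmult_1_l (zsum N (fun k => f y * _))).
      (* Averaging over [k] and [-k] turns [cas (k x) cas (k y)] into [cos (k (y - x))]: the mixed
         products of sine and cosine are odd in [k]. *)
      assert (forall g : Z -> R, zsum N g = / 2 * zsum N (fun k => g k + g (- k)%Z)) as Hsym.
      { intros g. rewrite zsum_plus, zsum_reflect. field. }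
      rewrite Rmult_1_l, Hsym, (Hsym (fun k => f y * _)). f_equal.
      apply zsum_ext. intros k _. rewrite opp_IZR. unfold cas.
      replace (- IZR k * x) with (- (IZR k * x)) by ring.
      replace (- IZR k * y) with (- (IZR k * y)) by ring.
      replace (IZR k * (y - x)) with (IZR k * y - IZR k * x) by ring.
      replace (- IZR k * (y - x)) with (IZR k * x - IZR k * y) by ring.
      rewrite !cos_neg, !sin_neg, !cos_minus. ring.
    - intros k. replace (2 * PI * (fc f k * cas (IZR k * x)))
        with (cas (IZR k * x) * (2 * PI * fc f k)) by ring.
      apply is_RInt_Rscal, is_RInt_fc, Hc. }
  pose proof (RInt_period_shift F (2 * PI) (- PI) x HFc HFp) as H2.
  replace (- PI + 2 * PI) with PI in H2 by ring.
  rewrite (is_RInt_unique _ _ _ _ H1) in H2.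
  set (g := fun z => F (x + z)) in *.
  assert (forall z, continuous g z) as Hg.
  { intros z. apply (continuous_comp (fun z => x + z) F); [|apply HFc].
    apply continuous_Rplus; [apply continuous_const|apply continuous_id]. }
  assert (is_RInt (fun z => g (- z)) 0 PI (RInt g (- PI) 0)) as H3.
  { eapply is_RInt_Rext; [|apply (is_RInt_comp_lin (fun z => -1 * g z) (-1) 0 0 PI)].
    - intros z. unfold scal; simpl; unfold mult; simpl.
      replace (-1 * z + 0) with (- z) by ring. ring.
    - replace (-1 * 0 + 0) with 0 by ring. replace (-1 * PI + 0) with (- PI) by ring.
      replace (RInt g (- PI) 0) with (-1 * RInt g 0 (- PI)).
      + apply is_RInt_Rscal, is_RInt_cont, Hg.
      + rewrite <- (opp_RInt_swap g 0 (- PI)) by (apply ex_RInt_cont, Hg).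
        unfold opp; simpl. ring. }
  rewrite Rmult_minus_distr_l, <- (is_RInt_unique _ _ _ _ H2).
  symmetry. apply is_RInt_unique.
  rewrite <- (RInt_Chasles g (- PI) 0 PI) by (apply ex_RInt_cont, Hg).
  replace (2 * PI * f x) with (2 * f x * PI) by ring.
  eapply is_RInt_Rext; [|apply is_RInt_Rminus; [apply is_RInt_Rplus;
     [exact H3|apply is_RInt_cont, Hg]|apply is_RInt_Rscal, (RInt_dirichlet N)]].
  intros z. simpl. unfold g, F.
  replace (x + - z - x) with (- z) by ring. replace (x + z - x) with z by ring.
  rewrite dirichlet_opp. replace (x + - z) with (x - z) by ring. ring.
Qed.

(** A bounded second derivative makes the second difference at most [2 M z^2], so [dirichlet_decay]
    applies and gives convergence at rate [1 / (N + 1)]. *)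
Theorem fourier_inversion (f f' f'' : R -> R) M x :
  (forall y, is_derive f y (f' y)) -> (forall y, is_derive f' y (f'' y)) ->
  (forall y, Rabs (f'' y) <= M) -> (forall y, f (y + 2 * PI) = f y) ->
  is_lim_seq (fun N => zsum N (fun k => fc f k * cas (IZR k * x))) (f x).
Proof.
  intros Hd Hd' HM Hp. pose proof two_PI_pos as Hpi.
  assert (0 <= M) as HM0 by (pose proof (HM 0); pose proof (Rabs_pos (f'' 0)); lra).
  set (phi := fun z => f (x + z) + f (x - z) - 2 * f x).
  set (phi' := fun z => f' (x + z) - f' (x - z)).
  assert (forall z, is_derive phi z (phi' z)) as Hphi.
  { intros z. unfold phi, phi'.
    auto_derive.
    - repeat split; eexists; apply Hd.
    - assert (forall y, Derive (fun y : R => f y) y = f' y) as HD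
        by (intros y; apply is_derive_unique, Hd).
      rewrite !HD. replace (x + - z) with (x - z) by ring. ring. }
  assert (forall z, 0 <= z <= PI -> Rabs (phi' z) <= 2 * M * z) as H1.
  { intros z Hz. unfold phi'. replace (2 * M * z) with (M * (x + z - (x - z))) by ring.
    apply (mvt_Rabs_le f' f''); [lra| | |]; intros; auto.
    eapply is_derive_continuity_pt, Hd'. }
  assert (forall z, 0 <= z <= PI -> Rabs (phi z) <= 2 * M * (z * z)) as H2.
  { intros z Hz. replace (phi z) with (phi z - phi 0)
      by (unfold phi; rewrite Rplus_0_r, Rminus_0_r; ring).
    replace (2 * M * (z * z)) with (2 * M * z * (z - 0)) by ring.
    apply (mvt_Rabs_le phi phi'); [lra| | |]; intros; auto.
    - eapply is_derive_continuity_pt, Hphi.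
    - eapply Rle_trans; [apply H1; lra|]. apply Rmult_le_compat_l; lra. }
  apply is_lim_seq_of_bound with (/ (2 * PI) * (400 * (2 * M))). intros N.
  pose proof (dirichlet_decay phi phi' (2 * M) N Hphi H1 H2) as Hb.
  unfold phi in Hb. rewrite <- fc_partial_sum in Hb;
    [|intros; eapply is_derive_cont, Hd|exact Hp].
  rewrite Rabs_mult, (Rabs_pos_eq (2 * PI)) in Hb by lra.
  apply Rmult_le_reg_l with (2 * PI); [lra|].
  eapply Rle_trans; [exact Hb|]. right. pose proof (pos_INR N). field. split; lra.
Qed.

(** * Commutator structure of the transport term *)

(** Young's inequality with [g] in l1 and [x], [y] in l2: after [x_k y_l <= (x_k^2 + y_l^2) / 2],
    every row and column sum of [g] is at most [Gam]. *)
Lemma young_l1 N (g x y : Z -> R) Gam :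
  (forall j, 0 <= g j) -> (forall n, zsum n g <= Gam) ->
  zsum N (fun k => zsum N (fun l => g (k - l)%Z * (x k * y l)))
  <= Gam / 2 * (zsum N (fun k => x k * x k) + zsum N (fun k => y k * y k)).
Proof.
  intros Hg HG.
  apply Rle_trans with (zsum N (fun k => zsum N (fun l =>
    x k * x k / 2 * g (k - l)%Z + y l * y l / 2 * g (k - l)%Z))).
  { apply zsum_le; intros k _. apply zsum_le; intros l _.
    pose proof (Hg (k - l)%Z). assert (x k * y l <= (x k * x k + y l * y l) / 2).
    { pose proof (Rle_0_sqr (x k - y l)). unfold Rsqr in *. lra. }
    nra. }
  erewrite zsum_ext; [|intros k _; apply zsum_plus]. rewrite zsum_plus.
  rewrite (zsum_swap N N (fun k l => y l * y l / 2 * g (k - l)%Z)).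
  apply Rle_trans with (zsum N (fun k => Gam / 2 * (x k * x k)) + zsum N (fun k => Gam / 2 * (y k * y k))).
  2:{ rewrite !zsum_scal. lra. }
  apply Rplus_le_compat; apply zsum_le; intros k _; rewrite zsum_scal.
  - pose proof (zsum_shift_bound' N k g Gam Hg HG).
    pose proof (Rle_0_sqr (x k)). unfold Rsqr in *. nra.
  - pose proof (zsum_shift_bound N (- k) g Gam Hg HG) as H.
    rewrite (zsum_ext N _ (fun l => g (- k + l)%Z)) by (intros; f_equal; lia).
    pose proof (Rle_0_sqr (y k)). unfold Rsqr in *. nra.
Qed.

(** The companion with [y] in l1 and [g], [x] in l2: at fixed [l] the square is completed between
    [g (k - l)] and [x k]. It serves when the velocity carries the highest derivatives. *)
Lemma young_l2 N (g x y : Z -> R) Gam :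
  (forall j, 0 <= y j) -> (forall n, zsum n (fun j => g j * g j) <= Gam) ->
  zsum N (fun k => zsum N (fun l => g (k - l)%Z * (x k * y l)))
  <= zsum N y * ((Gam + zsum N (fun k => x k * x k)) / 2).
Proof.
  intros Hy HG. rewrite zsum_swap, <- zsum_scal_r.
  apply zsum_le; intros l _.
  apply Rle_trans with (zsum N (fun k => y l * ((g (k - l)%Z * g (k - l)%Z + x k * x k) / 2))).
  { apply zsum_le; intros k _. pose proof (Hy l).
    assert (g (k - l)%Z * x k <= (g (k - l)%Z * g (k - l)%Z + x k * x k) / 2).
    { pose proof (Rle_0_sqr (g (k - l)%Z - x k)). unfold Rsqr in *. lra. }
    nra. }
  rewrite zsum_scal. apply Rmult_le_compat_l; [apply Hy|].
  unfold Rdiv. rewrite zsum_scal_r, zsum_plus. apply Rmult_le_compat_r; [lra|].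
  apply Rplus_le_compat_r.
  rewrite (zsum_ext N _ (fun k => (fun j => g j * g j) (- l + k)%Z))
    by (intros k _; replace (k - l)%Z with (- l + k)%Z by lia; reflexivity).
  apply (zsum_shift_bound N (- l) (fun j => g j * g j)); [|exact HG]. intros j. apply Rle_0_sqr.
Qed.

(** An even majorant of [|G|]: bounds on [Amat] in terms of it are unchanged when [k] and [l] are
    exchanged. *)
Definition evn (G : Z -> R) (j : Z) : R := Rabs (G j) + Rabs (G (- j)%Z).

Lemma evn_nonneg G j : 0 <= evn G j.
Proof. unfold evn. pose proof (Rabs_pos (G j)). pose proof (Rabs_pos (G (- j)%Z)). lra. Qed.

Lemma evn_opp G j : evn G (- j)%Z = evn G j.
Proof. unfold evn. rewrite Z.opp_involutive. ring. Qed.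

Lemma zsum_evn_weight N G m :
  (forall j, m (- j)%Z = m j) ->
  zsum N (fun j => m j * evn G j) = 2 * zsum N (fun j => m j * Rabs (G j)).
Proof.
  intros Hm. unfold evn.
  rewrite (zsum_ext N _ (fun j => m j * Rabs (G j) + (fun j => m j * Rabs (G j)) (- j)%Z))
    by (intros; rewrite Hm; ring).
  rewrite zsum_plus, (zsum_reflect N (fun j => m j * Rabs (G j))). ring.
Qed.

Lemma zsum_evn_sqr N G (m : Z -> R) :
  (forall j, Rabs (m (- j)%Z) = Rabs (m j)) ->
  zsum N (fun j => (Rabs (m j) * evn G j) * (Rabs (m j) * evn G j))
  <= 4 * zsum N (fun j => m j * m j * (G j * G j)).
Proof.
  intros Hm. set (q := fun j => m j * m j * (G j * G j)).
  apply Rle_trans with (zsum N (fun j => 2 * (q j + q (- j)%Z))).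
  - apply zsum_le. intros j _. unfold q, evn.
    assert (forall x : R, x * x = Rabs x * Rabs x) as Hsq by (intros x; apply Rsqr_abs).
    rewrite (Hsq (m j)), (Hsq (G j)), (Hsq (m (- j)%Z)), (Hsq (G (- j)%Z)), Hm.
    set (a := Rabs (m j)). set (b := Rabs (G j)). set (c := Rabs (G (- j)%Z)).
    pose proof (Rle_0_sqr (a * (b - c))). unfold Rsqr in *. nra.
  - rewrite zsum_scal, zsum_plus, zsum_reflect. lra.
Qed.

Lemma Amat_bound G k l : Rabs (Amat G k l) <= (evn G (k - l) + evn G (k + l)) / 2.
Proof.
  unfold Amat, evn.
  replace (- (k - l))%Z with (l - k)%Z by lia. replace (- (k + l))%Z with (- k - l)%Z by lia.
  pose proof (Rabs_triang (G (k - l)%Z - G (l - k)%Z) (G (k + l)%Z + G (- k - l)%Z)).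
  pose proof (Rabs_triang (G (k - l)%Z) (- G (l - k)%Z)).
  pose proof (Rabs_triang (G (k + l)%Z) (G (- k - l)%Z)).
  rewrite Rabs_Ropp in *. unfold Rdiv. rewrite Rabs_mult, (Rabs_pos_eq (/ 2)) by lra.
  replace (G (k - l)%Z - G (l - k)%Z + G (k + l)%Z + G (- k - l)%Z)
    with (G (k - l)%Z - G (l - k)%Z + (G (k + l)%Z + G (- k - l)%Z)) by ring.
  unfold Rminus in *. lra.
Qed.

(** Exchanging [k] and [l] replaces the unbounded factor [m k * l] by a
    commutator of size [k - l]; the part of [Amat] in [k + l] is turned into a
    part in [k - l] by [l -> - l]. *)
Lemma transport_symmetrized N G (m h : Z -> R) :
  (forall k, m (- k)%Z = m k) ->
  Rabs (zsum N (fun k => zsum N (fun l => m k * h k * (Amat G k l * (IZR l * h l)))))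
  <= / 4 * zsum N (fun k => zsum N (fun l =>
       evn G (k - l) * (Rabs (IZR l * m k - IZR k * m l) * (Rabs (h k) * evn h l)))).
Proof.
  intros Hm.
  set (T := fun k l => m k * h k * (Amat G k l * (IZR l * h l))).
  change (Rabs (zsum N (fun k => zsum N (fun l => T k l))) <=
    / 4 * zsum N (fun k => zsum N (fun l =>
       evn G (k - l) * (Rabs (IZR l * m k - IZR k * m l) * (Rabs (h k) * evn h l))))).
  assert (zsum N (fun k => zsum N (fun l => T k l)) =
    / 2 * zsum N (fun k => zsum N (fun l => T k l + T l k))) as ->.
  { rewrite (zsum_ext N (fun k => zsum N (fun l => T k l + T l k))
      (fun k => zsum N (fun l => T k l) + zsum N (fun l => T l k))) by (intros; apply zsum_plus).
    rewrite zsum_plus, (zsum_swap N N (fun k l => T l k)). field. }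
  rewrite Rabs_mult, (Rabs_pos_eq (/ 2)) by lra.
  replace (/ 4) with (/ 2 * / 2) by field. rewrite Rmult_assoc.
  apply Rmult_le_compat_l; [lra|].
  eapply Rle_trans; [apply zsum_Rabs|].
  set (w := fun k l => evn G (k - l) * Rabs (IZR l * m k - IZR k * m l) * Rabs (h k)).
  apply Rle_trans with (zsum N (fun k => / 2 * zsum N (fun l =>
    w k l * Rabs (h l) + (fun l => w k l * Rabs (h (- l)%Z)) (- l)%Z))).
  2:{ rewrite zsum_scal. apply Rmult_le_compat_l; [lra|]. apply zsum_le; intros k _.
      rewrite zsum_plus, (zsum_reflect N (fun l => w k l * Rabs (h (- l)%Z))), <- zsum_plus.
      apply zsum_le; intros l _. right. unfold w, evn. ring. }
  apply zsum_le; intros k _. eapply Rle_trans; [apply zsum_Rabs|].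
  rewrite <- zsum_scal. apply zsum_le; intros l _.
  unfold w, T. rewrite opp_IZR, Hm, Z.opp_involutive.
  replace (k - - l)%Z with (k + l)%Z by lia.
  (* Exchanging [k] and [l] changes the sign of [D] and preserves [P], so [D] comes with
     [l m_k - k m_l] and [P] with [l m_k + k m_l]; the reflection of [l] carries the second factor
     into the first up to sign. *)
  set (D := G (k - l)%Z - G (l - k)%Z). set (P := G (k + l)%Z + G (- k - l)%Z).
  assert (Rabs D <= evn G (k - l)) as HD.
  { unfold D, evn. replace (- (k - l))%Z with (l - k)%Z by lia.
    eapply Rle_trans; [apply Rabs_triang|]. rewrite Rabs_Ropp. lra. }
  assert (Rabs P <= evn G (k + l)) as HP.
  { unfold P, evn. replace (- (k + l))%Z with (- k - l)%Z by lia. apply Rabs_triang. }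
  assert (Amat G k l = (D + P) / 2) as -> by (unfold Amat, D, P; field).
  assert (Amat G l k = (P - D) / 2) as ->.
  { unfold Amat, D, P. replace (l + k)%Z with (k + l)%Z by lia.
    replace (- l - k)%Z with (- k - l)%Z by lia. field. }
  replace (m k * h k * ((D + P) / 2 * (IZR l * h l)) + m l * h l * ((P - D) / 2 * (IZR k * h k)))
    with (/ 2 * (h k * h l * D * (IZR l * m k - IZR k * m l)
           + h k * h l * P * (IZR l * m k + IZR k * m l))) by field.
  rewrite Rabs_mult, (Rabs_pos_eq (/ 2)) by lra. apply Rmult_le_compat_l; [lra|].
  eapply Rle_trans; [apply Rabs_triang|]. rewrite !Rabs_mult.
  replace (- IZR l * m k - IZR k * m l) with (- (IZR l * m k + IZR k * m l)) by ring.
  rewrite Rabs_Ropp.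
  pose proof (Rabs_pos (h k)). pose proof (Rabs_pos (h l)).
  apply Rplus_le_compat.
  - replace (evn G (k - l) * Rabs (IZR l * m k - IZR k * m l) * Rabs (h k) * Rabs (h l))
      with (Rabs (h k) * Rabs (h l) * evn G (k - l) * Rabs (IZR l * m k - IZR k * m l)) by ring.
    apply Rmult_le_compat_r; [apply Rabs_pos|]. apply Rmult_le_compat_l; [nra|exact HD].
  - replace (evn G (k + l) * Rabs (IZR l * m k + IZR k * m l) * Rabs (h k) * Rabs (h l))
      with (Rabs (h k) * Rabs (h l) * evn G (k + l) * Rabs (IZR l * m k + IZR k * m l)) by ring.
    apply Rmult_le_compat_r; [apply Rabs_pos|]. apply Rmult_le_compat_l; [nra|exact HP].
Qed.

Lemma pow_diff_bound n (x y : R) :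
  Rabs (x ^ S n - y ^ S n) <= INR (S n) * Rabs (x - y) * (Rabs x ^ n + Rabs y ^ n).
Proof.
  set (m := Rmax (Rabs x) (Rabs y)).
  assert (Rabs x <= m) by apply Rmax_l. assert (Rabs y <= m) by apply Rmax_r.
  pose proof (Rabs_pos x). pose proof (Rabs_pos y).
  assert (m ^ n <= Rabs x ^ n + Rabs y ^ n) as Hm.
  { pose proof (pow_le (Rabs x) n ltac:(lra)). pose proof (pow_le (Rabs y) n ltac:(lra)).
    unfold m. apply Rmax_case; lra. }
  apply Rle_trans with (INR (S n) * Rabs (x - y) * m ^ n).
  2:{ apply Rmult_le_compat_l; [|exact Hm]. apply Rmult_le_pos; [apply pos_INR|apply Rabs_pos]. }
  clear Hm. induction n as [|n IH].
  - simpl. rewrite !Rmult_1_r, Rmult_1_l. lra.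
  - replace (x ^ S (S n) - y ^ S (S n)) with (x * (x ^ S n - y ^ S n) + (x - y) * y ^ S n) by (simpl; ring).
    eapply Rle_trans; [apply Rabs_triang|]. rewrite !Rabs_mult, <- RPow_abs.
    assert (Rabs x * Rabs (x ^ S n - y ^ S n) <= m * (INR (S n) * Rabs (x - y) * m ^ n))
      by (apply Rmult_le_compat; auto using Rabs_pos).
    assert (Rabs (x - y) * Rabs y ^ S n <= Rabs (x - y) * m ^ S n)
      by (apply Rmult_le_compat_l; [apply Rabs_pos|apply pow_incr; lra]).
    rewrite (S_INR (S n)). simpl (m ^ S n) in *. nra.
Qed.

Lemma pow_plus_bound n (b c : R) : 0 <= b -> 0 <= c -> (b + c) ^ n <= 2 ^ n * (b ^ n + c ^ n).
Proof.
  intros Hb Hc.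
  assert (forall b c, 0 <= c <= b -> (b + c) ^ n <= 2 ^ n * (b ^ n + c ^ n)) as H.
  { clear. intros b c H. apply Rle_trans with ((2 * b) ^ n).
    - apply pow_incr; lra.
    - rewrite Rpow_mult_distr. apply Rmult_le_compat_l; [apply pow_le; lra|].
      pose proof (pow_le c n ltac:(lra)). lra. }
  destruct (Rle_dec c b); [apply H; lra|].
  rewrite Rplus_comm, (Rplus_comm (b ^ n)). apply H; lra.
Qed.

(** With [s = p + 1] the commutator is [x y (x^(2p+1) - y^(2p+1))], and the difference of powers
    yields a factor [|x - y|] beside [|x|^(2p) + |y|^(2p)]. One of the two factors [|x|^p] is then
    replaced by [2^p (|y|^p + |x - y|^p)], and symmetrically for [y], so that no variable carries
    more than the power [s]. *)
Lemma commutator_weight p (x y : R) :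
  let s := S p in
  Rabs (y * (x ^ s * x ^ s) - x * (y ^ s * y ^ s)) <=
  INR (S (2 * p)) * 2 ^ p *
   (2 * (Rabs (x - y) * (Rabs x ^ s * Rabs y ^ s))
    + Rabs (x - y) ^ s * (Rabs x ^ s * Rabs y)
    + Rabs (x - y) ^ s * (Rabs x * Rabs y ^ s)).
Proof.
  intros s.
  replace (y * (x ^ s * x ^ s) - x * (y ^ s * y ^ s))
    with (x * y * (x ^ S (2 * p) - y ^ S (2 * p))).
  2:{ unfold s. replace (2 * p)%nat with (p + p)%nat by lia.
      cbn [pow]. rewrite !pow_add. ring. }
  rewrite !Rabs_mult.
  set (a := Rabs x). set (b := Rabs y). set (c := Rabs (x - y)).
  assert (0 <= a) by apply Rabs_pos. assert (0 <= b) by apply Rabs_pos. assert (0 <= c) by apply Rabs_pos.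
  assert (a <= b + c) as Hac.
  { unfold a, b, c. pose proof (Rabs_triang (x - y) y). replace (x - y + y) with x in * by ring. lra. }
  assert (b <= a + c) as Hbc.
  { unfold a, b, c. rewrite Rabs_minus_sym. pose proof (Rabs_triang (y - x) x).
    replace (y - x + x) with y in * by ring. lra. }
  pose proof (pow_diff_bound (2 * p) x y) as Hd. fold a b c in Hd.
  set (n := INR (S (2 * p))) in *. assert (0 <= n) by apply pos_INR.
  assert (a ^ p <= 2 ^ p * (b ^ p + c ^ p)) as Ha.
  { eapply Rle_trans; [apply pow_incr; split; [|exact Hac]; lra|]. apply pow_plus_bound; auto. }
  assert (b ^ p <= 2 ^ p * (a ^ p + c ^ p)) as Hb.
  { eapply Rle_trans; [apply pow_incr; split; [|exact Hbc]; lra|]. apply pow_plus_bound; auto. }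
  assert (0 <= a ^ p) by (apply pow_le; auto). assert (0 <= b ^ p) by (apply pow_le; auto).
  assert (0 <= c ^ p) by (apply pow_le; auto).
  apply Rle_trans with (a * b * (n * c * (a ^ (2 * p) + b ^ (2 * p)))).
  { apply Rmult_le_compat_l; [nra|exact Hd]. }
  replace (2 * p)%nat with (p + p)%nat by lia. rewrite !pow_add.
  unfold s. cbn [pow].
  set (A := a ^ p) in *. set (B := b ^ p) in *. set (D := c ^ p) in *. set (t := 2 ^ p) in *.
  apply Rle_trans with (n * (c * b * (a * A) * (t * (B + D)) + c * a * (b * B) * (t * (A + D)))).
  - replace (a * b * (n * c * (A * A + B * B)))
      with (n * (c * b * (a * A) * A + c * a * (b * B) * B)) by ring.
    apply Rmult_le_compat_l; [auto|].
    apply Rplus_le_compat; (apply Rmult_le_compat_l; [|assumption]); repeat apply Rmult_le_pos; auto.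
  - right. ring.
Qed.

(** * Energy estimates *)

(** [Amat] reads its argument at [k - l] and [k + l], of size up to [2 N]; cutting a family to zero
    beyond [N] keeps the finite system closed. *)
Definition tr (N : nat) (f : Z -> R) (k : Z) : R :=
  if Z_le_dec (Z.abs k) (Z.of_nat N) then f k else 0.

Lemma tr_in N f k : (Z.abs k <= Z.of_nat N)%Z -> tr N f k = f k.
Proof. intros H. unfold tr. destruct (Z_le_dec (Z.abs k) (Z.of_nat N)); [reflexivity|lia]. Qed.

Lemma tr_out N f k : (Z.of_nat N < Z.abs k)%Z -> tr N f k = 0.
Proof. intros H. unfold tr. destruct (Z_le_dec (Z.abs k) (Z.of_nat N)); [lia|reflexivity]. Qed.

Lemma zsum_supp N n f :
  (N <= n)%nat -> (forall k, (Z.of_nat N < Z.abs k)%Z -> f k = 0) -> zsum n f = zsum N f.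
Proof.
  intros H Hf. induction H as [|n H IH]; [reflexivity|]. cbn [zsum].
  rewrite IH, (Hf (Z.of_nat (S n))), (Hf (- Z.of_nat (S n))%Z) by lia. ring.
Qed.

Lemma zsum_supp_le N n f :
  (forall k, 0 <= f k) -> (forall k, (Z.of_nat N < Z.abs k)%Z -> f k = 0) -> zsum n f <= zsum N f.
Proof.
  intros H0 Hf. destruct (Nat.le_ge_cases N n).
  - rewrite (zsum_supp N n f) by assumption. lra.
  - apply zsum_mono; assumption.
Qed.

(** Coefficients of the velocity: the operator sends [cas (k x)] to a multiple of [cas (- k x)], so
    the frequency [j] of the velocity is fed by the frequency [-j] of the density. *)
Definition Gop (gam h : Z -> R) (j : Z) : R := gam j * h (- j)%Z.

(** The truncated transport term in bilinear form: [a] generates the velocity and [b] is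
    transported. Bilinearity is what splits a difference of solutions into two terms. *)
Definition QN (gam : Z -> R) (N : nat) (a b : Z -> R) (k : Z) : R :=
  - zsum N (fun l => Amat (Gop gam (tr N a)) k l * (IZR l * b l)).

(** A squared homogeneous Sobolev norm. Since [IZR 0 ^ 0 = 1], [En 0] is the full squared l2 norm,
    whereas [s > 0] does not see the mean. *)
Definition En (s N : nat) (h : Z -> R) : R :=
  zsum N (fun k => IZR k ^ s * IZR k ^ s * (h k * h k)).

(** Dominates, up to a constant, the slope of the trigonometric sum; it is the growth rate in every
    energy estimate. *)
Definition lip1 (N : nat) (h : Z -> R) : R := zsum N (fun k => Rabs (IZR k) * Rabs (h k)).

Lemma En_nonneg s N h : 0 <= En s N h.
Proof.
  apply zsum_nonneg. intros k _. apply Rmult_le_pos; apply Rle_0_sqr.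
Qed.

Lemma lip1_nonneg N h : 0 <= lip1 N h.
Proof. apply zsum_nonneg. intros k _. apply Rmult_le_pos; apply Rabs_pos. Qed.

Lemma Rabs_IZR_opp k : Rabs (IZR (- k)) = Rabs (IZR k).
Proof. rewrite opp_IZR. apply Rabs_Ropp. Qed.

Lemma Rabs_pow_IZR_opp k s : Rabs (IZR (- k) ^ s) = Rabs (IZR k ^ s).
Proof. rewrite <- !RPow_abs, Rabs_IZR_opp. reflexivity. Qed.

Section Energy.

Variables (gam : Z -> R) (M : R).
Hypothesis Hgam : forall j, Rabs (gam j) <= M.

Lemma gam_bound_nonneg : 0 <= M.
Proof. pose proof (Hgam 0). pose proof (Rabs_pos (gam 0)). lra. Qed.

Lemma Gop_l1 N n h :
  zsum n (fun j => Rabs (IZR j) * Rabs (Gop gam (tr N h) j)) <= M * lip1 N h.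
Proof.
  pose proof gam_bound_nonneg as HM.
  apply Rle_trans with (zsum n (fun j => (fun j => M * (Rabs (IZR j) * Rabs (tr N h j))) (- j)%Z)).
  - apply zsum_le. intros j _. unfold Gop. rewrite Rabs_mult, Rabs_IZR_opp.
    replace (M * (Rabs (IZR j) * Rabs (tr N h (- j)))) with (Rabs (IZR j) * (M * Rabs (tr N h (- j)))) by ring.
    apply Rmult_le_compat_l; [apply Rabs_pos|]. apply Rmult_le_compat_r; [apply Rabs_pos|apply Hgam].
  - rewrite (zsum_reflect n (fun j => M * (Rabs (IZR j) * Rabs (tr N h j)))), zsum_scal.
    apply Rmult_le_compat_l; [exact HM|].
    eapply Rle_trans; [apply (zsum_supp_le N)|].
    + intros k. apply Rmult_le_pos; apply Rabs_pos.
    + intros k Hk. rewrite tr_out by exact Hk. rewrite Rabs_R0. ring.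
    + apply zsum_le. intros k Hk. rewrite tr_in by exact Hk. lra.
Qed.

Lemma Gop_l2 s N n h :
  zsum n (fun j => IZR j ^ s * IZR j ^ s * (Gop gam (tr N h) j * Gop gam (tr N h) j))
  <= M * M * En s N h.
Proof.
  pose proof gam_bound_nonneg as HM.
  assert (forall x : R, x * x = Rabs x * Rabs x) as Hsq by (intros x; apply Rsqr_abs).
  apply Rle_trans with (zsum n (fun j => (fun j => M * M * (IZR j ^ s * IZR j ^ s * (tr N h j * tr N h j))) (- j)%Z)).
  - apply zsum_le. intros j _. unfold Gop.
    rewrite (Hsq (IZR (- j) ^ s)), Rabs_pow_IZR_opp, <- (Hsq (IZR j ^ s)).
    replace (gam j * tr N h (- j) * (gam j * tr N h (- j)))
      with (gam j * gam j * (tr N h (- j) * tr N h (- j))) by ring.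
    assert (gam j * gam j <= M * M).
    { rewrite (Hsq (gam j)). apply Rmult_le_compat; auto using Rabs_pos. }
    pose proof (Rle_0_sqr (IZR j ^ s)). pose proof (Rle_0_sqr (tr N h (- j))). unfold Rsqr in *.
    set (a := IZR j ^ s * IZR j ^ s) in *. set (b := tr N h (- j) * tr N h (- j)) in *.
    replace (a * (gam j * gam j * b)) with (gam j * gam j * (a * b)) by ring.
    apply Rmult_le_compat_r; [apply Rmult_le_pos; assumption|assumption].
  - rewrite (zsum_reflect n (fun j => M * M * (IZR j ^ s * IZR j ^ s * (tr N h j * tr N h j)))), zsum_scal.
    apply Rmult_le_compat_l; [nra|].
    eapply Rle_trans; [apply (zsum_supp_le N)|].
    + intros k. apply Rmult_le_pos; apply Rle_0_sqr.
    + intros k Hk. rewrite tr_out by exact Hk. ring.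
    + apply zsum_le. intros k Hk. rewrite tr_in by exact Hk. lra.
Qed.

Lemma evn_Gop_l1 N n h :
  zsum n (fun j => Rabs (IZR j) * evn (Gop gam (tr N h)) j) <= 2 * M * lip1 N h.
Proof.
  rewrite (zsum_evn_weight n _ (fun j => Rabs (IZR j))) by apply Rabs_IZR_opp.
  pose proof (Gop_l1 N n h). lra.
Qed.

Lemma evn_Gop_l2 s N n h :
  zsum n (fun j => (Rabs (IZR j ^ s) * evn (Gop gam (tr N h)) j) *
                   (Rabs (IZR j ^ s) * evn (Gop gam (tr N h)) j)) <= 4 * (M * M) * En s N h.
Proof.
  eapply Rle_trans; [apply (zsum_evn_sqr n _ (fun j => IZR j ^ s)); intros; apply Rabs_pow_IZR_opp|].
  pose proof (Gop_l2 s N n h). lra.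
Qed.

Lemma evn_l1 N h : zsum N (fun k => Rabs (IZR k) * evn h k) = 2 * lip1 N h.
Proof. apply zsum_evn_weight. apply Rabs_IZR_opp. Qed.

Lemma evn_l2 s N h :
  zsum N (fun k => (Rabs (IZR k ^ s) * evn h k) * (Rabs (IZR k ^ s) * evn h k)) <= 4 * En s N h.
Proof. apply (zsum_evn_sqr N h (fun j => IZR j ^ s)). intros; apply Rabs_pow_IZR_opp. Qed.

Lemma abs_l2 s N h :
  zsum N (fun k => (Rabs (IZR k ^ s) * Rabs (h k)) * (Rabs (IZR k ^ s) * Rabs (h k))) = En s N h.
Proof.
  apply zsum_ext. intros k _.
  replace (Rabs (IZR k ^ s) * Rabs (h k) * (Rabs (IZR k ^ s) * Rabs (h k)))
    with (Rabs (IZR k ^ s) * Rabs (IZR k ^ s) * (Rabs (h k) * Rabs (h k))) by ring.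
  change (Rsqr (Rabs (IZR k ^ s)) * Rsqr (Rabs (h k)) = Rsqr (IZR k ^ s) * Rsqr (h k)).
  rewrite <- !Rsqr_abs. reflexivity.
Qed.

Lemma QN_pairing N a b (c : Z -> R) :
  zsum N (fun k => c k * QN gam N a b k) =
  - zsum N (fun k => zsum N (fun l => c k * (Amat (Gop gam (tr N a)) k l * (IZR l * b l)))).
Proof.
  rewrite <- zsum_opp. apply zsum_ext. intros k _. unfold QN. rewrite zsum_scal. ring.
Qed.

(** For the weight [1] the commutator is [l - k], one derivative on the velocity, which is put in
    l1. The family [d] generating the velocity and the transported [w] are independent, as
    differences of solutions require. *)
Lemma energy_estimate_0 N d w :
  Rabs (zsum N (fun k => w k * QN gam N d w k)) <= 2 * M * lip1 N d * En 0 N w.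
Proof.
  rewrite QN_pairing, Rabs_Ropp.
  set (G := Gop gam (tr N d)).
  rewrite (zsum_ext N _ (fun k => zsum N (fun l => 1 * w k * (Amat G k l * (IZR l * w l)))))
    by (intros; apply zsum_ext; intros; ring).
  eapply Rle_trans; [apply (transport_symmetrized N G (fun _ => 1) w); reflexivity|].
  apply Rle_trans with (/ 4 * zsum N (fun k => zsum N (fun l =>
    (fun j => Rabs (IZR j) * evn G j) (k - l)%Z *
      (Rabs (IZR k ^ 0) * Rabs (w k) * (Rabs (IZR l ^ 0) * evn w l))))).
  { apply Rmult_le_compat_l; [lra|]. apply zsum_le; intros k _; apply zsum_le; intros l _.
    right. simpl. rewrite Rabs_R1, !Rmult_1_r, minus_IZR, (Rabs_minus_sym (IZR l)). ring. }
  eapply Rle_trans; [apply Rmult_le_compat_l; [lra|]; 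
    apply (young_l1 N (fun j => Rabs (IZR j) * evn G j) (fun k => Rabs (IZR k ^ 0) * Rabs (w k))
      (fun l => Rabs (IZR l ^ 0) * evn w l) (2 * M * lip1 N d))|].
  - intros j. apply Rmult_le_pos; [apply Rabs_pos|apply evn_nonneg].
  - intros n. apply evn_Gop_l1.
  - rewrite abs_l2. pose proof (evn_l2 0 N w). pose proof (En_nonneg 0 N w).
    pose proof gam_bound_nonneg. pose proof (lip1_nonneg N d).
    assert (0 <= M * lip1 N d) by (apply Rmult_le_pos; assumption). nra.
Qed.

(** The derivative falls on the given family [c], so no cancellation is called for: [|l| c_l] is put
    in l1 and both copies of [w] in l2. *)
Lemma pairing_estimate_0 N w c :
  Rabs (zsum N (fun k => w k * QN gam N w c k)) <= (2 * (M * M) + 1) * lip1 N c * En 0 N w.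
Proof.
  rewrite QN_pairing, Rabs_Ropp.
  set (G := Gop gam (tr N w)).
  eapply Rle_trans; [apply zsum_Rabs|].
  apply Rle_trans with (/ 2 * zsum N (fun k => zsum N (fun l =>
    (fun j => Rabs (IZR j ^ 0) * evn G j) (k - l)%Z *
      (Rabs (IZR k ^ 0) * Rabs (w k) * (Rabs (IZR l) * evn c l))))).
  { rewrite <- zsum_scal. apply zsum_le; intros k _. eapply Rle_trans; [apply zsum_Rabs|].
    set (q := fun l => evn G (k - l) * (Rabs (w k) * (Rabs (IZR l) * Rabs (c (- l)%Z)))).
    apply Rle_trans with (/ 2 * zsum N (fun l =>
      evn G (k - l) * (Rabs (w k) * (Rabs (IZR l) * Rabs (c l))) + q (- l)%Z)).
    - rewrite <- zsum_scal. apply zsum_le; intros l _. unfold q.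
      rewrite Z.opp_involutive, Rabs_IZR_opp. replace (k - - l)%Z with (k + l)%Z by lia.
      rewrite !Rabs_mult. pose proof (Amat_bound G k l) as HA.
      set (z := Rabs (IZR l) * Rabs (c l)). assert (0 <= z) by (apply Rmult_le_pos; apply Rabs_pos).
      pose proof (Rabs_pos (w k)).
      replace (/ 2 * (evn G (k - l) * (Rabs (w k) * z) + evn G (k + l) * (Rabs (w k) * z)))
        with (Rabs (w k) * ((evn G (k - l) + evn G (k + l)) / 2 * z)) by field.
      apply Rmult_le_compat_l; [assumption|]. apply Rmult_le_compat_r; assumption.
    - rewrite zsum_plus, (zsum_reflect N q), <- zsum_plus. apply Rmult_le_compat_l; [lra|].
      apply zsum_le; intros l _. right. unfold q, evn at 4. simpl. rewrite Rabs_R1. ring. }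
  eapply Rle_trans; [apply Rmult_le_compat_l; [lra|]; 
    apply (young_l2 N (fun j => Rabs (IZR j ^ 0) * evn G j) (fun k => Rabs (IZR k ^ 0) * Rabs (w k))
      (fun l => Rabs (IZR l) * evn c l) (4 * (M * M) * En 0 N w))|].
  - intros j. apply Rmult_le_pos; [apply Rabs_pos|apply evn_nonneg].
  - intros n. apply evn_Gop_l2.
  - rewrite abs_l2, evn_l1. pose proof (En_nonneg 0 N w). pose proof (lip1_nonneg N c).
    assert (0 <= lip1 N c * En 0 N w) by (apply Rmult_le_pos; assumption).
    assert (0 <= M * M) by apply Rle_0_sqr. nra.
Qed.

(** In the first term of [commutator_weight] both copies of [h] carry [s] derivatives and the
    velocity carries one, in l1. In the other two the velocity carries [s] derivatives in l2, and
    one copy of [h] carries a single derivative in l1. Each way the l1 factor costs [lip1] and the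
    rest is bounded by a multiple of [En s], so the estimate is linear in [En s]. *)
Lemma energy_estimate_S p N h :
  let s := S p in
  Rabs (zsum N (fun k => IZR k ^ s * IZR k ^ s * h k * QN gam N h h k))
  <= INR (S (2 * p)) * 2 ^ p * (3 * M + 2 * (M * M) + 1) * lip1 N h * En s N h.
Proof.
  intros s. rewrite QN_pairing, Rabs_Ropp.
  set (G := Gop gam (tr N h)). set (C := INR (S (2 * p)) * 2 ^ p).
  assert (0 <= C) as HC.
  { apply Rmult_le_pos; [apply pos_INR|apply pow_le; lra]. }
  assert (forall x : R, x * x = Rabs x * Rabs x) as Hsq by (intros x; apply Rsqr_abs).
  eapply Rle_trans; [apply (transport_symmetrized N G (fun k => IZR k ^ s * IZR k ^ s) h)|].
  { intros k. rewrite (Hsq (IZR (- k) ^ s)), Rabs_pow_IZR_opp, <- Hsq. reflexivity. }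
  set (g1 := fun j => Rabs (IZR j) * evn G j).
  set (g2 := fun j => Rabs (IZR j ^ s) * evn G j).
  set (x := fun k => Rabs (IZR k ^ s) * Rabs (h k)).
  set (y := fun l => Rabs (IZR l ^ s) * evn h l).
  set (u := fun k => Rabs (IZR k) * Rabs (h k)).
  set (v := fun l => Rabs (IZR l) * evn h l).
  apply Rle_trans with (/ 4 * (C * (2 * zsum N (fun k => zsum N (fun l => g1 (k - l)%Z * (x k * y l)))
    + zsum N (fun k => zsum N (fun l => g2 (k - l)%Z * (x k * v l)))
    + zsum N (fun k => zsum N (fun l => g2 (k - l)%Z * (y k * u l)))))).
  { apply Rmult_le_compat_l; [lra|].
    (* In the third sum [k] and [l] trade roles, by evenness of [g2], so that the l1 factor [u]
       stands where [young_l2] expects it. *)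
    rewrite (zsum_swap N N (fun k l => g2 (k - l)%Z * (y k * u l))).
    rewrite <- (zsum_scal N 2), <- !zsum_plus, <- zsum_scal.
    apply zsum_le; intros k _.
    rewrite <- (zsum_scal N 2), <- !zsum_plus, <- zsum_scal.
    apply zsum_le; intros l _.
    assert (g2 (l - k)%Z = g2 (k - l)%Z) as ->.
    { unfold g2. replace (l - k)%Z with (- (k - l))%Z by lia. rewrite evn_opp, Rabs_pow_IZR_opp. reflexivity. }
    pose proof (commutator_weight p (IZR k) (IZR l)) as Hw. cbv zeta in Hw. fold s C in Hw.
    unfold g1, g2, x, y, u, v. rewrite <- !RPow_abs. rewrite minus_IZR.
    set (W := Rabs (IZR l * (IZR k ^ s * IZR k ^ s) - IZR k * (IZR l ^ s * IZR l ^ s))) in *.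
    set (e := evn G (k - l)). set (hk := Rabs (h k)). set (hl := evn h l).
    assert (0 <= e * (hk * hl)).
    { apply Rmult_le_pos; [apply evn_nonneg|]. apply Rmult_le_pos; [apply Rabs_pos|apply evn_nonneg]. }
    replace (e * (W * (hk * hl))) with (W * (e * (hk * hl))) by ring.
    eapply Rle_trans; [apply Rmult_le_compat_r; [assumption|exact Hw]|]. right. ring. }
  pose proof gam_bound_nonneg as HM. pose proof (lip1_nonneg N h) as HA. pose proof (En_nonneg s N h) as HE.
  assert (0 <= lip1 N h * En s N h) as HAE by (apply Rmult_le_pos; assumption).
  pose proof (abs_l2 s N h) as Hx. fold x in Hx.
  pose proof (evn_l2 s N h) as Hy. fold y in Hy.
  assert (zsum N (fun k => zsum N (fun l => g1 (k - l)%Z * (x k * y l))) <= 5 * M * (lip1 N h * En s N h)) as H1.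
  { eapply Rle_trans; [apply young_l1 with (Gam := 2 * M * lip1 N h)|].
    - intros j. apply Rmult_le_pos; [apply Rabs_pos|apply evn_nonneg].
    - intros n. apply evn_Gop_l1.
    - change (zsum N (fun k => x k * x k) = En s N h) in Hx. rewrite Hx.
      change (zsum N (fun k => y k * y k) <= 4 * En s N h) in Hy.
      assert (0 <= M * lip1 N h) by (apply Rmult_le_pos; assumption). nra. }
  assert (zsum N (fun k => zsum N (fun l => g2 (k - l)%Z * (x k * v l)))
     <= (4 * (M * M) + 1) * (lip1 N h * En s N h)) as H2.
  { eapply Rle_trans; [apply young_l2 with (Gam := 4 * (M * M) * En s N h)|].
    - intros j. apply Rmult_le_pos; [apply Rabs_pos|apply evn_nonneg].
    - intros n. apply evn_Gop_l2.
    - change (zsum N (fun k => x k * x k) = En s N h) in Hx. rewrite Hx.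
      unfold v. rewrite evn_l1. right. field. }
  assert (zsum N (fun k => zsum N (fun l => g2 (k - l)%Z * (y k * u l)))
     <= (2 * (M * M) + 2) * (lip1 N h * En s N h)) as H3.
  { eapply Rle_trans; [apply young_l2 with (Gam := 4 * (M * M) * En s N h)|].
    - intros j. apply Rmult_le_pos; apply Rabs_pos.
    - intros n. apply evn_Gop_l2.
    - change (zsum N (fun k => y k * y k) <= 4 * En s N h) in Hy.
      change (zsum N u) with (lip1 N h).
      replace ((2 * (M * M) + 2) * (lip1 N h * En s N h))
        with (lip1 N h * ((4 * (M * M) * En s N h + 4 * En s N h) / 2)) by field.
      apply Rmult_le_compat_l; [assumption|]. lra. }
  assert (0 <= M * M) by apply Rle_0_sqr.
  assert (0 <= M * M * (lip1 N h * En s N h)) by (apply Rmult_le_pos; assumption).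
  assert (0 <= M * (lip1 N h * En s N h)) by (apply Rmult_le_pos; assumption).
  rewrite <- Rmult_assoc, (Rmult_comm (/ 4)), Rmult_assoc, !(Rmult_assoc C).
  apply Rmult_le_compat_l; [assumption|]. lra.
Qed.

End Energy.

(** * Global existence for Lipschitz systems *)

(** Integration against the weight [exp (lam s)] gains [1 / lam]. In the norm with this weight the
    Picard map contracts on the whole line when [lam] is large. *)
Lemma exp_integral_bound_pos (F f : R -> R) c lam t :
  0 < lam -> 0 <= c -> 0 <= t -> F 0 = 0 ->
  (forall s, is_derive F s (f s)) ->
  (forall s, 0 <= s -> Rabs (f s) <= c * exp (lam * s)) ->
  Rabs (F t) <= c / lam * exp (lam * t).
Proof.
  intros Hl Hc Ht H0 Hd Hb.
  assert (forall sg : R, Rabs sg <= 1 -> sg * F t <= c / lam * exp (lam * t)) as H.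
  { intros sg Hsg.
    set (g := fun s => sg * F s - c / lam * exp (lam * s)).
    assert (forall s, is_derive g s (sg * f s - c * exp (lam * s))) as Hg.
    { intros s. unfold g. apply (is_derive_minus (fun s => sg * F s) (fun s => c / lam * exp (lam * s))).
      - apply is_derive_scal, Hd.
      - auto_derive; [trivial|]. field; lra. }
    pose proof (mvt_le g _ 0 t 0 Ht (fun s _ => Hg s) (fun s _ => is_derive_continuity_pt _ _ _ (Hg s))) as Hm.
    assert (g t - g 0 <= 0 * (t - 0)) as Hm'.
    { apply Hm. intros s Hs. pose proof (Hb s ltac:(lra)) as Hbs.
      assert (sg * f s <= Rabs (f s)).
      { eapply Rle_trans; [apply Rle_abs|]. rewrite Rabs_mult.
        pose proof (Rabs_pos (f s)). nra. }
      lra. }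
    unfold g in Hm'. rewrite H0, Rmult_0_r, Rmult_0_r, exp_0 in Hm'.
    assert (0 <= c / lam) by (apply Rdiv_le_0_compat; lra). lra. }
  apply Rabs_le. split.
  - pose proof (H (-1) ltac:(rewrite Rabs_left; lra)). lra.
  - pose proof (H 1 ltac:(rewrite Rabs_R1; lra)). lra.
Qed.

Lemma exp_integral_bound (f : R -> R) c lam t :
  0 < lam -> 0 <= c -> (forall s, continuous f s) ->
  (forall s, Rabs (f s) <= c * exp (lam * Rabs s)) ->
  Rabs (RInt f 0 t) <= c / lam * exp (lam * Rabs t).
Proof.
  intros Hl Hc Hf Hb.
  assert (forall s, is_derive (fun s => RInt f 0 s) s (f s)) as Hd.
  { intros s. apply (is_derive_RInt f _ 0); [|apply Hf].
    apply filter_forall. intros y. apply is_RInt_cont, Hf. }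
  destruct (Rle_dec 0 t) as [Ht|Ht].
  - rewrite (Rabs_pos_eq t) by lra.
    apply (exp_integral_bound_pos (fun s => RInt f 0 s) f); auto.
    + apply (@RInt_point R_CompleteNormedModule).
    + intros s Hs. rewrite <- (Rabs_pos_eq s) at 2 by lra. apply Hb.
  - rewrite (Rabs_left t) by lra.
    replace (RInt f 0 t) with ((fun s => RInt f 0 (- s)) (- t)) by (simpl; f_equal; ring).
    apply (exp_integral_bound_pos (fun s => RInt f 0 (- s)) (fun s => - f (- s))); auto; try lra.
    + rewrite Ropp_0. apply (@RInt_point R_CompleteNormedModule).
    + intros s. replace (- f (- s)) with (-1 * f (- s)) by ring.
      apply (is_derive_comp (fun s => RInt f 0 s) (fun s => - s)); [apply Hd|].
      auto_derive; [trivial|ring].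
    + intros s Hs. rewrite Rabs_Ropp. rewrite <- (Rabs_pos_eq s) at 2 by lra.
      rewrite <- (Rabs_Ropp s). apply Hb.
Qed.

Lemma geometric_cauchy (u : nat -> R) c :
  (forall n, Rabs (u (S n) - u n) <= c / 2 ^ n) ->
  exists l : R, is_lim_seq u l /\ forall n, Rabs (l - u n) <= 2 * c / 2 ^ n.
Proof.
  intros H.
  assert (0 <= c) as Hc.
  { pose proof (H 0%nat) as H0. simpl in H0. pose proof (Rabs_pos (u 1%nat - u 0%nat)). lra. }
  assert (forall n, 0 < 2 ^ n) as Hp by (intros; apply pow_lt; lra).
  assert (forall n m, (n <= m)%nat -> Rabs (u m - u n) <= 2 * c / 2 ^ n - 2 * c / 2 ^ m) as Hd.
  { intros n m Hnm. induction Hnm as [|m Hnm IH].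
    - rewrite !Rminus_diag, Rabs_R0. lra.
    - pose proof (H m) as Hm. pose proof (Rabs_triang (u (S m) - u m) (u m - u n)) as Ht.
      replace (u (S m) - u m + (u m - u n)) with (u (S m) - u n) in Ht by ring.
      replace (2 * c / 2 ^ S m) with (c / 2 ^ m) by (simpl; field; specialize (Hp m); lra).
      replace (2 * c / 2 ^ m) with (2 * (c / 2 ^ m)) in IH by (unfold Rdiv; ring). lra. }
  assert (forall n m, (n <= m)%nat -> Rabs (u m - u n) <= 2 * c / 2 ^ n) as Hd'.
  { intros n m Hnm. specialize (Hd n m Hnm).
    assert (0 <= 2 * c / 2 ^ m) by (apply Rdiv_le_0_compat; [lra|apply Hp]). lra. }
  assert (ex_finite_lim_seq u) as [l Hl].
  { apply ex_lim_seq_cauchy_corr. intros eps.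
    destruct (inv_INR_small (2 * c) eps (cond_pos eps)) as [N HN].
    assert (forall n, (N <= n)%nat -> 2 * c / 2 ^ n < eps) as Hs.
    { intros n Hn. eapply Rle_lt_trans; [|apply (HN n Hn)].
      unfold Rdiv. apply Rmult_le_compat_l; [lra|]. apply Rinv_le_contravar.
      - pose proof (pos_INR n); lra.
      - clear. induction n as [|n IH]; [simpl; lra|]. rewrite S_INR. simpl.
        pose proof (pow_R1_Rle 2 n ltac:(lra)). lra. }
    exists N. intros n m Hn Hm. destruct (Nat.le_ge_cases n m).
    - rewrite Rabs_minus_sym. eapply Rle_lt_trans; [apply Hd'; eassumption|auto].
    - eapply Rle_lt_trans; [apply Hd'; eassumption|auto]. }
  exists l. split; [exact Hl|]. intros n.
  apply (is_lim_seq_le_loc (fun m => Rabs (u m - u n)) (fun _ => 2 * c / 2 ^ n)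
    (Finite (Rabs (l - u n))) (Finite (2 * c / 2 ^ n))).
  - exists n. intros m Hm. apply Hd'; exact Hm.
  - apply (is_lim_seq_abs _ (Finite (l - u n))).
    apply (is_lim_seq_minus' _ _ l (u n)); [exact Hl|apply is_lim_seq_const].
  - apply is_lim_seq_const.
Qed.

Lemma is_lim_seq_pow2 c : is_lim_seq (fun n => c / 2 ^ n) 0.
Proof.
  replace (Finite 0) with (Rbar_mult c 0) by (simpl; f_equal; ring).
  unfold Rdiv. apply is_lim_seq_scal_l.
  apply is_lim_seq_ext with (fun n => (/ 2) ^ n).
  - intros n. apply pow_inv.
  - apply is_lim_seq_geom. rewrite Rabs_pos_eq; lra.
Qed.

Lemma continuous_dominated {U : UniformSpace} (f phi : U -> R) x :
  (forall y, Rabs (f y - f x) <= phi y) -> phi x = 0 -> continuous phi x -> continuous f x.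
Proof.
  intros H H0 Hc. apply filterlim_locally. intros eps.
  pose proof (proj1 (filterlim_locally _ _) Hc eps) as He.
  apply (filter_imp _ _ (F := locally x)) with (2 := He). intros y Hy.
  change (Rabs (phi y - phi x) < eps) in Hy. change (Rabs (f y - f x) < eps).
  rewrite H0, Rminus_0_r in Hy. pose proof (Rle_abs (phi y)). specialize (H y). lra.
Qed.

Section Picard.

Variables (N : nat) (p : Z -> (Z -> R) -> R) (x0 : Z -> R) (B L : R).
Hypothesis HL : 0 < L.
Hypothesis HB : forall k x, Rabs (p k x) <= B.
Hypothesis Hlip : forall k x y,
  Rabs (p k x - p k y) <= L * zsum N (fun j => Rabs (x j - y j)).

Lemma field_continuous (x : R -> Z -> R) k s :
  (forall j, continuous (fun s => x s j) s) -> continuous (fun s => p k (x s)) s.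
Proof.
  intros Hx.
  apply continuous_dominated with (fun r => L * zsum N (fun j => Rabs (x r j - x s j))).
  - intros r. apply Hlip.
  - rewrite (zsum_ext N _ (fun _ => 0)), zsum_0; [ring|].
    intros j _. rewrite Rminus_diag. apply Rabs_R0.
  - apply continuous_Rmult; [apply continuous_const|]. apply continuous_zsum. intros j _.
    apply (continuous_comp (fun r => x r j - x s j) Rabs).
    + apply continuous_Rminus; [apply Hx|apply continuous_const].
    + apply continuous_Rabs.
Qed.

Fixpoint picard (n : nat) (t : R) (k : Z) : R :=
  match n with
  | O => x0 k
  | S n => x0 k + RInt (fun s => p k (picard n s)) 0 t
  end.

Lemma picard_continuous n k t : continuous (fun t => picard n t k) t.
Proof.
  revert k t. induction n as [|n IH]; intros k t; simpl.
  - apply continuous_const.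
  - apply continuous_Rplus; [apply continuous_const|].
    apply is_derive_cont with (p k (picard n t)).
    apply (is_derive_RInt (fun s => p k (picard n s)) _ 0).
    + apply filter_forall. intros y. apply is_RInt_cont. intros s. apply field_continuous. auto.
    + apply field_continuous. auto.
Qed.

Lemma picard_field_continuous n k t : continuous (fun t => p k (picard n t)) t.
Proof. apply field_continuous. intros; apply picard_continuous. Qed.

Let w := 2 * INR N + 1.
(** [w L = lam / 2] is the Lipschitz constant of the field for the sup norm over the [w] coordinates
    of the window; after the gain [1 / lam] each Picard step halves the distance. *)
Let lam := 2 * w * L.

Lemma picard_w_pos : 0 < w.
Proof. unfold w. pose proof (pos_INR N). lra. Qed.

Lemma picard_lam_pos : 0 < lam.
Proof. unfold lam. pose proof picard_w_pos. nra. Qed.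

Lemma picard_B_nonneg : 0 <= B.
Proof. pose proof (HB 0%Z x0). pose proof (Rabs_pos (p 0%Z x0)). lra. Qed.

Lemma picard_field_close (x y : Z -> R) k e :
  (forall j, Rabs (x j - y j) <= e) -> Rabs (p k x - p k y) <= lam / 2 * e.
Proof.
  intros H. eapply Rle_trans; [apply Hlip|].
  replace (lam / 2 * e) with (L * (w * e)) by (unfold lam; field).
  apply Rmult_le_compat_l; [lra|]. unfold w. rewrite <- zsum_const. apply zsum_le. auto.
Qed.

Lemma picard_diff n k t :
  Rabs (picard (S n) t k - picard n t k) <= B / lam * exp (lam * Rabs t) / 2 ^ n.
Proof.
  pose proof picard_lam_pos as Hlam. pose proof picard_B_nonneg as HB0.
  revert k t. induction n as [|n IH]; intros k t.
  - simpl. assert (forall a b : R, a + b - a = b) as -> by (intros; ring).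
    rewrite Rdiv_1_r. apply exp_integral_bound; auto.
    + intros s. apply continuous_const.
    + intros s. eapply Rle_trans; [apply HB|]. rewrite <- (Rmult_1_r B) at 1.
      apply Rmult_le_compat_l; [lra|]. pose proof (exp_ineq1_le (lam * Rabs s)).
      assert (0 <= lam * Rabs s) by (apply Rmult_le_pos; [lra|apply Rabs_pos]). lra.
  - assert (picard (S (S n)) t k - picard (S n) t k =
      RInt (fun s => p k (picard (S n) s) - p k (picard n s)) 0 t) as ->.
    { symmetry. apply is_RInt_unique.
      replace (picard (S (S n)) t k - picard (S n) t k) with
        (RInt (fun s => p k (picard (S n) s)) 0 t - RInt (fun s => p k (picard n s)) 0 t)
        by (simpl; ring).
      apply is_RInt_Rminus; apply is_RInt_cont; intros; apply picard_field_continuous. }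
    assert (0 < 2 ^ n) by (apply pow_lt; lra).
    replace (B / lam * exp (lam * Rabs t) / 2 ^ S n)
      with (lam / 2 * (B / lam / 2 ^ n) / lam * exp (lam * Rabs t)) by (simpl; field; lra).
    apply exp_integral_bound; auto.
    + apply Rmult_le_pos; [lra|]. apply Rdiv_le_0_compat; [|lra]. apply Rdiv_le_0_compat; lra.
    + intros s. apply continuous_Rminus; apply picard_field_continuous.
    + intros s. replace (lam / 2 * (B / lam / 2 ^ n) * exp (lam * Rabs s))
        with (lam / 2 * (B / lam * exp (lam * Rabs s) / 2 ^ n)) by (field; lra).
      apply picard_field_close. intros j. apply IH.
Qed.

(** A bounded, globally Lipschitz field has solutions on the whole line; negative times make the
    derivative at [t = 0] two-sided. *)
Theorem picard_lindelof :
  exists x : R -> Z -> R, (forall k, x 0 k = x0 k) /\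
    forall k t, is_derive (fun t => x t k) t (p k (x t)).
Proof.
  pose proof picard_lam_pos as Hlam. pose proof picard_B_nonneg as HB0.
  set (x := fun t k => real (Lim_seq (fun n => picard n t k))).
  assert (forall t k, is_lim_seq (fun n => picard n t k) (x t k) /\
    forall n, Rabs (x t k - picard n t k) <= 2 * (B / lam * exp (lam * Rabs t)) / 2 ^ n) as Hx.
  { intros t k. destruct (geometric_cauchy (fun n => picard n t k) (B / lam * exp (lam * Rabs t))) as [l [Hl Hb]].
    - intros n. apply picard_diff.
    - unfold x. rewrite (is_lim_seq_unique _ _ Hl). auto. }
  (* All iterates share the time-Lipschitz constant [B], so the limit inherits it; its continuity
     makes the right-hand side integrable. *)
  assert (forall k t s, Rabs (x t k - x s k) <= B * Rabs (t - s)) as Hxl.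
  { intros k t s.
    apply (is_lim_seq_le (fun n => Rabs (picard n t k - picard n s k)) (fun _ => B * Rabs (t - s))
      (Finite (Rabs (x t k - x s k))) (Finite (B * Rabs (t - s)))).
    - assert (forall n t s, s <= t -> Rabs (picard n t k - picard n s k) <= B * Rabs (t - s)) as H.
      { clear t s. intros n t s Hst. destruct n as [|n]; simpl.
        - rewrite Rminus_diag, Rabs_R0. apply Rmult_le_pos; [lra|apply Rabs_pos].
        - assert (forall a b, ex_RInt (fun s => p k (picard n s)) a b) as Hex
            by (intros; apply ex_RInt_cont; intros; apply picard_field_continuous).
          rewrite <- (RInt_Chasles _ 0 s t) by auto. unfold plus; simpl.
          assert (forall a b c : R, a + (b + c) - (a + b) = c) as -> by (intros; ring).
          rewrite (Rabs_pos_eq (t - s)), Rmult_comm by lra.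
          apply (is_RInt_abs_le (fun s => p k (picard n s))); auto.
          apply is_RInt_cont; intros; apply picard_field_continuous. }
      intros n. destruct (Rle_dec s t); [apply H; lra|].
      rewrite Rabs_minus_sym, (Rabs_minus_sym t). apply H; lra.
    - apply (is_lim_seq_abs _ (Finite (x t k - x s k))).
      apply (is_lim_seq_minus' _ _ (x t k) (x s k)); apply Hx.
    - apply is_lim_seq_const. }
  assert (forall k t, continuous (fun t => x t k) t) as Hxc.
  { intros k t. apply continuous_dominated with (fun s => B * Rabs (s - t)).
    - intros s. apply Hxl.
    - rewrite Rminus_diag, Rabs_R0. ring.
    - apply continuous_Rmult; [apply continuous_const|].
      apply (continuous_comp (fun r => r - t) Rabs); [|apply continuous_Rabs].
      apply continuous_Rminus; [apply continuous_id|apply continuous_const]. }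
  assert (forall k t, continuous (fun t => p k (x t)) t) as Hpc
    by (intros; apply field_continuous; auto).
  assert (forall k t, x t k = x0 k + RInt (fun s => p k (x s)) 0 t) as Heq.
  { intros k t.
    assert (is_lim_seq (fun n => picard (S n) t k) (x t k)) as H1.
    { apply (is_lim_seq_incr_1 (fun n => picard n t k)). apply Hx. }
    assert (is_lim_seq (fun n => picard (S n) t k) (x0 k + RInt (fun s => p k (x s)) 0 t)) as H2.
    { apply is_lim_seq_le_le with
        (fun n => x0 k + RInt (fun s => p k (x s)) 0 t - B / lam * exp (lam * Rabs t) / 2 ^ n)
        (fun n => x0 k + RInt (fun s => p k (x s)) 0 t + B / lam * exp (lam * Rabs t) / 2 ^ n).
      - intros n. cut (Rabs (picard (S n) t k - (x0 k + RInt (fun s => p k (x s)) 0 t)) <=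
          B / lam * exp (lam * Rabs t) / 2 ^ n).
        { intros H. apply Rabs_le_between in H. lra. }
        assert (picard (S n) t k - (x0 k + RInt (fun s => p k (x s)) 0 t) =
          RInt (fun s => p k (picard n s) - p k (x s)) 0 t) as ->.
        { symmetry. apply is_RInt_unique.
          replace (picard (S n) t k - (x0 k + RInt (fun s => p k (x s)) 0 t)) with
            (RInt (fun s => p k (picard n s)) 0 t - RInt (fun s => p k (x s)) 0 t) by (simpl; ring).
          apply is_RInt_Rminus; apply is_RInt_cont; auto. intros; apply picard_field_continuous. }
        assert (0 < 2 ^ n) by (apply pow_lt; lra).
        replace (B / lam * exp (lam * Rabs t) / 2 ^ n)
          with (lam / 2 * (2 * (B / lam) / 2 ^ n) / lam * exp (lam * Rabs t)) by (field; lra).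
        apply exp_integral_bound; auto.
        + apply Rmult_le_pos; [lra|]. apply Rdiv_le_0_compat; [|lra].
          apply Rmult_le_pos; [lra|]. apply Rdiv_le_0_compat; lra.
        + intros s. apply continuous_Rminus; auto. apply picard_field_continuous.
        + intros s. replace (lam / 2 * (2 * (B / lam) / 2 ^ n) * exp (lam * Rabs s))
            with (lam / 2 * (2 * (B / lam * exp (lam * Rabs s)) / 2 ^ n)) by (field; lra).
          apply picard_field_close. intros j. rewrite Rabs_minus_sym. apply Hx.
      - rewrite <- (Rminus_0_r (x0 k + _)) at 1.
        apply is_lim_seq_minus'; [apply is_lim_seq_const|apply is_lim_seq_pow2].
      - rewrite <- (Rplus_0_r (x0 k + _)) at 1.
        apply is_lim_seq_plus'; [apply is_lim_seq_const|apply is_lim_seq_pow2]. }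
    apply is_lim_seq_unique in H1, H2. rewrite H1 in H2. injection H2; auto. }
  exists x. split.
  - intros k. rewrite Heq, RInt_point. unfold zero; simpl. ring.
  - intros k t. apply is_derive_ext with (fun t => x0 k + RInt (fun s => p k (x s)) 0 t).
    { intros s. symmetry. apply Heq. }
    replace (p k (x t)) with (0 + p k (x t)) by ring.
    apply (is_derive_plus (fun _ => x0 k) (fun t => RInt (fun s => p k (x s)) 0 t)).
    + apply (@is_derive_const R_AbsRing R_NormedModule).
    + apply (is_derive_RInt (fun s => p k (x s)) _ 0); [|apply Hpc].
      apply filter_forall. intros y. apply is_RInt_cont, Hpc.
Qed.

End Picard.

(** * Galerkin approximations *)

(** Bounded Lipschitz functionals of the coordinates in the window. Boundedness makes the class
    closed under products, so polynomials in clamped coordinates belong to it without any explicit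
    constant. *)
Definition blip (N : nat) (phi : (Z -> R) -> R) : Prop :=
  exists B L, 0 <= B /\ 0 <= L /\ (forall x, Rabs (phi x) <= B) /\
    forall x y, Rabs (phi x - phi y) <= L * zsum N (fun j => Rabs (x j - y j)).

Lemma dist_nonneg N (x y : Z -> R) : 0 <= zsum N (fun j => Rabs (x j - y j)).
Proof. apply zsum_nonneg. intros; apply Rabs_pos. Qed.

Lemma blip_const N c : blip N (fun _ => c).
Proof.
  exists (Rabs c), 0. split; [apply Rabs_pos|]. split; [lra|]. split; [intros; lra|].
  intros x y. rewrite Rminus_diag, Rabs_R0. lra.
Qed.

Lemma blip_plus N f g : blip N f -> blip N g -> blip N (fun x => f x + g x).
Proof.
  intros (B & L & HB & HL & H1 & H2) (B' & L' & HB' & HL' & H1' & H2').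
  exists (B + B'), (L + L'). repeat split; try lra.
  - intros x. eapply Rle_trans; [apply Rabs_triang|]. apply Rplus_le_compat; auto.
  - intros x y. replace (f x + g x - (f y + g y)) with (f x - f y + (g x - g y)) by ring.
    eapply Rle_trans; [apply Rabs_triang|]. rewrite Rmult_plus_distr_r.
    apply Rplus_le_compat; auto.
Qed.

Lemma blip_mult N f g : blip N f -> blip N g -> blip N (fun x => f x * g x).
Proof.
  intros (B & L & HB & HL & H1 & H2) (B' & L' & HB' & HL' & H1' & H2').
  exists (B * B'), (L * B' + B * L'). repeat split; try nra.
  - intros x. rewrite Rabs_mult. apply Rmult_le_compat; auto using Rabs_pos.
  - intros x y. replace (f x * g x - f y * g y) with ((f x - f y) * g x + f y * (g x - g y)) by ring.
    eapply Rle_trans; [apply Rabs_triang|]. rewrite !Rabs_mult.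
    set (D := zsum N (fun j => Rabs (x j - y j))).
    assert (Rabs (f x - f y) * Rabs (g x) <= L * D * B')
      by (apply Rmult_le_compat; auto using Rabs_pos).
    assert (Rabs (f y) * Rabs (g x - g y) <= B * (L' * D))
      by (apply Rmult_le_compat; auto using Rabs_pos).
    lra.
Qed.

Lemma blip_zsum N n (f : Z -> (Z -> R) -> R) :
  (forall k, blip N (f k)) -> blip N (fun x => zsum n (fun k => f k x)).
Proof.
  intros H. induction n as [|n IH]; cbn [zsum]; [apply H|].
  apply blip_plus; [exact IH|]. apply blip_plus; apply H.
Qed.

Definition clamp (r y : R) : R := Rmax (- r) (Rmin r y).

Lemma clamp_bound r y : 0 <= r -> Rabs (clamp r y) <= r.
Proof.
  intros Hr. unfold clamp. apply Rabs_le.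
  unfold Rmax, Rmin. repeat destruct Rle_dec; lra.
Qed.

Lemma clamp_lip r y z : 0 <= r -> Rabs (clamp r y - clamp r z) <= Rabs (y - z).
Proof.
  intros Hr. unfold clamp, Rmax, Rmin.
  repeat destruct Rle_dec; unfold Rabs; repeat destruct Rcase_abs; lra.
Qed.

Lemma clamp_id r y : Rabs y <= r -> clamp r y = y.
Proof.
  intros H. apply Rabs_le_between in H. unfold clamp, Rmax, Rmin.
  repeat destruct Rle_dec; lra.
Qed.

Lemma clamp_out r y : 0 <= r -> r < Rabs y -> clamp r y * clamp r y = r * r.
Proof.
  intros Hr H. unfold clamp, Rmax, Rmin.
  revert H. unfold Rabs. destruct Rcase_abs; intros; repeat destruct Rle_dec; try lra; try nra.
Qed.

Lemma blip_clamp N r k : 0 <= r -> blip N (fun x => tr N (fun j => clamp r (x j)) k).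
Proof.
  intros Hr. unfold tr. destruct (Z_le_dec (Z.abs k) (Z.of_nat N)) as [Hk|Hk]; [|apply blip_const].
  exists r, 1. repeat split; try lra.
  - intros x. apply clamp_bound; lra.
  - intros x y. eapply Rle_trans; [apply clamp_lip; lra|]. rewrite Rmult_1_l.
    apply (zsum_term_le N (fun j => Rabs (x j - y j)) k Hk). intros; apply Rabs_pos.
Qed.

(** Piecewise linear in [e]: [1] up to [r], and [0] from [2 r] on. *)
Definition cutoff (r e : R) : R := Rmax 0 (Rmin 1 (2 - e / r)).

Lemma cutoff_range r e : 0 <= cutoff r e <= 1.
Proof. unfold cutoff, Rmax, Rmin. repeat destruct Rle_dec; lra. Qed.

Lemma cutoff_one r e : 0 < r -> e <= r -> cutoff r e = 1.
Proof.
  intros Hr He. assert (e / r <= 1).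
  { apply Rmult_le_reg_r with r; [lra|]. unfold Rdiv. rewrite Rmult_assoc, Rinv_l by lra. lra. }
  unfold cutoff, Rmax, Rmin. repeat destruct Rle_dec; lra.
Qed.

Lemma cutoff_zero r e : 0 < r -> 2 * r <= e -> cutoff r e = 0.
Proof.
  intros Hr He. assert (2 <= e / r).
  { apply Rmult_le_reg_r with r; [lra|]. unfold Rdiv. rewrite Rmult_assoc, Rinv_l by lra. lra. }
  unfold cutoff, Rmax, Rmin. repeat destruct Rle_dec; lra.
Qed.

Lemma cutoff_lip r e f : 0 < r -> Rabs (cutoff r e - cutoff r f) <= / r * Rabs (e - f).
Proof.
  intros Hr.
  replace (/ r * Rabs (e - f)) with (Rabs (e / r - f / r)).
  - unfold cutoff. set (u := e / r). set (v := f / r). unfold Rmax, Rmin.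
    repeat destruct Rle_dec; unfold Rabs; repeat destruct Rcase_abs; lra.
  - replace (e / r - f / r) with (/ r * (e - f)) by (field; lra).
    rewrite Rabs_mult, (Rabs_pos_eq (/ r)); [reflexivity|left; apply Rinv_0_lt_compat; lra].
Qed.

Lemma blip_cutoff N r f : 0 < r -> blip N f -> blip N (fun x => cutoff r (f x)).
Proof.
  intros Hr (B & L & HB & HL & H1 & H2). exists 1, (/ r * L).
  assert (0 < / r) by (apply Rinv_0_lt_compat; lra).
  repeat split; try nra.
  - intros x. pose proof (cutoff_range r (f x)). apply Rabs_le; lra.
  - intros x y. eapply Rle_trans; [apply cutoff_lip; lra|]. rewrite Rmult_assoc.
    apply Rmult_le_compat_l; [lra|]. apply H2.
Qed.

Lemma blip_ext N f g : (forall x, f x = g x) -> blip N f -> blip N g.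
Proof.
  intros H (B & L & HB & HL & H1 & H2). exists B, L. repeat split; auto.
  - intros x. rewrite <- H. auto.
  - intros x y. rewrite <- !H. auto.
Qed.

(** The quantity kept bounded by the a priori estimate: [En 0] controls single coordinates, [En 2]
    controls [lip1] and hence the growth of every energy. *)
Definition En02 (N : nat) (h : Z -> R) : R := En 0 N h + En 2 N h.

Lemma En_ext s N h h' :
  (forall k, (Z.abs k <= Z.of_nat N)%Z -> h k = h' k) -> En s N h = En s N h'.
Proof. intros H. apply zsum_ext. intros k Hk. rewrite H by exact Hk. reflexivity. Qed.

Lemma tr_ext N h h' j :
  (forall k, (Z.abs k <= Z.of_nat N)%Z -> h k = h' k) -> tr N h j = tr N h' j.
Proof. intros H. unfold tr. destruct Z_le_dec; auto. Qed.

Lemma Amat_ext G G' k l : (forall j, G j = G' j) -> Amat G k l = Amat G' k l.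
Proof. intros H. unfold Amat. rewrite !H. reflexivity. Qed.

Lemma QN_ext gam N a a' b b' k :
  (forall j, (Z.abs j <= Z.of_nat N)%Z -> a j = a' j) ->
  (forall j, (Z.abs j <= Z.of_nat N)%Z -> b j = b' j) ->
  QN gam N a b k = QN gam N a' b' k.
Proof.
  intros Ha Hb. unfold QN. f_equal. apply zsum_ext. intros l Hl. rewrite Hb by exact Hl.
  f_equal. apply Amat_ext. intros j. unfold Gop. f_equal. apply tr_ext, Ha.
Qed.

Lemma En02_ge_sqr N h k : (Z.abs k <= Z.of_nat N)%Z -> h k * h k <= En02 N h.
Proof.
  intros Hk. pose proof (En_nonneg 2 N h). unfold En02.
  assert (h k * h k <= En 0 N h); [|lra].
  replace (h k * h k) with (IZR k ^ 0 * IZR k ^ 0 * (h k * h k)) by (simpl; ring).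
  apply (zsum_term_le N (fun k => IZR k ^ 0 * IZR k ^ 0 * (h k * h k)) k Hk).
  intros j. apply Rmult_le_pos; apply Rle_0_sqr.
Qed.

(** [|k h_k| <= (1 / wt k + wt k (k h_k)^2) / 2], where the inverse weights sum to at most [5] and
    [wt k * k^2 <= 2 k^4] because [k] is an integer. *)
Lemma lip1_le_En02 N h : lip1 N h <= 5 + En02 N h.
Proof.
  pose proof (En_nonneg 0 N h). unfold En02.
  cut (lip1 N h <= / 2 * (5 + 2 * En 2 N h)); [lra|].
  apply Rle_trans with (/ 2 * (zsum N (fun k => / wt k) + 2 * En 2 N h)).
  2:{ pose proof (zsum_inv_wt N). lra. }
  unfold En. rewrite <- zsum_scal, <- zsum_plus, <- zsum_scal. apply zsum_le. intros k _.
  assert (IZR k * IZR k <= (IZR k * IZR k) * (IZR k * IZR k)) as Hk.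
  { rewrite <- !mult_IZR. apply IZR_le. nia. }
  pose proof (wt_ge_1 k) as Hw. pose proof (wt_pos k).
  assert (Rabs (IZR k) * Rabs (h k) <= / 2 * (/ wt k + wt k * ((IZR k * h k) * (IZR k * h k)))) as H1.
  { rewrite <- Rabs_mult. set (z := IZR k * h k).
    assert (Rabs z * Rabs z = z * z) as <- by (symmetry; apply Rsqr_abs).
    set (q := Rabs z).
    apply Rmult_le_reg_l with (wt k); [lra|].
    replace (wt k * (/ 2 * (/ wt k + wt k * (q * q)))) with (/ 2 * (1 + (wt k * q) * (wt k * q))) by (field; lra).
    pose proof (Rle_0_sqr (1 - wt k * q)). unfold Rsqr in *. lra. }
  eapply Rle_trans; [exact H1|]. apply Rmult_le_compat_l; [lra|]. apply Rplus_le_compat_l.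
  unfold wt. simpl. pose proof (Rle_0_sqr (h k)). unfold Rsqr in *. nra.
Qed.

(** If clamping moves a coordinate, the clamped one has square [4 r^2], which is at least [2 r]
    since [r >= 1], and the original one is larger; both cutoffs then vanish. *)
Lemma En02_clamp_cutoff N r x :
  1 <= r ->
  let th := fun j => clamp (2 * r) (x j) in
  (forall k, (Z.abs k <= Z.of_nat N)%Z -> th k = x k) \/
  (cutoff r (En02 N th) = 0 /\ cutoff r (En02 N x) = 0).
Proof.
  intros Hr th.
  destruct (classic (forall k, (Z.abs k <= Z.of_nat N)%Z -> Rabs (x k) <= 2 * r)) as [H|H].
  - left. intros k Hk. apply clamp_id. auto.
  - right. apply not_all_ex_not in H. destruct H as [k H]. apply imply_to_and in H.
    destruct H as [Hk H]. apply Rnot_le_lt in H.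
    assert (2 * r <= 2 * r * (2 * r)) by nra.
    split; apply cutoff_zero; try lra.
    + eapply Rle_trans; [|apply (En02_ge_sqr N th k Hk)]. unfold th. rewrite clamp_out by lra. lra.
    + eapply Rle_trans; [|apply (En02_ge_sqr N x k Hk)].
      replace (x k * x k) with (Rabs (x k) * Rabs (x k)) by (symmetry; apply Rsqr_abs). nra.
Qed.

Lemma finite_uniform N (P : Z -> R -> Prop) :
  (forall k b c, P k b -> b <= c -> P k c) ->
  (forall k, exists b, P k b) ->
  exists b, forall k, (Z.abs k <= Z.of_nat N)%Z -> P k b.
Proof.
  intros Hm H. induction N as [|N [b Hb]].
  - destruct (H 0%Z) as [b Hb]. exists b. intros k Hk. replace k with 0%Z by lia. exact Hb.
  - destruct (H (Z.of_nat (S N))) as [b1 Hb1]. destruct (H (- Z.of_nat (S N))%Z) as [b2 Hb2].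
    exists (Rmax b (Rmax b1 b2)). intros k Hk.
    destruct (Z_le_gt_dec (Z.abs k) (Z.of_nat N)).
    + apply Hm with b; [apply Hb; lia|apply Rmax_l].
    + assert (k = Z.of_nat (S N) \/ k = - Z.of_nat (S N))%Z as [->| ->] by lia.
      * eapply Hm; [exact Hb1|]. eapply Rle_trans; [apply Rmax_l|apply Rmax_r].
      * eapply Hm; [exact Hb2|]. eapply Rle_trans; [apply Rmax_r|apply Rmax_r].
Qed.

(** Clamping the coordinates makes the field globally Lipschitz and changes
    nothing where the cutoff is nonzero. *)
Lemma galerkin_cutoff gam N r x0 :
  1 <= r ->
  exists x : R -> Z -> R, (forall k, x 0 k = x0 k) /\
    forall k t, (Z.abs k <= Z.of_nat N)%Z ->
      is_derive (fun t => x t k) t (cutoff r (En02 N (x t)) * QN gam N (x t) (x t) k).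
Proof.
  intros Hr.
  set (th := fun (x : Z -> R) j => clamp (2 * r) (x j)).
  set (p := fun k x => cutoff r (En02 N (tr N (th x))) * QN gam N (th x) (tr N (th x)) k).
  assert (forall k, blip N (fun x => tr N (th x) k)) as Hth
    by (intros k; apply (blip_clamp N (2 * r) k); lra).
  assert (forall s, blip N (fun x => En s N (tr N (th x)))) as HE.
  { intros s. apply blip_zsum. intros k. apply blip_mult; [apply blip_const|].
    apply blip_mult; apply Hth. }
  assert (forall k, blip N (p k)) as Hp.
  { intros k. apply blip_mult.
    - apply blip_cutoff; [lra|]. apply blip_plus; apply HE.
    - unfold QN.
      apply blip_ext with (fun x => -1 * zsum N (fun l =>
        Amat (Gop gam (tr N (th x))) k l * (IZR l * tr N (th x) l))); [intros; ring|].
      apply blip_mult; [apply blip_const|]. apply blip_zsum. intros l.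
      assert (forall j, blip N (fun x => Gop gam (tr N (th x)) j)) as HG.
      { intros j. apply blip_mult; [apply blip_const|apply Hth]. }
      apply blip_mult; [|apply blip_mult; [apply blip_const|apply Hth]].
      apply blip_ext with (fun x => / 2 * ((Gop gam (tr N (th x)) (k - l) + (-1) * Gop gam (tr N (th x)) (l - k))
        + (Gop gam (tr N (th x)) (k + l) + Gop gam (tr N (th x)) (- k - l)))).
      { intros x. unfold Amat. field. }
      apply blip_mult; [apply blip_const|]. apply blip_plus; apply blip_plus; auto.
      apply blip_mult; [apply blip_const|apply HG]. }
  (* With the field set to zero outside the window, constants maximised over finitely many [k] serve
     for every [k]. *)
  set (p' := fun k x => if Z_le_dec (Z.abs k) (Z.of_nat N) then p k x else 0).
  destruct (finite_uniform N (fun k b => (forall x, Rabs (p k x) <= b) /\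
    forall x y, Rabs (p k x - p k y) <= b * zsum N (fun j => Rabs (x j - y j)))) as [b Hb].
  { intros k b c [H1 H2] Hbc. split.
    - intros x. specialize (H1 x). lra.
    - intros x y. eapply Rle_trans; [apply H2|]. apply Rmult_le_compat_r; [apply dist_nonneg|lra]. }
  { intros k. destruct (Hp k) as (B & L & HB & HL & H1 & H2).
    exists (B + L). split.
    - intros x. specialize (H1 x). lra.
    - intros x y. eapply Rle_trans; [apply H2|]. apply Rmult_le_compat_r; [apply dist_nonneg|lra]. }
  assert (0 <= b) as Hb0.
  { destruct (Hb 0%Z ltac:(lia)) as [H _]. specialize (H x0). pose proof (Rabs_pos (p 0%Z x0)). lra. }
  destruct (picard_lindelof N p' x0 b (b + 1)) as [x [Hx0 Hx]].
  - lra.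
  - intros k x. unfold p'. destruct Z_le_dec as [Hk|Hk]; [apply Hb; exact Hk|].
    rewrite Rabs_R0. exact Hb0.
  - intros k x y. pose proof (dist_nonneg N x y). unfold p'. destruct Z_le_dec as [Hk|Hk].
    + eapply Rle_trans; [apply Hb; exact Hk|]. apply Rmult_le_compat_r; lra.
    + rewrite Rminus_diag, Rabs_R0. apply Rmult_le_pos; lra.
  - exists x. split; [exact Hx0|]. intros k t Hk.
    replace (cutoff r (En02 N (x t)) * QN gam N (x t) (x t) k) with (p' k (x t)); [apply Hx|].
    unfold p'. destruct Z_le_dec as [_|Hk']; [|contradiction]. unfold p.
    assert (En02 N (tr N (th (x t))) = En02 N (th (x t))) as ->.
    { unfold En02. f_equal; apply En_ext; intros; apply tr_in; assumption. }
    rewrite (QN_ext gam N (th (x t)) (th (x t)) (tr N (th (x t))) (th (x t)))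
      by (auto using tr_in).
    destruct (En02_clamp_cutoff N r (x t) Hr) as [H|[H1 H2]].
    + fold (th (x t)) in H. rewrite (QN_ext gam N _ (x t) _ (x t)) by exact H.
      f_equal. f_equal. unfold En02. f_equal; apply En_ext; exact H.
    + fold (th (x t)) in H1. rewrite H1, H2. ring.
Qed.

Lemma is_derive_En s N (x : R -> Z -> R) (x' : Z -> R) t :
  (forall k, (Z.abs k <= Z.of_nat N)%Z -> is_derive (fun t => x t k) t (x' k)) ->
  is_derive (fun t => En s N (x t)) t
    (2 * zsum N (fun k => IZR k ^ s * IZR k ^ s * x t k * x' k)).
Proof.
  intros H. rewrite <- zsum_scal. unfold En.
  apply (is_derive_zsum N (fun k t => IZR k ^ s * IZR k ^ s * (x t k * x t k))).
  intros k Hk.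
  replace (2 * (IZR k ^ s * IZR k ^ s * x t k * x' k))
    with (IZR k ^ s * IZR k ^ s * (x' k * x t k + x t k * x' k)) by ring.
  apply is_derive_scal.
  apply (is_derive_mult (fun t => x t k) (fun t => x t k)); auto. intros; apply Rmult_comm.
Qed.

Definition Kc (M : R) (s : nat) : R :=
  match s with
  | O => 2 * M
  | S p => INR (S (2 * p)) * 2 ^ p * (3 * M + 2 * (M * M) + 1)
  end.

Lemma Kc_nonneg M s : 0 <= M -> 0 <= Kc M s.
Proof.
  intros HM. destruct s as [|p]; unfold Kc; [lra|].
  apply Rmult_le_pos; [|nra]. apply Rmult_le_pos; [apply pos_INR|apply pow_le; lra].
Qed.

Lemma energy_estimate gam M s N h :
  (forall j, Rabs (gam j) <= M) ->
  Rabs (zsum N (fun k => IZR k ^ s * IZR k ^ s * h k * QN gam N h h k))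
  <= Kc M s * lip1 N h * En s N h.
Proof.
  intros HM. destruct s as [|p]; [|apply energy_estimate_S; exact HM].
  rewrite (zsum_ext N _ (fun k => h k * QN gam N h h k)) by (intros; simpl; ring).
  apply energy_estimate_0. exact HM.
Qed.

(** [E exp (- K s) - e s] is nonincreasing. A derivative is asked for on the open interval and
    continuity on the closed one, since an arbitrary solution is differentiable in time only at
    positive times. *)
Lemma gronwall (E E' : R -> R) K e T t :
  0 <= K -> 0 <= e ->
  (forall s, 0 < s < T -> is_derive E s (E' s)) ->
  (forall s, 0 <= s <= T -> continuity_pt E s) ->
  (forall s, 0 < s < T -> E' s <= K * E s + e) ->
  0 <= t <= T ->
  E t <= (E 0 + e * t) * exp (K * t).
Proof.
  intros HK He Hd Hc HE Ht.
  set (g := fun s => E s * exp (- (K * s)) - e * s).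
  assert (g t - g 0 <= 0 * (t - 0)) as H.
  { apply (mvt_le g (fun s => E' s * exp (- (K * s)) + E s * (- K * exp (- (K * s))) - e)); [lra| | |].
    - intros s Hs. unfold g.
      apply (is_derive_minus (fun s => E s * exp (- (K * s))) (fun s => e * s)).
      + apply (is_derive_mult E (fun s => exp (- (K * s)))); [apply Hd; lra| |intros; apply Rmult_comm].
        auto_derive; [trivial|ring].
      + auto_derive; [trivial|ring].
    - intros s Hs. unfold g. apply continuity_pt_minus.
      + apply continuity_pt_mult; [apply Hc; lra|].
        apply is_derive_continuity_pt with (- K * exp (- (K * s))). auto_derive; [trivial|ring].
      + apply is_derive_continuity_pt with e. auto_derive; [trivial|ring].
    - intros s Hs. pose proof (HE s ltac:(lra)) as H1. pose proof (exp_pos (- (K * s))) as H2.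
      assert (exp (- (K * s)) <= 1).
      { rewrite <- exp_0. destruct (Req_dec (K * s) 0) as [->|Hn]; [rewrite Ropp_0; lra|].
        left. apply exp_increasing. assert (0 <= K * s) by (apply Rmult_le_pos; lra). lra. }
      nra. }
  unfold g in H. rewrite Rmult_0_r, Ropp_0, exp_0, Rmult_0_r in H.
  assert (E t = E t * exp (- (K * t)) * exp (K * t)) as ->.
  { rewrite Rmult_assoc, <- exp_plus, Rplus_opp_l, exp_0. ring. }
  apply Rmult_le_compat_r; [left; apply exp_pos|]. lra.
Qed.

(** Where [En02 <= 2 r], also [lip1 <= 5 + 2 r], and the energy estimates bound the derivative of
    [En02] by the product in the denominator. Over this time [En02] grows by at most [1], whatever
    [N]. *)
Definition galerkin_time (M r : R) : R :=
  / (2 * (Kc M 0 + Kc M 2) * (5 + 2 * r) * (2 * r) + 1).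

Lemma galerkin_time_pos M r : 0 <= M -> 1 <= r -> 0 < galerkin_time M r.
Proof.
  intros HM Hr. apply Rinv_0_lt_compat.
  pose proof (Kc_nonneg M 0 HM). pose proof (Kc_nonneg M 2 HM).
  assert (0 <= 2 * (Kc M 0 + Kc M 2) * (5 + 2 * r) * (2 * r)); [|lra].
  repeat apply Rmult_le_pos; lra.
Qed.

(** No continuation argument is involved: the cutoff vanishes where [En02 >= 2 r], so the bound on
    the growth of [En02] holds at every time. Starting at most at [r - 1], [En02] stays below [r],
    where the cutoff is [1] and the true system is solved. *)
Lemma galerkin_exists gam M N r x0 :
  (forall j, Rabs (gam j) <= M) -> 1 <= r -> En02 N x0 + 1 <= r ->
  exists x : R -> Z -> R, (forall k, x 0 k = x0 k) /\
    (forall t, 0 <= t <= galerkin_time M r -> En02 N (x t) <= r) /\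
    (forall k t, (Z.abs k <= Z.of_nat N)%Z -> 0 <= t <= galerkin_time M r ->
      is_derive (fun t => x t k) t (QN gam N (x t) (x t) k)).
Proof.
  intros Hgam Hr Hx0.
  pose proof (gam_bound_nonneg gam M Hgam) as HM.
  destruct (galerkin_cutoff gam N r x0 Hr) as [x [Hx Hd]].
  pose proof (Kc_nonneg M 0 HM) as HK0. pose proof (Kc_nonneg M 2 HM) as HK2.
  set (Lam := 2 * (Kc M 0 + Kc M 2) * (5 + 2 * r) * (2 * r)).
  assert (0 <= Lam) as HLam by (unfold Lam; repeat apply Rmult_le_pos; lra).
  set (chi := fun t => cutoff r (En02 N (x t))).
  set (S' := fun s t => zsum N (fun k => IZR k ^ s * IZR k ^ s * x t k * QN gam N (x t) (x t) k)).
  assert (forall s t, is_derive (fun t => En s N (x t)) t (2 * (chi t * S' s t))) as HEd.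
  { intros s t.
    replace (2 * (chi t * S' s t)) with (2 * zsum N (fun k =>
      IZR k ^ s * IZR k ^ s * x t k * (chi t * QN gam N (x t) (x t) k))).
    - apply (is_derive_En s N x (fun k => chi t * QN gam N (x t) (x t) k)).
      intros k Hk. apply Hd; exact Hk.
    - unfold S'. f_equal. rewrite <- zsum_scal. apply zsum_ext. intros; ring. }
  assert (forall t, is_derive (fun t => En02 N (x t)) t (2 * (chi t * S' 0%nat t) + 2 * (chi t * S' 2%nat t))) as HE.
  { intros t. apply (is_derive_plus (fun t => En 0 N (x t)) (fun t => En 2 N (x t))); apply HEd. }
  assert (forall t, 0 <= t <= galerkin_time M r -> En02 N (x t) <= r) as HEr.
  { intros t Ht.
    assert (En02 N (x t) - En02 N (x 0) <= Lam * (t - 0)) as H.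
    { apply (mvt_le (fun t => En02 N (x t)) _ 0 t Lam ltac:(lra) (fun s _ => HE s)).
      - intros s _. eapply is_derive_continuity_pt, HE.
      - intros s _. pose proof (cutoff_range r (En02 N (x s))) as Hc. fold (chi s) in Hc.
        destruct (Rle_dec (2 * r) (En02 N (x s))) as [Hbig|Hsmall].
        { assert (chi s = 0) as -> by (apply cutoff_zero; lra). lra. }
        pose proof (En_nonneg 0 N (x s)). pose proof (En_nonneg 2 N (x s)).
        pose proof (lip1_nonneg N (x s)) as HA0. pose proof (lip1_le_En02 N (x s)) as HA.
        pose proof (energy_estimate gam M 0 N (x s) Hgam) as HS0. fold (S' 0%nat s) in HS0.
        pose proof (energy_estimate gam M 2 N (x s) Hgam) as HS2. fold (S' 2%nat s) in HS2.
        assert (forall sg K A E : R, Rabs sg <= K * A * E -> 0 <= K -> 0 <= A <= 5 + 2 * r -> 0 <= E <= 2 * r ->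
          chi s * sg <= K * (5 + 2 * r) * (2 * r)) as Haux.
        { intros sg K A E Hs HK HA' HE'.
          assert (K * A * E <= K * (5 + 2 * r) * (2 * r)).
          { apply Rmult_le_compat; try lra; [apply Rmult_le_pos; lra|]. apply Rmult_le_compat_l; lra. }
          pose proof (Rle_abs sg). pose proof (Rabs_pos sg).
          assert (chi s * sg <= chi s * Rabs sg) by (apply Rmult_le_compat_l; lra). nra. }
        unfold En02 in *.
        pose proof (Haux _ _ _ _ HS0 HK0 ltac:(lra) ltac:(lra)).
        pose proof (Haux _ _ _ _ HS2 HK2 ltac:(lra) ltac:(lra)).
        unfold Lam. lra. }
    assert (En02 N (x 0) = En02 N x0) as Hx0'.
    { unfold En02. f_equal; apply En_ext; intros; apply Hx. }
    assert (Lam * t <= 1).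
    { apply Rle_trans with (Lam * galerkin_time M r); [apply Rmult_le_compat_l; lra|].
      unfold galerkin_time. fold Lam. apply Rmult_le_reg_r with (Lam + 1); [lra|].
      rewrite Rmult_assoc, Rinv_l by lra. lra. }
    lra. }
  exists x. split; [exact Hx|]. split; [exact HEr|].
  intros k t Hk Ht. pose proof (Hd k t Hk) as H.
  rewrite cutoff_one, Rmult_1_l in H; [exact H|lra|]. apply HEr; exact Ht.
Qed.

Lemma galerkin_energy gam M N r T (x : R -> Z -> R) s t :
  (forall j, Rabs (gam j) <= M) ->
  (forall t, 0 <= t <= T -> En02 N (x t) <= r) ->
  (forall k t, (Z.abs k <= Z.of_nat N)%Z -> 0 <= t <= T ->
      is_derive (fun t => x t k) t (QN gam N (x t) (x t) k)) ->
  0 <= t <= T ->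
  En s N (x t) <= En s N (x 0) * exp (2 * Kc M s * (5 + r) * t).
Proof.
  intros Hgam HE Hd Ht. pose proof (gam_bound_nonneg gam M Hgam) as HM.
  pose proof (Kc_nonneg M s HM) as HK.
  assert (0 <= r) as Hr.
  { pose proof (HE 0 ltac:(lra)). pose proof (En_nonneg 0 N (x 0)). pose proof (En_nonneg 2 N (x 0)).
    unfold En02 in *. lra. }
  set (S' := fun t => zsum N (fun k => IZR k ^ s * IZR k ^ s * x t k * QN gam N (x t) (x t) k)).
  assert (forall t, 0 <= t <= T -> is_derive (fun t => En s N (x t)) t (2 * S' t)) as HEd.
  { intros u Hu. apply (is_derive_En s N x (fun k => QN gam N (x u) (x u) k)). auto. }
  replace (En s N (x 0)) with (En s N (x 0) + 0 * t) by ring.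
  apply (gronwall (fun t => En s N (x t)) (fun t => 2 * S' t) _ 0 T); auto.
  - repeat apply Rmult_le_pos; lra.
  - lra.
  - intros u Hu. apply HEd; lra.
  - intros u Hu. eapply is_derive_continuity_pt, HEd; lra.
  - intros u Hu. pose proof (energy_estimate gam M s N (x u) Hgam) as H. fold (S' u) in H.
    pose proof (Rle_abs (S' u)). pose proof (En_nonneg s N (x u)).
    pose proof (lip1_le_En02 N (x u)). pose proof (HE u ltac:(lra)). pose proof (lip1_nonneg N (x u)).
    assert (Kc M s * lip1 N (x u) * En s N (x u) <= Kc M s * (5 + r) * En s N (x u)).
    { apply Rmult_le_compat_r; [lra|]. apply Rmult_le_compat_l; lra. }
    lra.
Qed.

(** * Stability *)

Lemma Amat_abs_le G k l e : (forall j, Rabs (G j) <= e) -> Rabs (Amat G k l) <= 2 * e.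
Proof.
  intros H. pose proof (H (k - l)%Z) as H1. pose proof (H (l - k)%Z) as H2.
  pose proof (H (k + l)%Z) as H3. pose proof (H (- k - l)%Z) as H4.
  apply Rabs_le_between in H1, H2, H3, H4. unfold Amat. apply Rabs_le; lra.
Qed.

Lemma Amat_minus G G' k l : Amat G k l - Amat G' k l = Amat (fun j => G j - G' j) k l.
Proof. unfold Amat. field. Qed.

Lemma Gop_abs_le gam M D e j :
  (forall j, Rabs (gam j) <= M) -> (forall j, Rabs (D j) <= e) -> Rabs (Gop gam D j) <= M * e.
Proof.
  intros HM HD. unfold Gop. rewrite Rabs_mult. apply Rmult_le_compat; auto using Rabs_pos.
Qed.

Lemma tr_minus N a b j : tr N (fun j => a j - b j) j = tr N a j - tr N b j.
Proof. unfold tr. destruct Z_le_dec; ring. Qed.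

Lemma tr_abs_le N a e j : 0 <= e ->
  (forall k, (Z.abs k <= Z.of_nat N)%Z -> Rabs (a k) <= e) -> Rabs (tr N a j) <= e.
Proof. intros He H. unfold tr. destruct Z_le_dec; [auto|rewrite Rabs_R0; auto]. Qed.

Lemma QN_minus gam N d c k :
  QN gam N d d k - QN gam N c c k =
  QN gam N d (fun j => d j - c j) k + QN gam N (fun j => d j - c j) c k.
Proof.
  unfold QN.
  assert (forall a b : Z -> R, - zsum N a - - zsum N b = - zsum N (fun l => a l - b l)) as ->
    by (intros; rewrite zsum_minus; ring).
  assert (forall a b : Z -> R, - zsum N a + - zsum N b = - zsum N (fun l => a l + b l)) as ->
    by (intros; rewrite zsum_plus; ring).
  f_equal. apply zsum_ext. intros l _.
  rewrite (Amat_ext (Gop gam (tr N (fun j => d j - c j)))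
    (fun j => Gop gam (tr N d) j - Gop gam (tr N c) j)).
  - rewrite <- Amat_minus. ring.
  - intros j. unfold Gop. rewrite tr_minus. ring.
Qed.

Lemma QN_bound gam M N a b e L k :
  (forall j, Rabs (gam j) <= M) -> 0 <= e ->
  (forall j, (Z.abs j <= Z.of_nat N)%Z -> Rabs (a j) <= e) -> lip1 N b <= L ->
  Rabs (QN gam N a b k) <= 2 * (M * e) * L.
Proof.
  intros HM He Ha Hb. unfold QN. rewrite Rabs_Ropp.
  pose proof (gam_bound_nonneg gam M HM).
  eapply Rle_trans; [apply zsum_Rabs|].
  apply Rle_trans with (zsum N (fun l => 2 * (M * e) * (Rabs (IZR l) * Rabs (b l)))).
  - apply zsum_le. intros l _. rewrite !Rabs_mult.
    apply Rmult_le_compat_r; [apply Rmult_le_pos; apply Rabs_pos|].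
    apply Amat_abs_le. intros j. apply Gop_abs_le; auto. intros i. apply tr_abs_le; auto.
  - rewrite zsum_scal. apply Rmult_le_compat_l; [|exact Hb].
    assert (0 <= M * e) by (apply Rmult_le_pos; assumption). lra.
Qed.

(** * Decay in powers of the weight, and truncation errors *)

Lemma Rabs_IZR_le_wt k : Rabs (IZR k) <= wt k.
Proof.
  unfold wt. apply Rabs_le. split; nra.
Qed.

Lemma pow_wt_le p q k : (p <= q)%nat -> wt k ^ p <= wt k ^ q.
Proof. intros H. apply Rle_pow; [apply wt_ge_1|exact H]. Qed.

Lemma decay_weaken (x C : R) p q k : (p <= q)%nat -> Rabs x * wt k ^ q <= C -> Rabs x * wt k ^ p <= C.
Proof.
  intros Hpq H. eapply Rle_trans; [|exact H].
  apply Rmult_le_compat_l; [apply Rabs_pos|]. apply pow_wt_le; exact Hpq.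
Qed.

Lemma decay_abs (x C : R) p k : Rabs x * wt k ^ p <= C -> Rabs x <= C.
Proof.
  intros H. apply (decay_weaken x C 0 p k) in H; [|lia]. simpl in H. lra.
Qed.

Lemma decay_div (x C : R) k : Rabs x * wt k <= C -> Rabs x <= C * / wt k.
Proof.
  intros H. pose proof (wt_pos k). apply Rmult_le_reg_r with (wt k); [lra|].
  rewrite Rmult_assoc, Rinv_l by lra. lra.
Qed.

Lemma decay_lip1_term (x C : R) k p :
  (2 <= p)%nat -> Rabs x * wt k ^ p <= C -> Rabs (IZR k * x) <= C * / wt k.
Proof.
  intros Hp H. apply (decay_weaken x C 2 p k) in H; [|exact Hp]. apply decay_div.
  rewrite Rabs_mult. simpl in H. pose proof (Rabs_IZR_le_wt k). pose proof (Rabs_pos x).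
  pose proof (wt_pos k).
  assert (Rabs (IZR k) * Rabs x <= wt k * Rabs x) by (apply Rmult_le_compat_r; assumption).
  assert (Rabs (IZR k) * Rabs x * wt k <= wt k * Rabs x * wt k) by (apply Rmult_le_compat_r; lra).
  lra.
Qed.

Lemma decay_lip1 N h C p :
  (2 <= p)%nat -> (forall k, (Z.abs k <= Z.of_nat N)%Z -> Rabs (h k) * wt k ^ p <= C) ->
  lip1 N h <= 5 * C.
Proof.
  intros Hp H.
  assert (0 <= C) as HC.
  { pose proof (H 0%Z ltac:(lia)) as H0. apply decay_abs in H0. pose proof (Rabs_pos (h 0%Z)). lra. }
  apply Rle_trans with (zsum N (fun k => C * / wt k)).
  - apply zsum_le. intros k Hk. rewrite <- Rabs_mult. apply (decay_lip1_term _ _ _ p); auto.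
  - rewrite zsum_scal. pose proof (zsum_inv_wt N). nra.
Qed.

Lemma wt_large N k : (Z.of_nat N < Z.abs k)%Z -> (INR N + 1) * (INR N + 1) <= wt k.
Proof.
  intros H. unfold wt.
  assert (INR N + 1 <= Rabs (IZR k)).
  { rewrite <- abs_IZR, INR_IZR_INZ, <- plus_IZR. apply IZR_le. lia. }
  pose proof (pos_INR N).
  assert (IZR k * IZR k = Rabs (IZR k) * Rabs (IZR k)) as -> by apply Rsqr_abs. nra.
Qed.

(** Two errors: the terms with [|l| > N] (constant [8]) and the truncation of the velocity (constant
    [10]). In the first, of the three powers of the weight, one absorbs the factor [l], one makes
    the sum converge and one gives the rate [(N + 1)^-2]. The order [n] is free, so the bound covers
    both higher truncations and the full series. *)
Lemma truncation_residual gam M D C N n k :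
  (forall j, Rabs (gam j) <= M) -> (N <= n)%nat ->
  (forall j, Rabs (D j) * wt j ^ 3 <= C) ->
  Rabs (zsum n (fun l => Amat (Gop gam D) k l * (IZR l * D l)) + QN gam N D D k)
  <= 18 * (M * (C * C)) / ((INR N + 1) * (INR N + 1)).
Proof.
  intros HM HN HD. pose proof (gam_bound_nonneg gam M HM) as HM0.
  assert (0 <= C) as HC.
  { pose proof (HD 0%Z) as H0. apply decay_abs in H0. pose proof (Rabs_pos (D 0%Z)). lra. }
  pose proof (pos_INR N) as HNp. set (q := (INR N + 1) * (INR N + 1)).
  assert (1 <= q) as Hq by (unfold q; nra).
  set (f := fun l => Amat (Gop gam D) k l * (IZR l * D l)).
  assert (forall l, Rabs (Amat (Gop gam D) k l) <= 2 * (M * C)) as HA.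
  { intros l. apply Amat_abs_le. intros j. apply Gop_abs_le; auto. intros i. eapply decay_abs, HD. }
  assert (Rabs (zsum n f - zsum N f) <= 8 * (M * (C * C)) / q) as H1.
  { eapply Rle_trans; [apply (zsum_tail N n f (2 * (M * C) * (C / q)) HN)|].
    - repeat apply Rmult_le_pos; try lra. left. apply Rinv_0_lt_compat; lra.
    - intros l Hl. unfold f. rewrite Rabs_mult.
      replace (2 * (M * C) * (C / q) * / wt l) with (2 * (M * C) * (C / q * / wt l)) by ring.
      apply Rmult_le_compat; auto using Rabs_pos.
      apply decay_div. apply Rmult_le_reg_r with q; [lra|].
      unfold Rdiv. rewrite Rmult_assoc, Rmult_assoc, Rinv_l, Rmult_1_r by lra.
      pose proof (wt_large N l Hl) as Hw. fold q in Hw. pose proof (wt_pos l).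
      rewrite Rabs_mult. pose proof (Rabs_IZR_le_wt l). pose proof (HD l) as Hl3. simpl in Hl3.
      pose proof (Rabs_pos (D l)). pose proof (Rabs_pos (IZR l)).
      apply Rle_trans with (Rabs (D l) * (wt l * (wt l * (wt l * 1)))); [|exact Hl3].
      replace (Rabs (IZR l) * Rabs (D l) * (wt l * q)) with (Rabs (D l) * (Rabs (IZR l) * (wt l * q))) by ring.
      apply Rmult_le_compat_l; [assumption|]. rewrite Rmult_1_r.
      apply Rmult_le_compat; try assumption; [nra|]. apply Rmult_le_compat_l; lra.
    - unfold Rdiv. replace (4 * (2 * (M * C) * (C * / q)) * / (INR N + 1))
        with (8 * (M * (C * C)) * / q * / (INR N + 1)) by ring.
      rewrite <- (Rmult_1_r (8 * (M * (C * C)) * / q)) at 2.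
      apply Rmult_le_compat_l.
      + apply Rmult_le_pos; [|left; apply Rinv_0_lt_compat; lra].
        apply Rmult_le_pos; [lra|]. apply Rmult_le_pos; [lra|nra].
      + rewrite <- Rinv_1. apply Rinv_le_contravar; lra. }
  assert (Rabs (zsum N f + QN gam N D D k) <= 10 * (M * (C * C)) / q) as H2.
  { unfold QN. fold (zsum N f - zsum N (fun l => Amat (Gop gam (tr N D)) k l * (IZR l * D l))).
    rewrite <- zsum_minus.
    eapply Rle_trans; [apply zsum_Rabs|].
    apply Rle_trans with (zsum N (fun l => 2 * (M * (C / q)) * (Rabs (IZR l) * Rabs (D l)))).
    - apply zsum_le. intros l _. unfold f. rewrite <- Rmult_minus_distr_r, Amat_minus, !Rabs_mult.
      apply Rmult_le_compat_r; [apply Rmult_le_pos; apply Rabs_pos|].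
      apply Amat_abs_le. intros j.
      replace (Gop gam D j - Gop gam (tr N D) j) with (Gop gam (fun i => D i - tr N D i) j) by (unfold Gop; ring).
      apply Gop_abs_le; auto. intros i. unfold tr. destruct Z_le_dec as [Hi|Hi].
      + rewrite Rminus_diag, Rabs_R0. apply Rdiv_le_0_compat; lra.
      + rewrite Rminus_0_r. apply Rmult_le_reg_r with q; [lra|].
        unfold Rdiv. rewrite Rmult_assoc, Rinv_l, Rmult_1_r by lra.
        pose proof (wt_large N i ltac:(lia)) as Hw. fold q in Hw.
        pose proof (decay_weaken (D i) C 1 3 i ltac:(lia) (HD i)) as Hd. rewrite pow_1 in Hd.
        pose proof (Rabs_pos (D i)). nra.
    - rewrite zsum_scal. fold (lip1 N D).
      pose proof (decay_lip1 N D C 3 ltac:(lia) (fun j _ => HD j)) as Hl.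
      replace (10 * (M * (C * C)) / q) with (2 * (M * (C / q)) * (5 * C)) by (field; lra).
      apply Rmult_le_compat_l; [|exact Hl].
      assert (0 <= C / q) by (apply Rdiv_le_0_compat; lra).
      assert (0 <= M * (C / q)) by (apply Rmult_le_pos; assumption). lra. }
  replace (zsum n f + QN gam N D D k) with ((zsum n f - zsum N f) + (zsum N f + QN gam N D D k)) by ring.
  eapply Rle_trans; [apply Rabs_triang|].
  replace (18 * (M * (C * C)) / q) with (8 * (M * (C * C)) / q + 10 * (M * (C * C)) / q) by (field; lra).
  lra.
Qed.

(** Twice the sum of the rates of [energy_estimate_0] and [pairing_estimate_0], plus [1] from
    completing the square in the residual. *)
Definition stab_rate (M L : R) : R := 2 * (2 * M * L + (2 * (M * M) + 1) * L) + 1.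

(** The difference [w = d - c] solves [w' = QN d w + QN w c + r]: the first term is a commutator,
    the second has its derivative on [c], and the residual contributes [e^2] for each of the
    [2 N + 1] coordinates. *)
Lemma stability gam M N T L e (c d : R -> Z -> R) (r : R -> Z -> R) t :
  (forall j, Rabs (gam j) <= M) -> 0 <= e ->
  (forall k s, (Z.abs k <= Z.of_nat N)%Z -> 0 < s < T ->
    is_derive (fun s => c s k) s (QN gam N (c s) (c s) k)) ->
  (forall k s, (Z.abs k <= Z.of_nat N)%Z -> 0 < s < T ->
    is_derive (fun s => d s k) s (QN gam N (d s) (d s) k + r s k)) ->
  (forall k s, (Z.abs k <= Z.of_nat N)%Z -> 0 <= s <= T ->
    continuity_pt (fun s => c s k) s /\ continuity_pt (fun s => d s k) s) ->
  (forall k s, (Z.abs k <= Z.of_nat N)%Z -> 0 < s < T -> Rabs (r s k) <= e) ->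
  (forall s, 0 < s < T -> lip1 N (c s) <= L /\ lip1 N (d s) <= L) ->
  (forall k, (Z.abs k <= Z.of_nat N)%Z -> c 0 k = d 0 k) ->
  0 <= t <= T ->
  En 0 N (fun k => d t k - c t k) <= (2 * INR N + 1) * (e * e) * t * exp (stab_rate M L * t).
Proof.
  intros HM He Hc Hd Hcont Hr HL H0 Ht. pose proof (gam_bound_nonneg gam M HM) as HM0.
  (* For [T = 0] the hypotheses on the open interval are void; otherwise its midpoint shows
     [0 <= L]. *)
  destruct (Req_dec T 0) as [HT|HT].
  { assert (t = 0) as -> by lra.
    unfold En. rewrite (zsum_ext N _ (fun _ => 0)); [rewrite zsum_0; right; ring|].
    intros k Hk. rewrite (H0 k Hk). ring. }
  assert (0 <= L) as HL0.
  { destruct (HL (T / 2) ltac:(lra)) as [H _]. pose proof (lip1_nonneg N (c (T / 2))). lra. }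
  set (w := fun s k => d s k - c s k).
  set (w' := fun s k => QN gam N (d s) (d s) k + r s k - QN gam N (c s) (c s) k).
  replace ((2 * INR N + 1) * (e * e) * t) with (En 0 N (w 0) + (2 * INR N + 1) * (e * e) * t).
  2:{ assert (En 0 N (w 0) = 0) as ->; [|ring].
      unfold En. rewrite (zsum_ext N _ (fun _ => 0)); [apply zsum_0|].
      intros k Hk. unfold w. rewrite (H0 k Hk). ring. }
  assert (0 <= M * L) by (apply Rmult_le_pos; assumption).
  assert (0 <= M * M * L) by (repeat apply Rmult_le_pos; assumption).
  pose proof (pos_INR N) as HNp.
  apply (gronwall (fun s => En 0 N (w s)) (fun s => 2 * zsum N (fun k => IZR k ^ 0 * IZR k ^ 0 * w s k * w' s k))
    _ _ T); auto.
  - unfold stab_rate. nra.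
  - apply Rmult_le_pos; [lra|nra].
  - intros s Hs. apply (is_derive_En 0 N w (w' s)). intros k Hk.
    apply (is_derive_minus (fun s => d s k) (fun s => c s k)); auto.
  - intros s Hs. apply continuity_pt_filterlim. apply continuous_zsum. intros k Hk.
    assert (continuous (fun s => w s k) s).
    { apply continuous_Rminus; apply continuity_pt_filterlim; apply Hcont; auto. }
    apply continuous_Rmult; [apply continuous_const|]. apply continuous_Rmult; assumption.
  - intros s Hs. destruct (HL s Hs) as [Hlc Hld].
    pose proof (energy_estimate_0 gam M HM N (d s) (w s)) as Hest1.
    pose proof (pairing_estimate_0 gam M HM N (w s) (c s)) as Hest2.
    pose proof (En_nonneg 0 N (w s)) as HE.
    rewrite (zsum_ext N _ (fun k => (w s k * QN gam N (d s) (w s) k + w s k * QN gam N (w s) (c s) k) + w s k * r s k)).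
    2:{ intros k _. unfold w'. simpl.
        replace (QN gam N (d s) (d s) k + r s k - QN gam N (c s) (c s) k)
          with ((QN gam N (d s) (d s) k - QN gam N (c s) (c s) k) + r s k) by ring.
        rewrite QN_minus. fold (w s). unfold w. ring. }
    rewrite !zsum_plus.
    assert (2 * zsum N (fun k => w s k * r s k) <= En 0 N (w s) + (2 * INR N + 1) * (e * e)) as Hest3.
    { rewrite <- zsum_scal, <- zsum_const. unfold En. rewrite <- zsum_plus. apply zsum_le.
      intros k Hk. simpl. specialize (Hr k s Hk Hs).
      assert (r s k * r s k <= e * e).
      { replace (r s k * r s k) with (Rabs (r s k) * Rabs (r s k)) by (symmetry; apply Rsqr_abs).
        apply Rmult_le_compat; auto using Rabs_pos. }
      pose proof (Rle_0_sqr (w s k - r s k)). unfold Rsqr in *. lra. }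
    pose proof (Rle_abs (zsum N (fun k => w s k * QN gam N (d s) (w s) k))).
    pose proof (Rle_abs (zsum N (fun k => w s k * QN gam N (w s) (c s) k))).
    assert (2 * M * lip1 N (d s) * En 0 N (w s) <= 2 * M * L * En 0 N (w s)).
    { apply Rmult_le_compat_r; [assumption|]. apply Rmult_le_compat_l; lra. }
    assert ((2 * (M * M) + 1) * lip1 N (c s) * En 0 N (w s) <= (2 * (M * M) + 1) * L * En 0 N (w s)).
    { apply Rmult_le_compat_r; [assumption|]. apply Rmult_le_compat_l; nra. }
    unfold stab_rate. lra.
Qed.

Lemma IZR_sqr_pow_le_wt k s : IZR k ^ s * IZR k ^ s <= wt k ^ s.
Proof.
  rewrite <- Rpow_mult_distr. apply pow_incr. split; [apply Rle_0_sqr|]. unfold wt. lra.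
Qed.

Lemma decay_En s N h C C' :
  (forall k, Rabs (h k) <= C) -> (forall k, Rabs (h k) * wt k ^ S s <= C') ->
  En s N h <= 5 * (C * C').
Proof.
  intros H0 H1.
  assert (0 <= C) by (pose proof (H0 0%Z); pose proof (Rabs_pos (h 0%Z)); lra).
  assert (0 <= C') by (pose proof (decay_abs _ _ _ _ (H1 0%Z)); pose proof (Rabs_pos (h 0%Z)); lra).
  apply Rle_trans with (zsum N (fun k => C * C' * / wt k)).
  - apply zsum_le. intros k _.
    replace (h k * h k) with (Rabs (h k) * Rabs (h k)) by (symmetry; apply Rsqr_abs).
    pose proof (IZR_sqr_pow_le_wt k s) as Hw. pose proof (Rabs_pos (h k)).
    apply Rle_trans with (wt k ^ s * (Rabs (h k) * Rabs (h k))).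
    { apply Rmult_le_compat_r; [nra|exact Hw]. }
    replace (C * C' * / wt k) with (C * (C' * / wt k)) by ring.
    replace (wt k ^ s * (Rabs (h k) * Rabs (h k))) with (Rabs (h k) * (Rabs (h k) * wt k ^ s)) by ring.
    apply Rmult_le_compat; auto.
    + apply Rmult_le_pos; [assumption|]. apply pow_le. left; apply wt_pos.
    + apply Rmult_le_reg_r with (wt k); [apply wt_pos|].
      rewrite Rmult_assoc, (Rmult_assoc C'), Rinv_l by (pose proof (wt_pos k); lra).
      specialize (H1 k). simpl in H1. lra.
  - rewrite zsum_scal. pose proof (zsum_inv_wt N). assert (0 <= C * C') by (apply Rmult_le_pos; assumption). nra.
Qed.

(** [wt k ^ p <= 2^p (1 + k^(2p))], so two energies bound a weighted coordinate; [|z| <= 1 + z^2]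
    avoids square roots. *)
Lemma energy_decay p N h k :
  (Z.abs k <= Z.of_nat N)%Z ->
  Rabs (h k) * wt k ^ p <= 2 ^ p * (2 + En 0 N h + En (2 * p) N h).
Proof.
  intros Hk.
  assert (forall s, Rabs (IZR k ^ s * h k) <= 1 + En s N h) as Hs.
  { intros s.
    assert ((IZR k ^ s * h k) * (IZR k ^ s * h k) <= En s N h) as H.
    { replace ((IZR k ^ s * h k) * (IZR k ^ s * h k)) with (IZR k ^ s * IZR k ^ s * (h k * h k)) by ring.
      apply (zsum_term_le N (fun k => IZR k ^ s * IZR k ^ s * (h k * h k)) k Hk).
      intros j. apply Rmult_le_pos; apply Rle_0_sqr. }
    set (z := IZR k ^ s * h k) in *. rewrite (Rsqr_abs z : z * z = Rabs z * Rabs z) in H.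
    pose proof (Rabs_pos z). nra. }
  pose proof (Hs 0%nat) as H0. pose proof (Hs (2 * p)%nat) as H1.
  rewrite pow_O, Rmult_1_l in H0. rewrite Rabs_mult, pow_mult in H1.
  replace (IZR k ^ 2) with (IZR k * IZR k) in H1 by ring.
  assert (0 <= IZR k * IZR k) as Hkk by apply Rle_0_sqr.
  rewrite (Rabs_pos_eq ((IZR k * IZR k) ^ p)) in H1 by (apply pow_le; exact Hkk).
  pose proof (pow_plus_bound p 1 (IZR k * IZR k) ltac:(lra) Hkk) as Hp. rewrite pow1 in Hp. fold (wt k) in Hp.
  apply Rle_trans with (Rabs (h k) * (2 ^ p * (1 + (IZR k * IZR k) ^ p))).
  { apply Rmult_le_compat_l; [apply Rabs_pos|exact Hp]. }
  replace (Rabs (h k) * (2 ^ p * (1 + (IZR k * IZR k) ^ p)))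
    with (2 ^ p * (Rabs (h k) + (IZR k * IZR k) ^ p * Rabs (h k))) by ring.
  apply Rmult_le_compat_l; [apply pow_le; lra|]. lra.
Qed.

(** * The infinite system *)

(** Rapidly decreasing families, the coefficients of the functions in [Cinf_T]. *)
Definition rapid (x : Z -> R) : Prop :=
  forall p, exists C, forall k, Rabs (x k) * wt k ^ p <= C.

Definition Qb (gam a b : Z -> R) (k : Z) : R :=
  - zser (fun l => Amat (Gop gam a) k l * (IZR l * b l)).

Definition Qinf (gam h : Z -> R) : Z -> R := Qb gam h h.

(** The residual [e = X / n^2], with [X = 18 M C^2] and [n = N + 1], enters [stability] through
    [(2 N + 1) e^2 <= 2 X^2 / n]; this collects what multiplies [1 / n]. *)
Definition close_const (M C T : R) : R :=
  2 * (18 * (M * (C * C)) * (18 * (M * (C * C)))) * T * exp (stab_rate M (5 * C) * T).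

(** [d] solves the truncated system up to the residual; this covers both a Galerkin solution of
    higher order and the coefficients of a genuine solution. *)
Lemma galerkin_close gam M N T C (c d v : R -> Z -> R) t k :
  (forall j, Rabs (gam j) <= M) ->
  (forall k s, (Z.abs k <= Z.of_nat N)%Z -> 0 < s < T ->
    is_derive (fun s => c s k) s (QN gam N (c s) (c s) k)) ->
  (forall k s, (Z.abs k <= Z.of_nat N)%Z -> 0 < s < T -> is_derive (fun s => d s k) s (v s k)) ->
  (forall k s, 0 < s < T ->
    Rabs (v s k - QN gam N (d s) (d s) k) <= 18 * (M * (C * C)) / ((INR N + 1) * (INR N + 1))) ->
  (forall k s, (Z.abs k <= Z.of_nat N)%Z -> 0 <= s <= T ->
    continuity_pt (fun s => c s k) s /\ continuity_pt (fun s => d s k) s) ->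
  (forall s k, (Z.abs k <= Z.of_nat N)%Z -> 0 < s < T ->
    Rabs (c s k) * wt k ^ 3 <= C /\ Rabs (d s k) * wt k ^ 3 <= C) ->
  (forall k, (Z.abs k <= Z.of_nat N)%Z -> c 0 k = d 0 k) ->
  0 <= C -> 0 <= t <= T -> (Z.abs k <= Z.of_nat N)%Z ->
  (d t k - c t k) * (d t k - c t k) <= close_const M C T / (INR N + 1).
Proof.
  intros HM Hc Hd Hv Hcont HC H0 HC0 Ht Hk.
  pose proof (gam_bound_nonneg gam M HM) as HM0.
  pose proof (pos_INR N) as HN. set (X := 18 * (M * (C * C))) in *.
  assert (0 <= X).
  { unfold X. assert (0 <= C * C) by apply Rle_0_sqr. assert (0 <= M * (C * C)) by (apply Rmult_le_pos; assumption). lra. }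
  set (n := INR N + 1) in *. assert (1 <= n) as Hn by (unfold n; lra).
  assert (1 <= n * n) by nra.
  set (e := X / (n * n)) in *.
  assert (0 <= e) as He by (apply Rdiv_le_0_compat; lra).
  set (r := fun s k => v s k - QN gam N (d s) (d s) k).
  pose proof (stability gam M N T (5 * C) e c d r t HM He Hc) as Hst.
  apply Rle_trans with (En 0 N (fun k => d t k - c t k)).
  { replace ((d t k - c t k) * (d t k - c t k)) with
      (IZR k ^ 0 * IZR k ^ 0 * ((d t k - c t k) * (d t k - c t k))) by (simpl; ring).
    apply (zsum_term_le N (fun k => IZR k ^ 0 * IZR k ^ 0 * ((d t k - c t k) * (d t k - c t k))) k Hk).
    intros j. apply Rmult_le_pos; apply Rle_0_sqr. }
  eapply Rle_trans; [apply Hst; auto|].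
  - intros j s Hj Hs. unfold r. replace (QN gam N (d s) (d s) j + (v s j - QN gam N (d s) (d s) j)) with (v s j) by ring.
    auto.
  - intros j s Hj Hs. apply Hv; exact Hs.
  - intros s Hs. split; apply (decay_lip1 N _ C 3); try lia; intros j Hj; apply HC; auto.
  - unfold close_const. fold X.
    assert (0 <= stab_rate M (5 * C)) as Hsr.
    { unfold stab_rate. assert (0 <= M * C) by (apply Rmult_le_pos; assumption).
      assert (0 <= M * M * C) by (repeat apply Rmult_le_pos; assumption). nra. }
    replace (2 * (X * X) * T * exp (stab_rate M (5 * C) * T) / n)
      with (2 * n * (X * X / (n * n)) * T * exp (stab_rate M (5 * C) * T)) by (field; lra).
    assert (exp (stab_rate M (5 * C) * t) <= exp (stab_rate M (5 * C) * T)).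
    { destruct (Req_dec (stab_rate M (5 * C) * t) (stab_rate M (5 * C) * T)) as [->|Hne]; [lra|].
      left. apply exp_increasing.
      assert (stab_rate M (5 * C) * t <= stab_rate M (5 * C) * T) by (apply Rmult_le_compat_l; lra). lra. }
    assert (0 <= e * e) by apply Rle_0_sqr.
    apply Rmult_le_compat; [|left; apply exp_pos| |assumption].
    + apply Rmult_le_pos; [|lra]. apply Rmult_le_pos; [unfold n in *; lra|assumption].
    + apply Rmult_le_compat; [|lra| |lra].
      * apply Rmult_le_pos; [unfold n in *; lra|assumption].
      * apply Rmult_le_compat; [unfold n in *; lra|assumption|unfold n in *; lra|].
        unfold e. replace (X / (n * n) * (X / (n * n))) with (X * X / (n * n) * / (n * n)) by (field; lra).
        rewrite <- (Rmult_1_r (X * X / (n * n))) at 2. apply Rmult_le_compat_l.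
        -- apply Rdiv_le_0_compat; nra.
        -- rewrite <- Rinv_1. apply Rinv_le_contravar; lra.
Qed.

Lemma Qb_summable gam M a b Ca Cb k :
  (forall j, Rabs (gam j) <= M) ->
  (forall j, Rabs (a j) <= Ca) ->
  (forall j, Rabs (b j) * wt j ^ 2 <= Cb) ->
  summable (fun l => Amat (Gop gam a) k l * (IZR l * b l)) (2 * (M * Ca) * Cb).
Proof.
  intros HM Ha Hb l. rewrite Rabs_mult.
  replace (2 * (M * Ca) * Cb * / wt l) with (2 * (M * Ca) * (Cb * / wt l)) by ring.
  apply Rmult_le_compat; try apply Rabs_pos.
  - apply Amat_abs_le. intros j. apply Gop_abs_le; auto.
  - apply (decay_lip1_term _ _ _ 2); auto.
Qed.

Lemma Qinf_residual gam M D C N k :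
  (forall j, Rabs (gam j) <= M) ->
  (forall j, Rabs (D j) * wt j ^ 3 <= C) ->
  Rabs (Qinf gam D k - QN gam N D D k) <= 18 * (M * (C * C)) / ((INR N + 1) * (INR N + 1)).
Proof.
  intros HM HD.
  apply (is_lim_seq_le_loc
    (fun n => Rabs (zsum n (fun l => Amat (Gop gam D) k l * (IZR l * D l)) + QN gam N D D k))
    (fun _ => 18 * (M * (C * C)) / ((INR N + 1) * (INR N + 1)))
    (Finite (Rabs (Qinf gam D k - QN gam N D D k))) (Finite (18 * (M * (C * C)) / ((INR N + 1) * (INR N + 1))))).
  - exists N. intros n Hn. apply truncation_residual; auto.
  - replace (Rabs (Qinf gam D k - QN gam N D D k)) with
      (Rabs (zser (fun l => Amat (Gop gam D) k l * (IZR l * D l)) + QN gam N D D k)).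
    + apply (is_lim_seq_abs _ (Finite (zser (fun l => Amat (Gop gam D) k l * (IZR l * D l)) + QN gam N D D k))).
      apply is_lim_seq_plus'; [|apply is_lim_seq_const].
      apply zser_lim with (2 * (M * C) * C). apply Qb_summable; auto.
      * intros j. eapply decay_abs, HD.
      * intros j. apply (decay_weaken _ _ 2 3); [lia|apply HD].
    + unfold Qinf, Qb. rewrite <- Rabs_Ropp. f_equal. ring.
  - apply is_lim_seq_const.
Qed.

Lemma QN_tr_residual gam M D C N n k :
  (forall j, Rabs (gam j) <= M) -> (N <= n)%nat ->
  (forall j, (Z.abs j <= Z.of_nat n)%Z -> Rabs (D j) * wt j ^ 3 <= C) ->
  Rabs (QN gam n D D k - QN gam N D D k) <= 18 * (M * (C * C)) / ((INR N + 1) * (INR N + 1)).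
Proof.
  intros HM HN HD.
  assert (0 <= C) as HC.
  { pose proof (HD 0%Z ltac:(lia)) as H0. apply decay_abs in H0. pose proof (Rabs_pos (D 0%Z)). lra. }
  rewrite <- Rabs_Ropp.
  replace (- (QN gam n D D k - QN gam N D D k)) with
    (zsum n (fun l => Amat (Gop gam (tr n D)) k l * (IZR l * tr n D l)) + QN gam N (tr n D) (tr n D) k).
  - apply truncation_residual; auto. intros j. unfold tr. destruct Z_le_dec; [auto|].
    rewrite Rabs_R0. lra.
  - rewrite (QN_ext gam N (tr n D) D (tr n D) D) by (intros; apply tr_in; lia).
    unfold QN at 2. rewrite (zsum_ext n (fun l => Amat (Gop gam (tr n D)) k l * (IZR l * tr n D l))
      (fun l => Amat (Gop gam (tr n D)) k l * (IZR l * D l))) by (intros; rewrite tr_in by assumption; reflexivity).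
    ring.
Qed.

Lemma continuous_QN gam N (x : R -> Z -> R) k t :
  (forall j, (Z.abs j <= Z.of_nat N)%Z -> continuous (fun t => x t j) t) ->
  continuous (fun t => QN gam N (x t) (x t) k) t.
Proof.
  intros Hx. unfold QN.
  apply continuous_ext with (fun t => 0 - zsum N (fun l => Amat (Gop gam (tr N (x t))) k l * (IZR l * x t l))).
  { intros s. simpl. ring. }
  apply continuous_Rminus; [apply continuous_const|]. apply continuous_zsum. intros l Hl.
  assert (forall j, continuous (fun t => Gop gam (tr N (x t)) j) t) as HG.
  { intros j. apply continuous_Rmult; [apply continuous_const|].
    unfold tr. destruct Z_le_dec; [auto|apply continuous_const]. }
  apply continuous_Rmult.
  - unfold Amat. apply continuous_Rmult; [|apply continuous_const].
    apply continuous_Rplus; [apply continuous_Rplus; [apply continuous_Rminus|]|]; apply HG.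
  - apply continuous_Rmult; [apply continuous_const|auto].
Qed.

Lemma Rabs_lt_of_sqr (z d : R) : 0 < d -> z * z < d * d -> Rabs z < d.
Proof.
  intros Hd H. destruct (Rlt_dec (Rabs z) d) as [|Hge]; [assumption|].
  exfalso. apply Rnot_lt_le in Hge.
  assert (d * d <= Rabs z * Rabs z) as Hsq by (apply Rmult_le_compat; lra).
  replace (Rabs z * Rabs z) with (z * z) in Hsq by apply Rsqr_abs. lra.
Qed.

(** The constant grows with [N], since [lip1] of the difference is bounded by [(2 N + 1) N e]; it is
    meant for a fixed order while [e] tends to zero. *)
Lemma QN_close gam M N a b C e k :
  (forall j, Rabs (gam j) <= M) -> 0 <= e ->
  (forall j, (Z.abs j <= Z.of_nat N)%Z -> Rabs (a j) * wt j ^ 3 <= C) ->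
  (forall j, (Z.abs j <= Z.of_nat N)%Z -> Rabs (b j) * wt j ^ 3 <= C) ->
  (forall j, (Z.abs j <= Z.of_nat N)%Z -> Rabs (a j - b j) <= e) ->
  Rabs (QN gam N a a k - QN gam N b b k) <=
    (2 * (M * C) * ((2 * INR N + 1) * INR N) + 2 * M * (5 * C)) * e.
Proof.
  intros HM He Ha Hb Hab.
  assert (0 <= C) as HC.
  { pose proof (Ha 0%Z ltac:(lia)) as H0. apply decay_abs in H0. pose proof (Rabs_pos (a 0%Z)). lra. }
  rewrite QN_minus. eapply Rle_trans; [apply Rabs_triang|].
  replace ((2 * (M * C) * ((2 * INR N + 1) * INR N) + 2 * M * (5 * C)) * e)
    with (2 * (M * C) * ((2 * INR N + 1) * (INR N * e)) + 2 * (M * e) * (5 * C)) by ring.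
  apply Rplus_le_compat; apply QN_bound; auto.
  - intros j Hj. eapply decay_abs, Ha, Hj.
  - rewrite <- zsum_const. apply zsum_le. intros j Hj.
    apply Rmult_le_compat; auto using Rabs_pos.
    rewrite <- abs_IZR, INR_IZR_INZ. apply IZR_le. exact Hj.
  - apply (decay_lip1 N _ C 3); [lia|exact Hb].
Qed.

Lemma is_lim_seq_closed_le (u : nat -> R) (l b : R) (f : R -> R) N :
  is_lim_seq u l -> (forall x, continuity_pt f x) -> (forall n, (N <= n)%nat -> f (u n) <= b) -> f l <= b.
Proof.
  intros Hu Hf Hb.
  apply (is_lim_seq_le_loc (fun n => f (u n)) (fun _ => b) (Finite (f l)) (Finite b)).
  - exists N. exact Hb.
  - apply is_lim_seq_continuous; auto.
  - apply is_lim_seq_const.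
Qed.

Theorem fourier_solution gam M x0 :
  (forall j, Rabs (gam j) <= M) -> rapid x0 ->
  exists T, 0 < T /\ exists h : R -> Z -> R,
    (forall k, h 0 k = x0 k) /\
    (forall p, exists C, forall t k, 0 <= t <= T -> Rabs (h t k) * wt k ^ p <= C) /\
    (forall k t, 0 < t < T -> is_derive (fun t => h t k) t (Qinf gam (h t) k)) /\
    (exists L, forall k s t, 0 <= s <= T -> 0 <= t <= T -> Rabs (h t k - h s k) <= L * Rabs (t - s)) /\
    (forall T' (d : R -> Z -> R), 0 <= T' <= T ->
      (exists C, forall t k, 0 < t < T' -> Rabs (d t k) * wt k ^ 3 <= C) ->
      (forall k t, 0 < t < T' -> is_derive (fun t => d t k) t (Qinf gam (d t) k)) ->
      (forall k t, 0 <= t <= T' -> continuity_pt (fun t => d t k) t) ->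
      (forall k, d 0 k = x0 k) ->
      forall t k, 0 <= t <= T' -> d t k = h t k).
Proof.
  intros HM Hx0. pose proof (gam_bound_nonneg gam M HM) as HM0.
  assert (forall s, exists B, 0 <= B /\ forall N, En s N x0 <= B) as HEn0.
  { intros s. destruct (Hx0 0%nat) as [C0 HC0]. destruct (Hx0 (S s)) as [C1 HC1].
    exists (5 * (C0 * C1)).
    assert (forall N, En s N x0 <= 5 * (C0 * C1)) as H.
    { intros N. apply decay_En; [|exact HC1]. intros k. eapply decay_abs, HC0. }
    split; [|exact H]. pose proof (H 0%nat). pose proof (En_nonneg s 0 x0). lra. }
  destruct (HEn0 0%nat) as (B0 & HB0 & HE0). destruct (HEn0 2%nat) as (B2 & HB2 & HE2).
  (* [B0] and [B2] bound the energies of the data for all [N]; the [1] is the room for growth that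
     [galerkin_exists] asks for. *)
  set (r := B0 + B2 + 1). assert (1 <= r) as Hr by (unfold r; lra).
  set (T := galerkin_time M r).
  assert (0 < T) as HT by (apply galerkin_time_pos; auto).
  assert (forall N, exists x : R -> Z -> R, (forall k, x 0 k = x0 k) /\
    (forall t, 0 <= t <= T -> En02 N (x t) <= r) /\
    (forall k t, (Z.abs k <= Z.of_nat N)%Z -> 0 <= t <= T ->
      is_derive (fun t => x t k) t (QN gam N (x t) (x t) k))) as Hex.
  { intros N. apply galerkin_exists; auto. unfold En02, r. specialize (HE0 N). specialize (HE2 N). lra. }
  set (c := fun N => proj1_sig (constructive_indefinite_description _ (Hex N))).
  assert (forall N k, c N 0 k = x0 k) as Hc0.
  { intros N. unfold c. destruct constructive_indefinite_description as [x Hx]. apply Hx. }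
  assert (forall N t, 0 <= t <= T -> En02 N (c N t) <= r) as Hcr.
  { intros N. unfold c. destruct constructive_indefinite_description as [x Hx]. apply Hx. }
  assert (forall N k t, (Z.abs k <= Z.of_nat N)%Z -> 0 <= t <= T ->
      is_derive (fun t => c N t k) t (QN gam N (c N t) (c N t) k)) as Hcd.
  { intros N. unfold c. destruct constructive_indefinite_description as [x Hx]. apply Hx. }
  clearbody c. clear Hex.
  assert (forall s, exists B, forall N t, 0 <= t <= T -> En s N (c N t) <= B) as HEs.
  { intros s. destruct (HEn0 s) as (B & HB & HE). exists (B * exp (2 * Kc M s * (5 + r) * T)).
    intros N t Ht. eapply Rle_trans; [apply (galerkin_energy gam M N r T (c N) s t); auto|].
    apply Rmult_le_compat; [apply En_nonneg|left; apply exp_pos| |].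
    - rewrite (En_ext s N (c N 0) x0) by (intros; apply Hc0). apply HE.
    - destruct (Req_dec t T) as [->|Hne]; [lra|].
      pose proof (Kc_nonneg M s HM0).
      assert (2 * Kc M s * (5 + r) * t <= 2 * Kc M s * (5 + r) * T).
      { apply Rmult_le_compat_l; [|lra]. repeat apply Rmult_le_pos; lra. }
      destruct (Req_dec (2 * Kc M s * (5 + r) * t) (2 * Kc M s * (5 + r) * T)) as [->|Hn2]; [lra|].
      left. apply exp_increasing. lra. }
  assert (forall p, exists C, forall N t k, (Z.abs k <= Z.of_nat N)%Z -> 0 <= t <= T ->
    Rabs (c N t k) * wt k ^ p <= C) as Hdec.
  { intros p. destruct (HEs 0%nat) as [A HA]. destruct (HEs (2 * p)%nat) as [B HB].
    exists (2 ^ p * (2 + A + B)). intros N t k Hk Ht.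
    eapply Rle_trans; [apply (energy_decay p N (c N t) k Hk)|].
    apply Rmult_le_compat_l; [apply pow_le; lra|]. specialize (HA N t Ht). specialize (HB N t Ht). lra. }
  (* Three powers of the weight are what the truncation residual consumes. *)
  destruct (Hdec 3%nat) as [C HC].
  assert (0 <= C) as HC0.
  { pose proof (HC 0%nat 0 0%Z ltac:(simpl; lia) ltac:(lra)) as H. apply decay_abs in H.
    pose proof (Rabs_pos (c 0%nat 0 0%Z)). lra. }
  set (K := close_const M C T).
  assert (forall N n k t, (N <= n)%nat -> (Z.abs k <= Z.of_nat N)%Z -> 0 <= t <= T ->
    (c n t k - c N t k) * (c n t k - c N t k) <= K / (INR N + 1)) as Hclose.
  { intros N n k t HNn Hk Ht.
    apply (galerkin_close gam M N T C (c N) (c n) (fun s k => QN gam n (c n s) (c n s) k)); auto.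
    - intros j s Hj Hs. apply Hcd; [exact Hj|lra].
    - intros j s Hj Hs. apply Hcd; [lia|lra].
    - intros j s Hs. apply QN_tr_residual; auto. intros i Hi. apply HC; [exact Hi|lra].
    - intros j s Hj Hs. split; (eapply is_derive_continuity_pt, Hcd; [lia|lra]).
    - intros s j Hj Hs. split; apply HC; lia || lra.
    - intros j Hj. rewrite !Hc0. reflexivity. }
  assert (forall t k, 0 <= t <= T -> ex_finite_lim_seq (fun n => c n t k)) as Hlim.
  { intros t k Ht. apply ex_lim_seq_cauchy_corr. intros eps.
    destruct (inv_INR_small K (eps / 2 * (eps / 2))) as [N0 HN0].
    { pose proof (cond_pos eps). nra. }
    set (N := Nat.max N0 (Z.abs_nat k)).
    assert (forall n, (N <= n)%nat -> Rabs (c n t k - c N t k) < eps / 2) as H.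
    { intros n Hn. pose proof (Hclose N n k t Hn ltac:(lia) Ht) as H1.
      pose proof (HN0 N ltac:(lia)) as H2.
      pose proof (cond_pos eps). apply Rabs_lt_of_sqr; lra. }
    exists N. intros n m Hn Hm. pose proof (H n Hn) as H1. pose proof (H m Hm) as H2.
    pose proof (Rabs_triang (c n t k - c N t k) (- (c m t k - c N t k))) as H3.
    rewrite Rabs_Ropp in H3.
    replace (c n t k - c N t k + - (c m t k - c N t k)) with (c n t k - c m t k) in H3 by ring. lra. }
  set (h := fun t k => real (Lim_seq (fun n => c n t k))).
  assert (forall t k, 0 <= t <= T -> is_lim_seq (fun n => c n t k) (h t k)) as Hh.
  { intros t k Ht. destruct (Hlim t k Ht) as [l Hl]. unfold h.
    rewrite (is_lim_seq_unique _ _ Hl). exact Hl. }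
  assert (forall N k t, (Z.abs k <= Z.of_nat N)%Z -> 0 <= t <= T ->
    (h t k - c N t k) * (h t k - c N t k) <= K / (INR N + 1)) as Hhc.
  { intros N k t Hk Ht.
    apply (is_lim_seq_closed_le (fun n => c n t k) (h t k) _ (fun x => (x - c N t k) * (x - c N t k)) N (Hh t k Ht)).
    - intros x. apply is_derive_continuity_pt with (2 * (x - c N t k)). auto_derive; [trivial|ring].
    - intros n Hn. apply Hclose; auto. }
  assert (forall p, exists C, forall t k, 0 <= t <= T -> Rabs (h t k) * wt k ^ p <= C) as Hhdec.
  { intros p. destruct (Hdec p) as [Cp HCp]. exists Cp. intros t k Ht.
    apply (is_lim_seq_closed_le (fun n => c n t k) (h t k) _ (fun x => Rabs x * wt k ^ p) (Z.abs_nat k) (Hh t k Ht)).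
    - intros x. apply continuity_pt_mult; [apply Rcontinuity_abs|apply continuity_pt_const; intros ? ?; reflexivity].
    - intros n Hn. apply HCp; [lia|exact Ht]. }
  assert (forall t k, 0 <= t <= T -> Rabs (h t k) * wt k ^ 3 <= C) as HhC.
  { intros t k Ht.
    apply (is_lim_seq_closed_le (fun n => c n t k) (h t k) _ (fun x => Rabs x * wt k ^ 3) (Z.abs_nat k) (Hh t k Ht)).
    - intros x. apply continuity_pt_mult; [apply Rcontinuity_abs|apply continuity_pt_const; intros ? ?; reflexivity].
    - intros n Hn. apply HC; [lia|exact Ht]. }
  exists T. split; [exact HT|]. exists h. split; [|split; [exact Hhdec|split; [|split]]].
  - intros k. assert (is_lim_seq (fun n => c n 0 k) (x0 k)) as H.
    { apply is_lim_seq_ext with (fun _ => x0 k); [intros; symmetry; apply Hc0|apply is_lim_seq_const]. }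
    unfold h. rewrite (is_lim_seq_unique _ _ H). reflexivity.
  (* Uniform convergence of the time derivatives: a fixed order [m] brings both truncation residuals
     below [eps / 3], and at that order the finitely many coordinates of [c n] approach those of [h]
     uniformly in time. *)
  - assert (forall k eps, 0 < eps -> exists N0, forall n s, (N0 <= n)%nat -> 0 <= s <= T ->
      Rabs (Qinf gam (h s) k - QN gam n (c n s) (c n s) k) < eps) as Hunif.
    { intros k eps Heps.
      destruct (inv_INR_small (18 * (M * (C * C))) (eps / 3) ltac:(lra)) as [m Hm].
      specialize (Hm m (Nat.le_refl m)).
      assert (18 * (M * (C * C)) / ((INR m + 1) * (INR m + 1)) < eps / 3) as Hm2.
      { eapply Rle_lt_trans; [|exact Hm]. pose proof (pos_INR m). unfold Rdiv. apply Rmult_le_compat_l.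
        - apply Rmult_le_pos; [lra|]. apply Rmult_le_pos; [lra|apply Rle_0_sqr].
        - apply Rinv_le_contravar; nra. }
      set (W := 2 * (M * C) * ((2 * INR m + 1) * INR m) + 2 * M * (5 * C)).
      assert (0 <= W) as HW.
      { unfold W. pose proof (pos_INR m). assert (0 <= M * C) by (apply Rmult_le_pos; assumption).
        assert (0 <= (2 * INR m + 1) * INR m) by (apply Rmult_le_pos; lra).
        assert (0 <= M * C * ((2 * INR m + 1) * INR m)) by (apply Rmult_le_pos; assumption). lra. }
      set (de := eps / 3 / (W + 1)).
      assert (0 < de) as Hde by (unfold de; apply Rdiv_lt_0_compat; lra).
      destruct (inv_INR_small K (de * de) ltac:(nra)) as [N1 HN1].
      exists (Nat.max N1 m). intros n s Hn Hs.
      pose proof (Qinf_residual gam M (h s) C m k HM (fun j => HhC s j Hs)) as H1.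
      pose proof (QN_tr_residual gam M (c n s) C m n k HM ltac:(lia) (fun j Hj => HC n s j Hj Hs)) as H2.
      assert (Rabs (QN gam m (h s) (h s) k - QN gam m (c n s) (c n s) k) <= W * de) as H3.
      { apply QN_close; auto; try lra.
        - intros j Hj. apply HC; [lia|exact Hs].
        - intros j Hj. left. apply Rabs_lt_of_sqr; [exact Hde|].
          eapply Rle_lt_trans; [apply Hhc; [lia|exact Hs]|]. apply HN1. lia. }
      assert (W * de < eps / 3).
      { unfold de. apply Rmult_lt_reg_r with (W + 1); [lra|].
        replace (W * (eps / 3 / (W + 1)) * (W + 1)) with (W * (eps / 3)) by (field; lra). nra. }
      apply Rabs_le_between in H1, H2, H3.
      apply Rabs_lt_between. lra. }
    intros k t Ht.
    assert (0 < Rmin t (T - t)) as Hrp by (apply Rmin_pos; lra).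
    assert (forall y, Boule t (mkposreal _ Hrp) y -> 0 < y < T) as Hball.
    { intros y Hy. unfold Boule in Hy. simpl in Hy.
      pose proof (Rmin_l t (T - t)). pose proof (Rmin_r t (T - t)).
      apply Rabs_lt_between in Hy. lra. }
    assert (Boule t (mkposreal _ Hrp) t) as Hcen
      by (unfold Boule; rewrite Rminus_diag, Rabs_R0; apply cond_pos).
    (* The shift by [|k|] keeps the coordinate [k] inside the window for every [n]. *)
    set (fn := fun n t => c (n + Z.abs_nat k)%nat t k).
    set (fn' := fun n t => QN gam (n + Z.abs_nat k) (c (n + Z.abs_nat k)%nat t) (c (n + Z.abs_nat k)%nat t) k).
    assert (CVU fn' (fun t => Qinf gam (h t) k) t (mkposreal _ Hrp)) as HCVU.
    { intros eps Heps. destruct (Hunif k eps Heps) as [N0 HN0]. exists N0. intros n y Hn Hy.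
      pose proof (Hball y Hy). apply HN0; [lia|lra]. }
    apply is_derive_Reals.
    apply (derivable_pt_lim_CVU fn fn' _ (fun t => Qinf gam (h t) k) t t (mkposreal _ Hrp) Hcen).
    + intros y n Hy. apply is_derive_Reals. apply Hcd; [lia|]. pose proof (Hball y Hy). lra.
    + intros y Hy. apply is_lim_seq_Reals. unfold fn.
      apply (is_lim_seq_incr_n (fun n => c n y k)). apply Hh. pose proof (Hball y Hy). lra.
    + exact HCVU.
    + intros y Hy. apply (CVU_continuity fn' _ t (mkposreal _ Hrp) HCVU); [|exact Hy].
      intros n z Hz. pose proof (Hball z Hz). apply continuity_pt_filterlim.
      apply continuous_QN. intros j Hj. eapply is_derive_cont, Hcd; [lia|lra].
  - exists (2 * (M * C) * (5 * C)). intros k s t Hs Ht.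
    set (L := 2 * (M * C) * (5 * C)).
    assert (forall s t, 0 <= s <= T -> 0 <= t <= T -> s <= t -> Rabs (h t k - h s k) <= L * (t - s)) as H.
    { clear s t Hs Ht. intros s t Hs Ht Hst.
      apply (is_lim_seq_closed_le (fun n => c n t k - c n s k) (h t k - h s k) _ Rabs (Z.abs_nat k)).
      - apply is_lim_seq_minus'; apply Hh; assumption.
      - intros x. apply Rcontinuity_abs.
      - intros n Hn. apply (mvt_Rabs_le (fun t => c n t k) (fun t => QN gam n (c n t) (c n t) k)); auto.
        + intros u Hu. apply Hcd; [lia|lra].
        + intros u Hu. eapply is_derive_continuity_pt, Hcd; [lia|lra].
        + intros u Hu. apply QN_bound; auto.
          * intros j Hj. eapply decay_abs. apply HC; [exact Hj|lra].
          * apply (decay_lip1 n _ C 3); [lia|]. intros j Hj. apply HC; [exact Hj|lra]. }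
    destruct (Rle_dec s t) as [Hst|Hst].
    + rewrite (Rabs_pos_eq (t - s)) by lra. apply H; auto.
    + rewrite Rabs_minus_sym, (Rabs_left (t - s)) by lra. rewrite Ropp_minus_distr. apply H; auto. lra.
  - intros T' d HT' [Cd HCd] Hdd Hdc Hd0 t k Ht.
    set (C' := Rmax C (Rmax Cd 0)).
    assert (C <= C') as HCC by apply Rmax_l.
    assert (Cd <= C') by (eapply Rle_trans; [apply Rmax_l|apply Rmax_r]).
    assert (forall N, (Z.abs k <= Z.of_nat N)%Z ->
      (d t k - c N t k) * (d t k - c N t k) <= close_const M C' T' / (INR N + 1)) as Hdcl.
    { intros N Hk.
      apply (galerkin_close gam M N T' C' (c N) d (fun s k => Qinf gam (d s) k)); auto.
      - intros j s Hj Hs. apply Hcd; [exact Hj|lra].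
      - intros j s Hs. apply Qinf_residual; auto. intros i. specialize (HCd s i Hs). lra.
      - intros j s Hj Hs. split; [|auto]. eapply is_derive_continuity_pt, Hcd; [lia|lra].
      - intros s j Hj Hs. split.
        + pose proof (HC N s j Hj ltac:(lra)). lra.
        + pose proof (HCd s j Hs). lra.
      - intros j Hj. rewrite Hc0, Hd0. reflexivity.
      - lra. }
    (* The Galerkin solutions converge to [h], while their squared distance to [d] is [O(1 / N)]. *)
    assert ((d t k - h t k) * (d t k - h t k) <= 0) as Hz.
    { apply Rle_trans with (real 0); [|simpl; lra].
      apply (is_lim_seq_le_loc (fun n => (d t k - c n t k) * (d t k - c n t k))
        (fun n => close_const M C' T' / (INR n + 1)) (Finite ((d t k - h t k) * (d t k - h t k))) (Finite 0)).
      - exists (Z.abs_nat k). intros n Hn. apply Hdcl. lia.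
      - assert (is_lim_seq (fun n => d t k - c n t k) (d t k - h t k)) as Hl.
        { apply is_lim_seq_minus'; [apply is_lim_seq_const|apply Hh; lra]. }
        apply is_lim_seq_mult'; exact Hl.
      - apply is_lim_seq_of_bound with (Rabs (close_const M C' T')). intros n. rewrite Rminus_0_r.
        unfold Rdiv. rewrite Rabs_mult, (Rabs_pos_eq (/ (INR n + 1))); [lra|].
        left. apply Rinv_0_lt_compat. pose proof (pos_INR n); lra. }
    pose proof (Rle_0_sqr (d t k - h t k)). unfold Rsqr in *.
    assert (d t k - h t k = 0); [|lra]. apply Rsqr_0_uniq. unfold Rsqr. lra.
Qed.

(** * The operator H_a as a multiplier *)

Lemma is_RInt_gen_p_infty (phi F : R -> R) e l :
  (forall r, e <= r -> is_RInt phi e r (F r)) ->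
  filterlim F (Rbar_locally p_infty) (locally l) ->
  is_RInt_gen phi (at_point e) (Rbar_locally p_infty) l.
Proof.
  intros HI HF P HP. specialize (HF P HP).
  apply (Filter_prod _ _ _ (fun y => y = e) (fun r => e <= r /\ P (F r))).
  - reflexivity.
  - apply filter_and; [|exact HF]. exists e. intros r Hr. lra.
  - intros x y -> [Hy HPy]. exists (F y). split; [apply HI; exact Hy|exact HPy].
Qed.

Lemma is_RInt_gen_m_infty (phi F : R -> R) e l :
  (forall r, e <= r -> is_RInt phi (- r) (- e) (F r)) ->
  filterlim F (Rbar_locally p_infty) (locally l) ->
  is_RInt_gen phi (Rbar_locally m_infty) (at_point (- e)) l.
Proof.
  intros HI HF P HP. specialize (HF P HP).
  apply (Filter_prod _ _ _ (fun r => e <= - r /\ P (F (- r))) (fun y => y = - e)).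
  - destruct HF as [r0 Hr0]. exists (Rmin (- r0) (- e)). intros r Hr.
    pose proof (Rmin_l (- r0) (- e)). pose proof (Rmin_r (- r0) (- e)).
    split; [lra|]. apply Hr0. lra.
  - reflexivity.
  - intros x y [Hx HPx] ->. exists (F (- x)). split; [|exact HPx].
    simpl. replace x with (- - x) at 1 by ring. apply HI. exact Hx.
Qed.

Lemma is_RInt_pos_cont (phi : R -> R) e r :
  0 < e -> 0 < r -> (forall y, 0 < y -> continuous phi y) -> is_RInt phi e r (RInt phi e r).
Proof.
  intros He Hr Hc. apply (@RInt_correct R_CompleteNormedModule).
  apply (@ex_RInt_continuous R_CompleteNormedModule). intros z Hz. apply Hc.
  revert Hz. apply Rmin_case; intros; lra.
Qed.

(** For either sign [sg], the function [sg * RInt phi e y + B / y] is nonincreasing in [y]. *)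
Lemma improper_tail (phi : R -> R) e B r s :
  0 < e -> (forall y, 0 < y -> continuous phi y) ->
  (forall y, e <= y -> Rabs (phi y) <= B / (y * y)) ->
  e <= r <= s -> Rabs (RInt phi e s - RInt phi e r) <= B / r - B / s.
Proof.
  intros He Hc Hb Hrs.
  assert (forall y, 0 < y -> is_derive (fun y => RInt phi e y) y (phi y)) as Hd.
  { intros y Hy. apply (is_derive_RInt phi _ e); [|apply Hc; exact Hy].
    exists (mkposreal y Hy). intros z Hz.
    change (Rabs (z - y) < y) in Hz. apply Rabs_lt_between in Hz.
    apply is_RInt_pos_cont; auto; lra. }
  assert (forall sg, Rabs sg <= 1 -> sg * (RInt phi e s - RInt phi e r) <= B / r - B / s) as H.
  { intros sg Hsg.
    set (g := fun y => sg * RInt phi e y + B / y).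
    assert (forall y, 0 < y -> is_derive g y (sg * phi y - B / (y * y))) as Hg.
    { intros y Hy. unfold g.
      replace (sg * phi y - B / (y * y)) with (sg * phi y + - (B / (y * y))) by ring.
      apply (is_derive_plus (fun y => sg * RInt phi e y) (fun y => B / y)).
      - apply is_derive_scal. apply Hd; exact Hy.
      - auto_derive; [lra|]. field; lra. }
    assert (g s - g r <= 0 * (s - r)) as Hm.
    { apply (mvt_le g (fun y => sg * phi y - B / (y * y))); [lra| | |].
      - intros y Hy. apply Hg; lra.
      - intros y Hy. eapply is_derive_continuity_pt, Hg; lra.
      - intros y Hy. pose proof (Hb y ltac:(lra)) as Hby.
        assert (sg * phi y <= Rabs (phi y)); [|lra].
        eapply Rle_trans; [apply Rle_abs|]. rewrite Rabs_mult. pose proof (Rabs_pos (phi y)). nra. }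
    unfold g in Hm. lra. }
  apply Rabs_le. split.
  - pose proof (H (-1) ltac:(rewrite Rabs_left; lra)). lra.
  - pose proof (H 1 ltac:(rewrite Rabs_R1; lra)). lra.
Qed.

Lemma improper_exists (phi : R -> R) e B :
  0 < e -> 0 <= B -> (forall y, 0 < y -> continuous phi y) ->
  (forall y, e <= y -> Rabs (phi y) <= B / (y * y)) ->
  exists l, filterlim (fun r => RInt phi e r) (Rbar_locally p_infty) (locally l) /\
    is_RInt_gen phi (at_point e) (Rbar_locally p_infty) l /\
    forall r, e <= r -> Rabs (l - RInt phi e r) <= B / r.
Proof.
  intros He HB Hc Hb.
  assert (forall r s, e <= r <= s -> Rabs (RInt phi e s - RInt phi e r) <= B / r) as Ht.
  { intros r s Hrs. pose proof (improper_tail phi e B r s He Hc Hb Hrs) as H.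
    assert (0 <= B / s) by (apply Rdiv_le_0_compat; lra). lra. }
  set (u := fun n => RInt phi e (e * (INR n + 1))).
  assert (forall n, e <= e * (INR n + 1)) as Hn by (intros n; pose proof (pos_INR n); nra).
  assert (ex_finite_lim_seq u) as [l Hl].
  { apply ex_lim_seq_cauchy_corr. intros eps.
    destruct (inv_INR_small (B / e) eps (cond_pos eps)) as [N HN].
    assert (forall n m, (N <= n)%nat -> (n <= m)%nat -> Rabs (u m - u n) < eps) as H.
    { intros n m HNn Hnm. eapply Rle_lt_trans; [apply Ht|].
      - split; [apply Hn|]. apply Rmult_le_compat_l; [lra|]. apply le_INR in Hnm. lra.
      - replace (B / (e * (INR n + 1))) with (B / e / (INR n + 1)); [apply HN; exact HNn|].
        field. pose proof (pos_INR n). split; lra. }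
    exists N. intros n m HNn HNm. destruct (Nat.le_ge_cases n m).
    - rewrite Rabs_minus_sym. apply H; auto.
    - apply H; auto. }
  assert (forall r, e <= r -> Rabs (l - RInt phi e r) <= B / r) as Hlr.
  { intros r Hr. destruct (nfloor_ex (r / e)) as [N0 [_ HN0]].
    { apply Rdiv_le_0_compat; lra. }
    apply (is_lim_seq_closed_le (fun n => u n - RInt phi e r) (l - RInt phi e r) _ Rabs N0).
    - apply is_lim_seq_minus'; [exact Hl|apply is_lim_seq_const].
    - intros x. apply Rcontinuity_abs.
    - intros n HNn. apply Ht. split; [exact Hr|]. apply le_INR in HNn.
      apply Rmult_le_reg_r with (/ e); [apply Rinv_0_lt_compat; lra|].
      replace (e * (INR n + 1) * / e) with (INR n + 1) by (field; lra). unfold Rdiv in HN0. lra. }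
  assert (filterlim (fun r => RInt phi e r) (Rbar_locally p_infty) (locally l)) as HF.
  { apply filterlim_locally. intros eps. exists (Rmax e (B / eps)). intros r Hr.
    pose proof (Rmax_l e (B / eps)). pose proof (Rmax_r e (B / eps)). pose proof (cond_pos eps).
    change (Rabs (RInt phi e r - l) < eps). rewrite Rabs_minus_sym.
    eapply Rle_lt_trans; [apply Hlr; lra|].
    assert (B / eps < r) as H2 by lra.
    apply Rmult_lt_reg_r with r; [lra|]. unfold Rdiv. rewrite Rmult_assoc, Rinv_l by lra.
    apply (Rmult_lt_compat_r eps) in H2; [|lra].
    unfold Rdiv in H2. rewrite Rmult_assoc, Rinv_l in H2 by lra. lra. }
  exists l. split; [exact HF|]. split; [|exact Hlr].
  apply (is_RInt_gen_p_infty phi (fun r => RInt phi e r)); [|exact HF].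
  intros r Hr. apply is_RInt_pos_cont; auto; lra.
Qed.

Lemma improper_unique (phi : R -> R) e l l' :
  is_RInt_gen phi (at_point e) (Rbar_locally p_infty) l ->
  is_RInt_gen phi (at_point e) (Rbar_locally p_infty) l' -> l = l'.
Proof.
  intros H H'.
  rewrite <- (is_RInt_gen_unique phi l H). apply (is_RInt_gen_unique phi l' H').
Qed.

Lemma improper_unique_m (phi : R -> R) e l l' :
  is_RInt_gen phi (Rbar_locally m_infty) (at_point e) l ->
  is_RInt_gen phi (Rbar_locally m_infty) (at_point e) l' -> l = l'.
Proof.
  intros H H'.
  rewrite <- (is_RInt_gen_unique phi l H). apply (is_RInt_gen_unique phi l' H').
Qed.

Lemma improper_scal (phi : R -> R) e c (l : R) :
  is_RInt_gen phi (at_point e) (Rbar_locally p_infty) l ->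
  is_RInt_gen (fun y => c * phi y) (at_point e) (Rbar_locally p_infty) (c * l).
Proof. intros H. apply (is_RInt_gen_scal (V := R_NormedModule)). exact H. Qed.

Lemma improper_minus (phi psi : R -> R) e (l m : R) :
  is_RInt_gen phi (at_point e) (Rbar_locally p_infty) l ->
  is_RInt_gen psi (at_point e) (Rbar_locally p_infty) m ->
  is_RInt_gen (fun y => phi y - psi y) (at_point e) (Rbar_locally p_infty) (l - m).
Proof. intros H H'. apply (is_RInt_gen_minus (V := R_NormedModule)); assumption. Qed.

Lemma improper_ext (phi psi : R -> R) e (l : R) :
  (forall y, phi y = psi y) ->
  is_RInt_gen phi (at_point e) (Rbar_locally p_infty) l ->
  is_RInt_gen psi (at_point e) (Rbar_locally p_infty) l.
Proof. intros H. apply is_RInt_gen_ext. apply filter_forall. intros [u v] y _. apply H. Qed.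

Lemma trunc_Ha_unique a f x e l l' : trunc_Ha a f x e l -> trunc_Ha a f x e l' -> l = l'.
Proof.
  intros (I1 & I2 & H1 & H2 & ->) (J1 & J2 & H1' & H2' & ->). f_equal.
  - eapply improper_unique_m; eassumption.
  - eapply improper_unique; eassumption.
Qed.

(** [is_solution] provides the velocity only as some value [v] related by [is_Ha]; uniqueness
    identifies it with the multiplier formula. *)
Lemma is_Ha_unique a f x v v' : is_Ha a f x v -> is_Ha a f x v' -> v = v'.
Proof.
  intros (I & HI & Hl) (J & HJ & Hl').
  apply (filterlim_locally_unique (F := at_right 0) I); [exact Hl|].
  eapply filterlim_ext_loc; [|exact Hl'].
  exists (mkposreal 1 Rlt_0_1). intros y _ Hy.
  eapply trunc_Ha_unique; [apply HJ|apply HI]; exact Hy.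
Qed.

(** * The kernel, its sine transform and the multipliers *)

Section Kernel.

Variable a : R.
Hypothesis ha : 0 < a.

Lemma Ka_continuous y : 0 < y -> continuous (Ka a) y.
Proof.
  intros Hy. pose proof PI_RGT_0. apply (@ex_derive_continuous R_AbsRing R_NormedModule).
  unfold Ka. auto_derive. repeat split; nra.
Qed.

Lemma Ka_opp y : 0 < y -> Ka a (- y) = - Ka a y.
Proof. intros Hy. unfold Ka. pose proof PI_RGT_0. field. repeat split; nra. Qed.

Lemma Ka_pos y : 0 < y -> 0 < Ka a y.
Proof.
  intros Hy. pose proof PI_RGT_0. unfold Ka. apply Rmult_lt_0_compat.
  - apply Rinv_0_lt_compat. nra.
  - apply Rdiv_lt_0_compat; nra.
Qed.

Lemma Ka_le_inv y : 0 < y -> 2 * Ka a y <= / y.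
Proof.
  intros Hy. pose proof PI2_1. unfold Ka.
  assert (0 < y ^ 2 + a ^ 2) by nra. assert (0 < PI * y) by nra.
  apply Rmult_le_reg_r with (PI * y * (y ^ 2 + a ^ 2)); [apply Rmult_lt_0_compat; assumption|].
  replace (2 * (/ (PI * y) * (a ^ 2 / (y ^ 2 + a ^ 2))) * (PI * y * (y ^ 2 + a ^ 2)))
    with (2 * a ^ 2) by (field; repeat split; nra).
  replace (/ y * (PI * y * (y ^ 2 + a ^ 2))) with (PI * (y ^ 2 + a ^ 2)) by (field; lra). nra.
Qed.

Lemma Ka_decay e y : 0 < e -> e <= y -> Ka a y <= (a ^ 2 / e) / (y * y).
Proof.
  intros He Hy. pose proof PI2_1. unfold Ka.
  assert (0 < y ^ 2 + a ^ 2) by nra. assert (0 < PI * y) by nra. assert (0 < y * y) by nra.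
  apply Rmult_le_reg_r with (e * (y * y) * (PI * y * (y ^ 2 + a ^ 2)));
    [apply Rmult_lt_0_compat; apply Rmult_lt_0_compat; assumption|].
  replace (/ (PI * y) * (a ^ 2 / (y ^ 2 + a ^ 2)) * (e * (y * y) * (PI * y * (y ^ 2 + a ^ 2))))
    with (a ^ 2 * (e * (y * y))) by (field; repeat split; nra).
  replace (a ^ 2 / e / (y * y) * (e * (y * y) * (PI * y * (y ^ 2 + a ^ 2))))
    with (a ^ 2 * (PI * y * (y ^ 2 + a ^ 2))) by (field; repeat split; nra).
  apply Rmult_le_compat_l; [nra|].
  apply Rmult_le_compat; nra.
Qed.

Definition sym_int (f : R -> R) (x y : R) : R := (f (x - y) - f (x + y)) * Ka a y.

(** Away from zero the kernel is [O(1 / y^2)], so both half-line integrals converge; oddness of [Ka]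
    folds the left one onto the right, where the difference [f (x - y) - f (x + y)] appears. *)
Lemma trunc_Ha_sym (f : R -> R) B x e :
  (forall y, continuous f y) -> (forall y, Rabs (f y) <= B) -> 0 < e ->
  exists l, trunc_Ha a f x e l /\
    is_RInt_gen (sym_int f x) (at_point e) (Rbar_locally p_infty) l.
Proof.
  intros Hc HB He.
  assert (0 <= B) as HB0 by (pose proof (HB 0); pose proof (Rabs_pos (f 0)); lra).
  set (D := B * (a ^ 2 / e)).
  assert (0 <= D) as HD.
  { apply Rmult_le_pos; [lra|]. apply Rdiv_le_0_compat; nra. }
  assert (forall sg y, e <= y -> Rabs (f (x + sg * y) * Ka a y) <= D / (y * y)) as Hb.
  { intros sg y Hy. rewrite Rabs_mult, (Rabs_pos_eq (Ka a y)) by (left; apply Ka_pos; lra).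
    unfold D, Rdiv. rewrite Rmult_assoc. apply Rmult_le_compat; auto using Rabs_pos.
    - left; apply Ka_pos; lra.
    - apply Ka_decay; lra. }
  assert (forall sg y, 0 < y -> continuous (fun y => f (x + sg * y) * Ka a y) y) as Hcont.
  { intros sg y Hy. apply continuous_Rmult; [|apply Ka_continuous; exact Hy].
    apply (continuous_comp (fun y => x + sg * y) f); [|apply Hc].
    apply continuous_Rplus; [apply continuous_const|].
    apply continuous_Rmult; [apply continuous_const|apply continuous_id]. }
  destruct (improper_exists _ e D He HD (Hcont (-1)) (Hb (-1))) as (I2 & HF2 & HI2 & _).
  destruct (improper_exists _ e D He HD (Hcont 1) (Hb 1)) as (J & HFJ & HIJ & _).
  exists (- J + I2). split.
  - exists (- J), I2. split; [|split; [|reflexivity]].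
    + apply (is_RInt_gen_m_infty _ (fun r => - RInt (fun y => f (x + 1 * y) * Ka a y) e r)).
      * intros r Hr.
        set (phi := fun y => f (x + 1 * y) * Ka a y).
        apply is_RInt_ext with (fun y => opp (phi (- y))).
        { intros y Hy. rewrite Rmin_left, Rmax_right in Hy by lra. unfold phi, opp; simpl.
          pose proof (Ka_opp (- y) ltac:(lra)) as HK. rewrite Ropp_involutive in HK. rewrite HK.
          replace (x + 1 * - y) with (x - y) by ring. ring. }
        apply (is_RInt_comp_opp phi). rewrite !Ropp_involutive.
        apply (@is_RInt_swap R_NormedModule phi r e (RInt phi e r)). apply is_RInt_pos_cont; [lra|lra|]. intros y Hy. apply Hcont; exact Hy.
      * apply (filterlim_comp _ _ _ _ Ropp _ (locally J)); [exact HFJ|].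
        apply (@filterlim_opp R_AbsRing R_NormedModule).
    + eapply is_RInt_gen_ext; [|exact HI2].
      apply filter_forall. intros [u v] y _. f_equal. f_equal. ring.
  - replace (- J + I2) with (minus I2 J) by (unfold minus, plus, opp; simpl; ring).
    eapply is_RInt_gen_ext; [|apply (is_RInt_gen_minus _ _ _ _ HI2 HIJ)].
    apply filter_forall. intros [u v] y _. unfold sym_int, minus, plus, opp; simpl.
    replace (x + -1 * y) with (x - y) by ring. replace (x + 1 * y) with (x + y) by ring. ring.
Qed.

(** [|sin (c y)| <= |c| y] cancels the singularity [2 Ka a y <= 1 / y]; after folding, the principal
    value is an ordinary integral near zero. *)
Lemma sin_kernel_small c y : 0 < y -> Rabs (2 * (sin (c * y) * Ka a y)) <= Rabs c.
Proof.
  intros Hy. pose proof (Ka_pos y Hy) as Hp. pose proof (Ka_le_inv y Hy) as Hle.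
  assert (Rabs (sin (c * y)) <= Rabs c * y) as Hs.
  { assert (forall z, 0 <= z -> Rabs (sin z) <= z) as H.
    { intros z Hz. destruct (Rle_dec z PI) as [Hz'|Hz'].
      - rewrite Rabs_pos_eq by (apply sin_ge_0; lra). apply sin_le_id; lra.
      - pose proof (SIN_bound z). pose proof PI2_1. apply Rabs_le; lra. }
    destruct (Rle_dec 0 c) as [Hc|Hc].
    - rewrite (Rabs_pos_eq c) by lra. apply H. apply Rmult_le_pos; lra.
    - rewrite (Rabs_left c) by lra. rewrite <- Rabs_Ropp, <- sin_neg.
      replace (- (c * y)) with (- c * y) by ring. apply H. apply Rmult_le_pos; lra. }
  replace (2 * (sin (c * y) * Ka a y)) with (sin (c * y) * (2 * Ka a y)) by ring.
  rewrite Rabs_mult, (Rabs_pos_eq (2 * Ka a y)) by lra.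
  replace (Rabs c) with (Rabs c * y * / y) by (field; lra).
  apply Rmult_le_compat; auto using Rabs_pos. lra.
Qed.

Lemma sin_kernel_continuous c y :
  0 < y -> continuous (fun y => 2 * (sin (c * y) * Ka a y)) y.
Proof.
  intros Hy. apply continuous_Rmult; [apply continuous_const|].
  apply continuous_Rmult; [|apply Ka_continuous; exact Hy].
  apply is_derive_cont with (cos (c * y) * c). auto_derive; [trivial|ring].
Qed.

Lemma is_derive_sin_kernel_int c e y :
  0 < e -> 0 < y ->
  is_derive (fun r => RInt (fun y => 2 * (sin (c * y) * Ka a y)) e r) y (2 * (sin (c * y) * Ka a y)).
Proof.
  intros He Hy.
  pose proof (sin_kernel_continuous c) as Hc.
  apply (is_derive_RInt (fun y => 2 * (sin (c * y) * Ka a y)) _ e); [|apply Hc; exact Hy].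
  exists (mkposreal y Hy). intros z Hz.
  change (Rabs (z - y) < y) in Hz. apply Rabs_lt_between in Hz.
  apply is_RInt_pos_cont; auto; lra.
Qed.

(** Integration by parts against the decreasing weight [2 * Ka a]. *)
Lemma sin_kernel_oscillation c d r :
  0 < c -> 0 < d -> 1 <= c * d -> d <= r ->
  Rabs (RInt (fun y => 2 * (sin (c * y) * Ka a y)) d r) <= 2.
Proof.
  intros Hc Hd Hcd Hr. pose proof PI2_1 as Hpi.
  set (w := fun y => 2 * Ka a y).
  set (w' := fun y => - (2 * a ^ 2 / PI) * ((3 * y ^ 2 + a ^ 2) / ((y * (y ^ 2 + a ^ 2)) ^ 2))).
  assert (forall y, 0 < y -> is_derive w y (w' y)) as Hw.
  { intros y Hy. unfold w, w', Ka. auto_derive; [repeat split; nra|].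
    field. repeat split; nra. }
  assert (forall y, 0 < y -> w' y <= 0) as Hw'.
  { intros y Hy. unfold w'.
    assert (0 <= 2 * a ^ 2 / PI) by (apply Rdiv_le_0_compat; nra).
    assert (0 <= (3 * y ^ 2 + a ^ 2) / (y * (y ^ 2 + a ^ 2)) ^ 2).
    { apply Rdiv_le_0_compat; [nra|]. apply pow_lt. apply Rmult_lt_0_compat; nra. }
    nra. }
  set (F := fun r => RInt (fun y => 2 * (sin (c * y) * Ka a y)) d r).
  assert (forall sg, -1 <= sg <= 1 -> sg * F r <= 2 * (w d / c)) as H.
  { intros sg Hsg.
    (* The extra [w y / c] gives the derivative the form [(sg cos (c y) + 1) w' / c], which is
       nonpositive because [w] decreases; comparing [Q r] with [Q d] then leaves [2 w d / c]. *)
    set (Q := fun y => sg * F y + (sg * (cos (c * y) * w y / c) + w y / c)).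
    assert (forall y, 0 < y -> is_derive Q y ((sg * cos (c * y) + 1) * w' y / c)) as HQ.
    { intros y Hy. unfold Q.
      replace ((sg * cos (c * y) + 1) * w' y / c) with
        (sg * (2 * (sin (c * y) * Ka a y)) +
          (sg * ((- (c * sin (c * y)) * w y + cos (c * y) * w' y) * / c) + w' y * / c))
        by (unfold w; field; lra).
      apply (is_derive_plus (fun y => sg * F y) (fun y => sg * (cos (c * y) * w y / c) + w y / c)).
      - apply is_derive_scal. apply is_derive_sin_kernel_int; assumption.
      - apply (is_derive_plus (fun y => sg * (cos (c * y) * w y / c)) (fun y => w y / c)).
        + apply is_derive_scal.
          apply (is_derive_scal_l (fun y => cos (c * y) * w y) y _ (/ c)).
          apply (is_derive_mult (fun y => cos (c * y)) w); [|apply Hw; exact Hy|intros; apply Rmult_comm].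
          auto_derive; [trivial|ring].
        + apply (is_derive_scal_l w y (w' y) (/ c)). apply Hw; exact Hy. }
    assert (Q r - Q d <= 0 * (r - d)) as Hm.
    { apply (mvt_le Q (fun y => (sg * cos (c * y) + 1) * w' y / c)); [lra| | |].
      - intros y Hy. apply HQ; lra.
      - intros y Hy. eapply is_derive_continuity_pt, HQ; lra.
      - intros y Hy. pose proof (Hw' y ltac:(lra)). pose proof (COS_bound (c * y)).
        assert (0 < / c) by (apply Rinv_0_lt_compat; lra).
        assert (0 <= sg * cos (c * y) + 1) by nra.
        assert ((sg * cos (c * y) + 1) * w' y <= 0) by nra. unfold Rdiv. nra. }
    unfold Q in Hm. unfold F at 2 in Hm.
    rewrite RInt_point in Hm. unfold zero in Hm; simpl in Hm.
    assert (forall y, 0 < y -> -1 * (w y / c) <= sg * (cos (c * y) * w y / c) <= w y / c) as Hb.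
    { intros y Hy. pose proof (Ka_pos y Hy). assert (0 <= w y / c).
      { unfold w. apply Rdiv_le_0_compat; lra. }
      pose proof (COS_bound (c * y)).
      replace (sg * (cos (c * y) * w y / c)) with (sg * cos (c * y) * (w y / c)) by (unfold Rdiv; ring).
      assert (-1 <= sg * cos (c * y) <= 1) by nra. nra. }
    pose proof (Hb d Hd). pose proof (Hb r ltac:(lra)). lra. }
  assert (w d / c <= 1) as Hwd.
  { pose proof (Ka_le_inv d Hd) as Hk. unfold w.
    apply Rmult_le_reg_r with c; [lra|]. unfold Rdiv. rewrite Rmult_assoc, Rinv_l by lra.
    assert (/ d <= c).
    { apply Rmult_le_reg_r with d; [lra|]. rewrite Rinv_l by lra. exact Hcd. }
    lra. }
  fold (F r). apply Rabs_le. split.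
  - pose proof (H (-1) ltac:(lra)). lra.
  - pose proof (H 1 ltac:(lra)). lra.
Qed.

(** Split at [1 / c]: below, the integrand is at most [c] on a length at most [1 / c], which gives
    [1]; above, oscillation gives [2]. The bound is uniform in [c], hence in the frequency. *)
Lemma sin_kernel_int_bound_pos c e r :
  0 < c -> 0 < e -> e <= r -> Rabs (RInt (fun y => 2 * (sin (c * y) * Ka a y)) e r) <= 3.
Proof.
  intros Hc He Hr.
  set (phi := fun y => 2 * (sin (c * y) * Ka a y)).
  pose proof (sin_kernel_continuous c : forall y, 0 < y -> continuous phi y) as Hcont.
  assert (0 < / c) as Hic by (apply Rinv_0_lt_compat; lra).
  assert (c * / c = 1) as Hcc by (apply Rinv_r; lra).
  assert (forall d, e <= d <= / c -> Rabs (RInt phi e d) <= 1) as H1.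
  { intros d Hd.
    eapply Rle_trans; [apply (is_RInt_abs_le phi e d _ (Rabs c)); [lra| |]|].
    - apply is_RInt_pos_cont; auto; lra.
    - intros y Hy. apply sin_kernel_small. lra.
    - rewrite Rabs_pos_eq by lra. nra. }
  destruct (Rle_dec (/ c) e) as [Hce|Hce].
  - pose proof (sin_kernel_oscillation c e r Hc He ltac:(nra) Hr) as H. fold phi in H. lra.
  - destruct (Rle_dec r (/ c)) as [Hrc|Hrc].
    + specialize (H1 r ltac:(lra)). fold phi. lra.
    + pose proof (sin_kernel_oscillation c (/ c) r Hc Hic ltac:(lra) ltac:(lra)) as H. fold phi in H.
      specialize (H1 (/ c) ltac:(lra)).
      assert (RInt phi e r = RInt phi e (/ c) + RInt phi (/ c) r) as Heq.
      { symmetry. apply (RInt_Chasles phi e (/ c) r); eexists; apply is_RInt_pos_cont; auto; lra. }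
      fold phi. rewrite Heq. eapply Rle_trans; [apply Rabs_triang|]. lra.
Qed.

Lemma sin_kernel_int_bound c e r :
  0 < e -> e <= r -> Rabs (RInt (fun y => 2 * (sin (c * y) * Ka a y)) e r) <= 3.
Proof.
  intros He Hr. destruct (Rlt_dec 0 c) as [Hc|Hc]; [apply sin_kernel_int_bound_pos; assumption|].
  destruct (Req_dec c 0) as [->|Hc0].
  - rewrite (RInt_ext _ (fun _ => 0)).
    + rewrite RInt_const. unfold scal; simpl; unfold mult; simpl. rewrite Rmult_0_r, Rabs_R0. lra.
    + intros y _. rewrite Rmult_0_l, sin_0. simpl; ring.
  - pose proof (sin_kernel_int_bound_pos (- c) e r ltac:(lra) He Hr) as H.
    rewrite <- Rabs_Ropp.
    replace (- RInt (fun y => 2 * (sin (c * y) * Ka a y)) e r)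
      with (RInt (fun y => 2 * (sin (- c * y) * Ka a y)) e r); [exact H|].
    apply is_RInt_unique. apply is_RInt_Rext with (fun y => opp (2 * (sin (c * y) * Ka a y))).
    { intros y. unfold opp; simpl. replace (- c * y) with (- (c * y)) by ring. rewrite sin_neg. ring. }
    apply (@is_RInt_opp R_NormedModule). apply is_RInt_pos_cont; [lra|lra|apply sin_kernel_continuous].
Qed.

Lemma sin_kernel_improper c e :
  0 < e ->
  exists l : R, Rabs l <= 3 /\
    is_RInt_gen (fun y => 2 * (sin (c * y) * Ka a y)) (at_point e) (Rbar_locally p_infty) l.
Proof.
  intros He.
  set (phi := fun y => 2 * (sin (c * y) * Ka a y)).
  pose proof (sin_kernel_continuous c : forall y, 0 < y -> continuous phi y) as Hcont.
  assert (0 <= a ^ 2 / e) as HD by (apply Rdiv_le_0_compat; nra).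
  destruct (improper_exists phi e (2 * (a ^ 2 / e)) He ltac:(lra) Hcont) as (l & _ & HI & Hl).
  { intros y Hy. unfold phi. rewrite !Rabs_mult, (Rabs_pos_eq 2), (Rabs_pos_eq (Ka a y))
      by (lra || (left; apply Ka_pos; lra)).
    pose proof (Ka_decay e y He Hy). pose proof (Ka_pos y ltac:(lra)).
    assert (Rabs (sin (c * y)) <= 1) by (pose proof (SIN_bound (c * y)); apply Rabs_le; lra).
    pose proof (Rabs_pos (sin (c * y))).
    replace (2 * (a ^ 2 / e) / (y * y)) with (2 * (1 * (a ^ 2 / e / (y * y)))) by (field; split; lra).
    apply Rmult_le_compat_l; [lra|]. apply Rmult_le_compat; lra. }
  exists l. split; [|exact HI].
  apply le_epsilon. intros eps Heps.
  set (B := 2 * (a ^ 2 / e)) in *.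
  set (r := Rmax e (B / eps)).
  assert (e <= r) as Hr by apply Rmax_l. assert (B / eps <= r) as Hr2 by apply Rmax_r.
  pose proof (Hl r Hr) as H1. pose proof (sin_kernel_int_bound c e r He Hr) as H2. fold phi in H2.
  assert (B / r <= eps).
  { apply Rmult_le_reg_r with r; [lra|]. unfold Rdiv. rewrite Rmult_assoc, Rinv_l by lra.
    apply (Rmult_le_compat_r eps) in Hr2; [|lra].
    unfold Rdiv in Hr2. rewrite Rmult_assoc, Rinv_l in Hr2 by lra. lra. }
  pose proof (Rabs_triang (l - RInt phi e r) (RInt phi e r)) as H3.
  assert (forall u v : R, u - v + v = u) as Huv by (intros; ring). rewrite Huv in H3. lra.
Qed.

(** Between the two inner radii the integrand is at most [|c|]. This yields both the limit defining
    [mu] and its rate. *)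
Lemma sin_kernel_improper_diff c e e' (l l' : R) :
  0 < e' <= e ->
  is_RInt_gen (fun y => 2 * (sin (c * y) * Ka a y)) (at_point e) (Rbar_locally p_infty) l ->
  is_RInt_gen (fun y => 2 * (sin (c * y) * Ka a y)) (at_point e') (Rbar_locally p_infty) l' ->
  Rabs (l' - l) <= Rabs c * e.
Proof.
  intros He Hl Hl'.
  set (phi := fun y => 2 * (sin (c * y) * Ka a y)) in *.
  assert (is_RInt phi e' e (RInt phi e' e)) as HI.
  { apply is_RInt_pos_cont; [lra|lra|apply sin_kernel_continuous]. }
  assert (is_RInt_gen phi (at_point e') (Rbar_locally p_infty) (RInt phi e' e + l)) as Hs.
  { apply (is_RInt_gen_Chasles (V := R_NormedModule) phi e (RInt phi e' e) l); [|exact Hl].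
    apply is_RInt_gen_at_point. exact HI. }
  pose proof (improper_unique _ _ _ _ Hl' Hs) as ->.
  assert (forall u v : R, u + v - v = u) as -> by (intros; ring).
  eapply Rle_trans; [apply (is_RInt_abs_le phi e' e _ (Rabs c)); [lra|exact HI|]|].
  - intros y Hy. apply sin_kernel_small. lra.
  - pose proof (Rabs_pos c). nra.
Qed.

(** Symbol of the operator truncated to [|y| >= e], which sends [cas (k x)] to
    [- mue k e cas (- k x)]. *)
Definition mue (k : Z) (e : R) : R :=
  RInt_gen (fun y => 2 * (sin (IZR k * y) * Ka a y)) (at_point e) (Rbar_locally p_infty).

Lemma mue_spec k e : 0 < e ->
  is_RInt_gen (fun y => 2 * (sin (IZR k * y) * Ka a y)) (at_point e) (Rbar_locally p_infty) (mue k e) /\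
  Rabs (mue k e) <= 3.
Proof.
  intros He. destruct (sin_kernel_improper (IZR k) e He) as [l [Hl HI]].
  unfold mue. rewrite (is_RInt_gen_unique _ _ HI). split; assumption.
Qed.

(** The limit is taken along a sequence of radii; [mue_mu] extends it to all small [e], with a
    rate. *)
Definition mu (k : Z) : R := real (Lim_seq (fun n => mue k (/ (INR n + 1)))).

Lemma inv_INR1_pos n : 0 < / (INR n + 1).
Proof. apply Rinv_0_lt_compat. pose proof (pos_INR n). lra. Qed.

Lemma mu_lim k : is_lim_seq (fun n => mue k (/ (INR n + 1))) (mu k).
Proof.
  assert (ex_finite_lim_seq (fun n => mue k (/ (INR n + 1)))) as [l Hl].
  { apply ex_lim_seq_cauchy_corr. intros eps.
    destruct (inv_INR_small (Rabs (IZR k)) eps (cond_pos eps)) as [N HN].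
    assert (forall n m, (N <= n)%nat -> (n <= m)%nat ->
      Rabs (mue k (/ (INR m + 1)) - mue k (/ (INR n + 1))) < eps) as H.
    { intros n m HNn Hnm. eapply Rle_lt_trans; [|apply (HN n HNn)].
      apply (sin_kernel_improper_diff (IZR k) (/ (INR n + 1)) (/ (INR m + 1))).
      - split; [apply inv_INR1_pos|]. apply le_INR in Hnm. pose proof (pos_INR n).
        apply Rinv_le_contravar; lra.
      - apply mue_spec, inv_INR1_pos.
      - apply mue_spec, inv_INR1_pos. }
    exists N. intros n m HNn HNm. destruct (Nat.le_ge_cases n m).
    - rewrite Rabs_minus_sym. apply H; auto.
    - apply H; auto. }
  unfold mu. rewrite (is_lim_seq_unique _ _ Hl). exact Hl.
Qed.

Lemma mu_bound k : Rabs (mu k) <= 3.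
Proof.
  apply (is_lim_seq_closed_le _ _ _ Rabs 0 (mu_lim k)).
  - intros x. apply Rcontinuity_abs.
  - intros n _. apply mue_spec, inv_INR1_pos.
Qed.

Lemma mue_mu k e : 0 < e -> Rabs (mue k e - mu k) <= Rabs (IZR k) * e.
Proof.
  intros He. rewrite Rabs_minus_sym.
  destruct (inv_INR_small 1 e He) as [N HN].
  apply (is_lim_seq_closed_le (fun n => mue k (/ (INR n + 1)) - mue k e) (mu k - mue k e) _ Rabs N).
  - apply is_lim_seq_minus'; [apply mu_lim|apply is_lim_seq_const].
  - intros x. apply Rcontinuity_abs.
  - intros n Hn. apply (sin_kernel_improper_diff (IZR k) e (/ (INR n + 1))).
    + split; [apply inv_INR1_pos|]. specialize (HN n Hn). unfold Rdiv in HN. rewrite Rmult_1_l in HN. lra.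
    + apply mue_spec, He.
    + apply mue_spec, inv_INR1_pos.
Qed.

Lemma is_RInt_gen_zsum n (f : Z -> R -> R) (I : Z -> R) e :
  (forall k, is_RInt_gen (f k) (at_point e) (Rbar_locally p_infty) (I k)) ->
  is_RInt_gen (fun y => zsum n (fun k => f k y)) (at_point e) (Rbar_locally p_infty) (zsum n I).
Proof.
  intros H. induction n as [|n IH]; cbn [zsum]; [apply H|].
  apply (is_RInt_gen_plus (fun y => zsum n (fun k => f k y))
    (fun y => f (Z.of_nat (S n)) y + f (- Z.of_nat (S n))%Z y)); [exact IH|].
  apply (is_RInt_gen_plus (f (Z.of_nat (S n))) (f (- Z.of_nat (S n))%Z)); apply H.
Qed.

Lemma sym_int_cas k x y :
  sym_int (fun z => cas (IZR k * z)) x y = - cas (- (IZR k * x)) * (2 * (sin (IZR k * y) * Ka a y)).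
Proof.
  unfold sym_int, cas. rewrite Rmult_minus_distr_l, Rmult_plus_distr_l.
  rewrite cos_minus, cos_plus, sin_minus, sin_plus, cos_neg, sin_neg. ring.
Qed.

Lemma zser_cas_continuous (h : Z -> R) C x :
  summable h C -> continuous (fun y => zser (fun k => h k * cas (IZR k * y))) x.
Proof.
  intros Hh. apply (zser_continuous _ (C * 2) x (mkposreal 1 Rlt_0_1)).
  - intros y _. apply summable_mult_bounded; auto using cas_bound.
  - intros k y _. apply continuous_Rmult; [apply continuous_const|apply continuous_cas0].
Qed.

(** Two interchanges of limits. At fixed [e], the tail of the series is small uniformly in [y] while
    the kernel is integrable on [[e, infinity)]. As [e] tends to zero, the error [|k| e] of each
    multiplier is absorbed by the second power of the weight. *)
Theorem is_Ha_zser (h : Z -> R) C x :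
  (forall k, Rabs (h k) * wt k ^ 2 <= C) ->
  is_Ha a (fun y => zser (fun k => h k * cas (IZR k * y))) x
    (zser (fun k => h k * (- mu k * cas (- (IZR k * x))))).
Proof.
  intros Hdec.
  assert (summable h C) as Hh.
  { intros k. apply decay_div. pose proof (decay_weaken _ _ 1 2 k ltac:(lia) (Hdec k)) as H.
    rewrite pow_1 in H. exact H. }
  pose proof (summable_nonneg h C Hh) as HC.
  set (f := fun y => zser (fun k => h k * cas (IZR k * y))).
  assert (forall y, continuous f y) as Hfc by (intros; eapply zser_cas_continuous, Hh).
  assert (forall y, summable (fun k => h k * cas (IZR k * y)) (C * 2)) as Hs.
  { intros y. apply summable_mult_bounded; auto using cas_bound. }
  assert (forall y, Rabs (f y) <= 5 * (C * 2)) as Hfb by (intros y; apply zser_bound, Hs).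
  assert (forall e k, 0 < e -> Rabs (- mue k e * cas (- (IZR k * x))) <= 3 * 2) as Hmb.
  { intros e k He. rewrite Rabs_mult, Rabs_Ropp.
    apply Rmult_le_compat; auto using Rabs_pos, cas_bound. apply mue_spec, He. }
  assert (forall k, Rabs (- mu k * cas (- (IZR k * x))) <= 3 * 2) as Hmb0.
  { intros k. rewrite Rabs_mult, Rabs_Ropp.
    apply Rmult_le_compat; auto using Rabs_pos, cas_bound, mu_bound. }
  exists (fun e => zser (fun k => h k * (- mue k e * cas (- (IZR k * x))))). split.
  - intros e He. destruct (trunc_Ha_sym f _ x e Hfc Hfb He) as [l [Hl HI]].
    replace (zser (fun k => h k * (- mue k e * cas (- (IZR k * x))))) with l; [exact Hl|].
    symmetry. apply zser_unique.
    assert (0 <= a ^ 2 / e) as Hae by (apply Rdiv_le_0_compat; nra).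
    apply is_lim_seq_of_bound with (2 * (4 * (C * 2)) * (a ^ 2 / e) / e). intros n.
    pose proof (pos_INR n) as Hn.
    set (S := fun y => zsum n (fun k => h k * sym_int (fun z => cas (IZR k * z)) x y)).
    assert (is_RInt_gen S (at_point e) (Rbar_locally p_infty)
      (zsum n (fun k => h k * (- mue k e * cas (- (IZR k * x)))))) as HS.
    { apply (is_RInt_gen_zsum n (fun k y => h k * sym_int (fun z => cas (IZR k * z)) x y)).
      intros k.
      replace (h k * (- mue k e * cas (- (IZR k * x))))
        with (h k * - cas (- (IZR k * x)) * mue k e) by ring.
      eapply improper_ext; [|apply improper_scal; apply mue_spec; exact He].
      intros y. simpl. rewrite sym_int_cas. ring. }
    set (B := 2 * (4 * (C * 2) / (INR n + 1)) * (a ^ 2 / e)).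
    assert (0 <= B) as HB.
    { unfold B. apply Rmult_le_pos; [|exact Hae]. apply Rmult_le_pos; [lra|]. apply Rdiv_le_0_compat; lra. }
    set (D := fun y => S y - sym_int f x y).
    destruct (improper_exists D e B He HB) as (l' & _ & HD & Hl').
    + intros y Hy. apply continuous_Rminus.
      * apply continuous_zsum. intros k _. apply continuous_Rmult; [apply continuous_const|].
        apply continuous_ext with (fun y => - cas (- (IZR k * x)) * (2 * (sin (IZR k * y) * Ka a y))).
        { intros z. symmetry. apply sym_int_cas. }
        apply continuous_Rmult; [apply continuous_const|].
        apply sin_kernel_continuous, Hy.
      * apply continuous_Rmult; [|apply Ka_continuous; exact Hy].
        apply continuous_Rminus.
        -- apply (continuous_comp (fun y => x - y) f); [|apply Hfc].
           apply continuous_Rminus; [apply continuous_const|apply continuous_id].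
        -- apply (continuous_comp (fun y => x + y) f); [|apply Hfc].
           apply continuous_Rplus; [apply continuous_const|apply continuous_id].
    + intros y Hy. unfold D.
      replace (S y - sym_int f x y) with
        (((f (x + y) - zsum n (fun k => h k * cas (IZR k * (x + y)))) -
          (f (x - y) - zsum n (fun k => h k * cas (IZR k * (x - y))))) * Ka a y).
      2:{ unfold S, sym_int.
          rewrite (zsum_ext n (fun k => h k * ((cas (IZR k * (x - y)) - cas (IZR k * (x + y))) * Ka a y))
            (fun k => (h k * cas (IZR k * (x - y)) - h k * cas (IZR k * (x + y))) * Ka a y))
            by (intros; ring).
          rewrite zsum_scal_r, zsum_minus. ring. }
      pose proof (zser_tail n _ _ (Hs (x + y))) as H1. pose proof (zser_tail n _ _ (Hs (x - y))) as H2.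
      fold (f (x + y)) in H1. fold (f (x - y)) in H2.
      rewrite Rabs_mult, (Rabs_pos_eq (Ka a y)) by (left; apply Ka_pos; lra).
      replace (B / (y * y)) with (2 * (4 * (C * 2) / (INR n + 1)) * (a ^ 2 / e / (y * y)))
        by (unfold B, Rdiv; ring).
      apply Rmult_le_compat; [apply Rabs_pos|left; apply Ka_pos; lra| |apply Ka_decay; lra].
      apply Rabs_le_between in H1, H2. apply Rabs_le. lra.
    + assert (is_RInt_gen D (at_point e) (Rbar_locally p_infty)
        (zsum n (fun k => h k * (- mue k e * cas (- (IZR k * x)))) - l)) as HD'
        by (apply improper_minus; assumption).
      pose proof (improper_unique _ _ _ _ HD HD') as Heq.
      (* The tail estimate at its left end: the proper integral is over a point, so the whole
         improper integral is at most [B / e]. *)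
      specialize (Hl' e (Rle_refl e)). rewrite RInt_point in Hl'. unfold zero in Hl'; simpl in Hl'.
      rewrite Rminus_0_r, Heq in Hl'.
      eapply Rle_trans; [exact Hl'|]. right. unfold B. field. split; lra.
  - apply filterlim_locally. intros eps.
    assert (0 < eps / (5 * (C * 2) + 1)) as Hd.
    { apply Rdiv_lt_0_compat; [apply cond_pos|lra]. }
    exists (mkposreal _ Hd). intros e Hball He.
    change (Rabs (e - 0) < eps / (5 * (C * 2) + 1)) in Hball.
    rewrite Rminus_0_r, Rabs_pos_eq in Hball by lra.
    change (Rabs (zser (fun k => h k * (- mue k e * cas (- (IZR k * x)))) -
      zser (fun k => h k * (- mu k * cas (- (IZR k * x))))) < eps).
    assert (zser (fun k => h k * (- mue k e * cas (- (IZR k * x)))) -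
      zser (fun k => h k * (- mu k * cas (- (IZR k * x)))) =
      zser (fun k => h k * ((mu k - mue k e) * cas (- (IZR k * x))))) as ->.
    { replace (zser (fun k => h k * (- mue k e * cas (- (IZR k * x))))) with
        (zser (fun k => h k * ((mu k - mue k e) * cas (- (IZR k * x))) + h k * (- mu k * cas (- (IZR k * x))))).
      - rewrite (zser_plus _ _ (C * ((3 + 3) * 2)) (C * (3 * 2))); [ring| |].
        + apply summable_mult_bounded; [exact Hh|]. intros k. rewrite Rabs_mult.
          apply Rmult_le_compat; auto using Rabs_pos, cas_bound.
          eapply Rle_trans; [apply Rabs_triang|]. rewrite Rabs_Ropp.
          apply Rplus_le_compat; [apply mu_bound|apply mue_spec, He].
        + apply summable_mult_bounded; assumption.
      - apply zser_ext. intros k. ring. }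
    eapply Rle_lt_trans; [apply (zser_bound _ (C * 2 * e))|].
    + intros k. rewrite !Rabs_mult.
      pose proof (mue_mu k e He) as H1. rewrite Rabs_minus_sym in H1.
      pose proof (cas_bound (- (IZR k * x))) as H2.
      pose proof (decay_lip1_term _ _ k 2 ltac:(lia) (Hdec k)) as H3. rewrite Rabs_mult in H3.
      replace (C * 2 * e * / wt k) with (C * / wt k * e * 2) by ring.
      rewrite <- Rmult_assoc. apply Rmult_le_compat; auto using Rabs_pos.
      { apply Rmult_le_pos; apply Rabs_pos. }
      apply Rle_trans with (Rabs (h k) * (Rabs (IZR k) * e)).
      { apply Rmult_le_compat_l; [apply Rabs_pos|exact H1]. }
      replace (Rabs (h k) * (Rabs (IZR k) * e)) with (Rabs (IZR k) * Rabs (h k) * e) by ring.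
      apply Rmult_le_compat_r; [lra|exact H3].
    + apply Rmult_lt_compat_r with (r := 5 * (C * 2) + 1) in Hball; [|lra].
      unfold Rdiv in Hball. rewrite Rmult_assoc, Rinv_l in Hball by lra. nra.
Qed.

End Kernel.

(** * Time regularity *)

(** Peetre's inequality: it distributes the weight at the output frequency over the two interacting
    ones. *)
Lemma wt_plus_le j l : wt (j + l) <= 2 * (wt j * wt l).
Proof.
  unfold wt. rewrite plus_IZR.
  pose proof (Rle_0_sqr (IZR j - IZR l)). unfold Rsqr in *.
  assert (0 <= (IZR j * IZR j) * (IZR l * IZR l)) by (apply Rmult_le_pos; apply Rle_0_sqr). lra.
Qed.

Lemma wt_plus_pow_le p j l : wt (j + l) ^ p <= 2 ^ p * (wt j ^ p * wt l ^ p).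
Proof.
  rewrite <- !Rpow_mult_distr. apply pow_incr. split; [left; apply wt_pos|apply wt_plus_le].
Qed.

(** The weight [wt k ^ p] is moved onto both factors. The two further powers asked of [b] pay for
    the derivative [l] and for summability in [l]. *)
Lemma Qb_term_decay gam M a b p Ca Cb k l :
  (forall j, Rabs (gam j) <= M) ->
  (forall j, Rabs (a j) * wt j ^ p <= Ca) ->
  (forall j, Rabs (b j) * wt j ^ (p + 2) <= Cb) ->
  Rabs (Amat (Gop gam a) k l * (IZR l * b l)) * wt k ^ p <= 2 ^ S p * (M * Ca) * Cb * / wt l.
Proof.
  intros HM Ha Hb. pose proof (gam_bound_nonneg gam M HM) as HM0.
  assert (0 <= Ca).
  { pose proof (decay_abs _ _ _ _ (Ha 0%Z)). pose proof (Rabs_pos (a 0%Z)). lra. }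
  assert (forall j, 0 <= wt j ^ p) as Hwp by (intros; apply pow_le; left; apply wt_pos).
  set (z := 2 ^ p * (M * Ca) * wt l ^ p).
  assert (forall j, wt k ^ p <= 2 ^ p * (wt j ^ p * wt l ^ p) -> Rabs (Gop gam a j) * wt k ^ p <= z) as HG.
  { intros j Hj. unfold Gop. rewrite Rabs_mult.
    apply Rle_trans with (M * Rabs (a (- j)%Z) * (2 ^ p * (wt j ^ p * wt l ^ p))).
    - apply Rmult_le_compat; auto.
      + apply Rmult_le_pos; apply Rabs_pos.
      + apply Rmult_le_compat_r; [apply Rabs_pos|apply HM].
    - pose proof (Ha (- j)%Z) as Hj2. rewrite wt_opp in Hj2. unfold z.
      replace (M * Rabs (a (- j)%Z) * (2 ^ p * (wt j ^ p * wt l ^ p)))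
        with (2 ^ p * wt l ^ p * M * (Rabs (a (- j)%Z) * wt j ^ p)) by ring.
      replace (2 ^ p * (M * Ca) * wt l ^ p) with (2 ^ p * wt l ^ p * M * Ca) by ring.
      apply Rmult_le_compat_l; [|exact Hj2].
      apply Rmult_le_pos; [apply Rmult_le_pos; [apply pow_le; lra|apply Hwp]|exact HM0]. }
  assert (Rabs (Amat (Gop gam a) k l) * wt k ^ p <= 2 * z) as HA.
  { assert (wt k ^ p <= 2 ^ p * (wt (k - l) ^ p * wt l ^ p)) as H1.
    { replace (wt k) with (wt (k - l + l)) by (f_equal; lia). apply wt_plus_pow_le. }
    assert (wt k ^ p <= 2 ^ p * (wt (k + l) ^ p * wt l ^ p)) as H2.
    { rewrite <- (wt_opp l). replace (wt k) with (wt (k + l + - l)) by (f_equal; lia). apply wt_plus_pow_le. }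
    assert (wt k ^ p <= 2 ^ p * (wt (l - k) ^ p * wt l ^ p)) as H3.
    { replace (wt (l - k)) with (wt (k - l)) by (rewrite <- wt_opp; f_equal; lia). exact H1. }
    assert (wt k ^ p <= 2 ^ p * (wt (- k - l) ^ p * wt l ^ p)) as H4.
    { replace (wt (- k - l)) with (wt (k + l)) by (rewrite <- wt_opp; f_equal; lia). exact H2. }
    apply HG in H1, H2, H3, H4.
    assert (forall x : R, Rabs x * wt k ^ p = Rabs (x * wt k ^ p)) as Hx.
    { intros x. rewrite Rabs_mult, (Rabs_pos_eq (wt k ^ p)); auto. }
    rewrite Hx in H1, H2, H3, H4. rewrite Hx.
    apply Rabs_le_between in H1, H2, H3, H4. apply Rabs_le. unfold Amat.
    set (w := wt k ^ p) in *. lra. }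
  assert (Rabs (IZR l * b l) * wt l ^ p <= Cb * / wt l) as HB.
  { specialize (Hb l). rewrite pow_add in Hb.
    pose proof (Rabs_IZR_le_wt l). pose proof (wt_pos l). pose proof (Rabs_pos (b l)).
    apply Rmult_le_reg_r with (wt l); [lra|].
    rewrite (Rmult_assoc Cb), Rinv_l, Rmult_1_r by lra.
    eapply Rle_trans; [|exact Hb]. rewrite Rabs_mult.
    replace (Rabs (IZR l) * Rabs (b l) * wt l ^ p * wt l)
      with (Rabs (b l) * wt l ^ p * wt l * Rabs (IZR l)) by ring.
    replace (Rabs (b l) * (wt l ^ p * wt l ^ 2)) with (Rabs (b l) * wt l ^ p * wt l * wt l) by ring.
    apply Rmult_le_compat_l; [|assumption].
    repeat apply Rmult_le_pos; auto; lra. }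
  rewrite Rabs_mult.
  replace (Rabs (Amat (Gop gam a) k l) * Rabs (IZR l * b l) * wt k ^ p)
    with (Rabs (Amat (Gop gam a) k l) * wt k ^ p * Rabs (IZR l * b l)) by ring.
  apply Rle_trans with (2 * z * Rabs (IZR l * b l)).
  { apply Rmult_le_compat_r; [apply Rabs_pos|exact HA]. }
  unfold z. simpl.
  replace (2 * (2 ^ p * (M * Ca) * wt l ^ p) * Rabs (IZR l * b l))
    with (2 * 2 ^ p * (M * Ca) * (Rabs (IZR l * b l) * wt l ^ p)) by ring.
  rewrite (Rmult_assoc _ Cb).
  apply Rmult_le_compat_l; [|exact HB].
  apply Rmult_le_pos; [|apply Rmult_le_pos; assumption].
  apply Rmult_le_pos; [lra|apply pow_le; lra].
Qed.

Lemma Qb_decay gam M a b p Ca Cb k :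
  (forall j, Rabs (gam j) <= M) ->
  (forall j, Rabs (a j) * wt j ^ p <= Ca) ->
  (forall j, Rabs (b j) * wt j ^ (p + 2) <= Cb) ->
  Rabs (Qb gam a b k) * wt k ^ p <= 5 * (2 ^ S p * (M * Ca) * Cb).
Proof.
  intros HM Ha Hb. unfold Qb. rewrite Rabs_Ropp.
  assert (0 <= wt k ^ p) as Hw by (apply pow_le; left; apply wt_pos).
  rewrite <- (Rabs_pos_eq (wt k ^ p)) by exact Hw.
  rewrite <- Rabs_mult, Rmult_comm.
  rewrite <- (zser_scal _ _ (2 * (M * Ca) * Cb)).
  - apply zser_bound. intros l. rewrite Rabs_mult, (Rabs_pos_eq (wt k ^ p)), Rmult_comm by exact Hw.
    apply Qb_term_decay; assumption.
  - apply Qb_summable; auto.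
    + intros j. eapply decay_abs, Ha.
    + intros j. apply (decay_weaken _ _ 2 (p + 2)); [lia|apply Hb].
Qed.

(** * Families differentiable in time with uniform rapid decay *)

Definition decayT (T : R) (f : R -> Z -> R) : Prop :=
  forall p, exists C, forall t k, 0 < t < T -> Rabs (f t k) * wt k ^ p <= C.

(** [m] time derivatives, each rapidly decreasing uniformly in time. The derivative is given
    existentially, coordinate by coordinate, so closure under sums and under [Qb] is a plain
    induction on [m]. *)
Fixpoint Sm (m : nat) (T : R) (f : R -> Z -> R) : Prop :=
  decayT T f /\
  match m with
  | O => forall k t, 0 < t < T -> continuous (fun t => f t k) t
  | S m => exists f', (forall k t, 0 < t < T -> is_derive (fun t => f t k) t (f' t k)) /\ Sm m T f'
  end.

Lemma Sm_decay m T f : Sm m T f -> decayT T f.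
Proof. destruct m; intros [H _]; exact H. Qed.

Lemma Sm_cont m T f : Sm m T f -> forall k t, 0 < t < T -> continuous (fun t => f t k) t.
Proof.
  destruct m; intros [_ H]; [exact H|]. destruct H as [f' [H _]].
  intros k t Ht. eapply is_derive_cont, H, Ht.
Qed.

Lemma Sm_pred m T f : Sm (S m) T f -> Sm m T f.
Proof.
  revert f. induction m as [|m IH]; intros f H.
  - split; [apply (Sm_decay _ _ _ H)|apply (Sm_cont _ _ _ H)].
  - destruct H as [Hd [f' [Hf' HS]]]. split; [exact Hd|]. exists f'. split; [exact Hf'|].
    apply IH, HS.
Qed.

Lemma decayT_plus T f g : decayT T f -> decayT T g -> decayT T (fun t k => f t k + g t k).
Proof.
  intros Hf Hg p. destruct (Hf p) as [C HC]. destruct (Hg p) as [D HD].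
  exists (C + D). intros t k Ht. pose proof (HC t k Ht). pose proof (HD t k Ht).
  assert (0 <= wt k ^ p) by (apply pow_le; left; apply wt_pos).
  pose proof (Rabs_triang (f t k) (g t k)). nra.
Qed.

Lemma Sm_plus m T f g : Sm m T f -> Sm m T g -> Sm m T (fun t k => f t k + g t k).
Proof.
  revert f g. induction m as [|m IH]; intros f g Hf Hg.
  - split; [apply decayT_plus; [apply Hf|apply Hg]|].
    intros k t Ht. apply continuous_Rplus; [apply Hf|apply Hg]; exact Ht.
  - destruct Hf as [Df [f' [Hf' HSf]]]. destruct Hg as [Dg [g' [Hg' HSg]]].
    split; [apply decayT_plus; assumption|].
    exists (fun t k => f' t k + g' t k). split; [|apply IH; assumption].
    intros k t Ht. apply (is_derive_plus (fun t => f t k) (fun t => g t k)); auto.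
Qed.

Lemma strip_ball T t : 0 < t < T ->
  exists r : posreal, forall y, Rabs (y - t) < r -> 0 < y < T.
Proof.
  intros Ht. assert (0 < Rmin t (T - t)) as Hr by (apply Rmin_pos; lra).
  exists (mkposreal _ Hr). intros y Hy. simpl in Hy.
  pose proof (Rmin_l t (T - t)). pose proof (Rmin_r t (T - t)).
  apply Rabs_lt_between in Hy. lra.
Qed.

Lemma strip_locally T t : 0 < t < T -> locally t (fun y => 0 < y < T).
Proof. intros Ht. destruct (strip_ball T t Ht) as [r Hr]. exists r. exact Hr. Qed.

Lemma decayT_ext T f g :
  (forall t k, 0 < t < T -> f t k = g t k) -> decayT T f -> decayT T g.
Proof.
  intros H Hf p. destruct (Hf p) as [C HC]. exists C. intros t k Ht. rewrite <- H by exact Ht. auto.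
Qed.

Lemma Sm_ext m T f g :
  (forall t k, 0 < t < T -> f t k = g t k) -> Sm m T f -> Sm m T g.
Proof.
  intros H Hf.
  assert (forall t k, 0 < t < T -> locally t (fun t => f t k = g t k)) as Hloc.
  { intros t k Ht. eapply filter_imp; [|apply (strip_locally T t Ht)]. intros; apply H; assumption. }
  destruct m as [|m]; (split; [apply (decayT_ext T f); [exact H|apply Hf]|]).
  - intros k t Ht. apply continuous_ext_loc with (fun t => f t k); [apply Hloc, Ht|apply Hf, Ht].
  - destruct Hf as [_ [f' [Hf' HS]]]. exists f'. split; [|exact HS]. intros k t Ht.
    apply is_derive_ext_loc with (fun t => f t k); [apply Hloc, Ht|apply Hf', Ht].
Qed.

Lemma continuous_Amat gam (a : R -> Z -> R) k l t :
  (forall j, continuous (fun t => a t j) t) -> continuous (fun t => Amat (Gop gam (a t)) k l) t.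
Proof.
  intros Ha.
  assert (forall j, continuous (fun t => Gop gam (a t) j) t) as HG.
  { intros j. apply continuous_Rmult; [apply continuous_const|apply Ha]. }
  unfold Amat. apply continuous_Rmult; [|apply continuous_const].
  apply continuous_Rplus; [apply continuous_Rplus; [apply continuous_Rminus|]|]; apply HG.
Qed.

Lemma is_derive_Amat gam (a : R -> Z -> R) (a' : Z -> R) k l t :
  (forall j, is_derive (fun t => a t j) t (a' j)) ->
  is_derive (fun t => Amat (Gop gam (a t)) k l) t (Amat (Gop gam a') k l).
Proof.
  intros Ha.
  assert (forall j, is_derive (fun t => Gop gam (a t) j) t (Gop gam a' j)) as HG.
  { intros j. apply is_derive_scal, Ha. }
  unfold Amat, Rdiv.
  apply (is_derive_scal_l (fun t => Gop gam (a t) (k - l) - Gop gam (a t) (l - k) + Gop gam (a t) (k + l)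
    + Gop gam (a t) (- k - l)) t _ (/ 2)).
  apply (is_derive_plus (fun t => Gop gam (a t) (k - l) - Gop gam (a t) (l - k) + Gop gam (a t) (k + l))
    (fun t => Gop gam (a t) (- k - l))); [|apply HG].
  apply (is_derive_plus (fun t => Gop gam (a t) (k - l) - Gop gam (a t) (l - k))
    (fun t => Gop gam (a t) (k + l))); [|apply HG].
  apply (is_derive_minus (fun t => Gop gam (a t) (k - l)) (fun t => Gop gam (a t) (l - k))); apply HG.
Qed.

Section TimeRegularity.

Variables (gam : Z -> R) (M T : R).
Hypothesis HM : forall j, Rabs (gam j) <= M.

Lemma decayT_Qb a b : decayT T a -> decayT T b -> decayT T (fun t => Qb gam (a t) (b t)).
Proof.
  intros Ha Hb p. destruct (Ha p) as [Ca HCa]. destruct (Hb (p + 2)%nat) as [Cb HCb].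
  exists (5 * (2 ^ S p * (M * Ca) * Cb)). intros t k Ht. apply Qb_decay; auto.
Qed.

Lemma decayT_Qb_summable a b :
  decayT T a -> decayT T b ->
  exists C, forall t k, 0 < t < T ->
    summable (fun l => Amat (Gop gam (a t)) k l * (IZR l * b t l)) C.
Proof.
  intros Ha Hb. destruct (Ha 0%nat) as [Ca HCa]. destruct (Hb 2%nat) as [Cb HCb].
  exists (2 * (M * Ca) * Cb). intros t k Ht. apply Qb_summable; auto.
  intros j. eapply decay_abs, HCa, Ht.
Qed.

Lemma continuous_Qb a b k t :
  decayT T a -> decayT T b ->
  (forall k t, 0 < t < T -> continuous (fun t => a t k) t) ->
  (forall k t, 0 < t < T -> continuous (fun t => b t k) t) ->
  0 < t < T -> continuous (fun t => Qb gam (a t) (b t) k) t.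
Proof.
  intros Ha Hb Hca Hcb Ht.
  destruct (decayT_Qb_summable a b Ha Hb) as [C HC].
  destruct (strip_ball T t Ht) as [r Hr].
  unfold Qb. apply (@continuous_opp R_UniformSpace R_AbsRing R_NormedModule).
  apply (zser_continuous (fun l t => Amat (Gop gam (a t)) k l * (IZR l * b t l)) C t r).
  - intros y Hy. apply HC, Hr, Hy.
  - intros l y Hy. apply continuous_Rmult.
    + apply continuous_Amat. intros j. apply Hca, Hr, Hy.
    + apply continuous_Rmult; [apply continuous_const|]. apply Hcb, Hr, Hy.
Qed.

Lemma is_derive_Qb a b a' b' k t :
  decayT T a -> decayT T b -> decayT T a' -> decayT T b' ->
  (forall k t, 0 < t < T -> is_derive (fun t => a t k) t (a' t k)) ->
  (forall k t, 0 < t < T -> is_derive (fun t => b t k) t (b' t k)) ->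
  (forall k t, 0 < t < T -> continuous (fun t => a' t k) t) ->
  (forall k t, 0 < t < T -> continuous (fun t => b' t k) t) ->
  0 < t < T ->
  is_derive (fun t => Qb gam (a t) (b t) k) t (Qb gam (a' t) (b t) k + Qb gam (a t) (b' t) k).
Proof.
  intros Ha Hb Ha' Hb' Hda Hdb Hca Hcb Ht.
  destruct (decayT_Qb_summable a b Ha Hb) as [C HC].
  destruct (decayT_Qb_summable a' b Ha' Hb) as [C1 HC1].
  destruct (decayT_Qb_summable a b' Ha Hb') as [C2 HC2].
  destruct (strip_ball T t Ht) as [r Hr].
  unfold Qb at 2 3. rewrite <- Ropp_plus_distr.
  rewrite <- (zser_plus _ _ C1 C2) by auto.
  unfold Qb. apply (@is_derive_opp R_AbsRing R_NormedModule).
  apply (is_derive_zser (fun l t => Amat (Gop gam (a t)) k l * (IZR l * b t l))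
    (fun l t => Amat (Gop gam (a' t)) k l * (IZR l * b t l) + Amat (Gop gam (a t)) k l * (IZR l * b' t l))
    C (C1 + C2) t r).
  - intros y Hy. apply HC, Hr, Hy.
  - intros y Hy l. eapply Rle_trans; [apply Rabs_triang|]. rewrite Rmult_plus_distr_r.
    apply Rplus_le_compat; [apply HC1|apply HC2]; apply Hr, Hy.
  - intros l y Hy.
    apply (is_derive_mult (fun t => Amat (Gop gam (a t)) k l) (fun t => IZR l * b t l)).
    + apply is_derive_Amat. intros j. apply Hda, Hr, Hy.
    + apply is_derive_scal. apply Hdb, Hr, Hy.
    + intros; apply Rmult_comm.
  - intros l y Hy. apply continuous_Rplus; apply continuous_Rmult.
    + apply continuous_Amat. intros j. apply Hca, Hr, Hy.
    + apply continuous_Rmult; [apply continuous_const|]. eapply is_derive_cont, Hdb, Hr, Hy.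
    + apply continuous_Amat. intros j. eapply is_derive_cont, Hda, Hr, Hy.
    + apply continuous_Rmult; [apply continuous_const|]. apply Hcb, Hr, Hy.
Qed.

Lemma Sm_Qb m a b : Sm m T a -> Sm m T b -> Sm m T (fun t => Qb gam (a t) (b t)).
Proof.
  revert a b. induction m as [|m IH]; intros a b Ha Hb.
  - split; [apply decayT_Qb; [apply Ha|apply Hb]|].
    intros k t Ht. apply continuous_Qb; try apply Ha; try apply Hb; exact Ht.
  - pose proof (Sm_pred m T a Ha) as Ha0. pose proof (Sm_pred m T b Hb) as Hb0.
    destruct Ha as [Da [a' [Hda HSa]]]. destruct Hb as [Db [b' [Hdb HSb]]].
    split; [apply decayT_Qb; assumption|].
    exists (fun t k => Qb gam (a' t) (b t) k + Qb gam (a t) (b' t) k). split.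
    + intros k t Ht. apply is_derive_Qb; auto; try (eapply Sm_decay; eassumption); try (eapply Sm_cont; eassumption).
    + apply (Sm_plus m T (fun t => Qb gam (a' t) (b t)) (fun t => Qb gam (a t) (b' t))); apply IH; assumption.
Qed.

(** Bootstrap: the time derivative [Qb h h] has as many derivatives as [h], so the system grants [h]
    one more. *)
Lemma Sm_solution h m :
  decayT T h ->
  (forall k t, 0 < t < T -> is_derive (fun t => h t k) t (Qinf gam (h t) k)) ->
  Sm m T h.
Proof.
  intros Hd Hh. induction m as [|m IH].
  - split; [exact Hd|]. intros k t Ht. eapply is_derive_cont, Hh, Ht.
  - split; [exact Hd|]. exists (fun t => Qb gam (h t) (h t)). split; [exact Hh|].
    apply Sm_Qb; exact IH.
Qed.

End TimeRegularity.

Definition Sinf (T : R) (f : R -> Z -> R) : Prop := forall m, Sm m T f.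

Definition Dtime (f : R -> Z -> R) (t : R) (k : Z) : R := Derive (fun t => f t k) t.

Lemma Sinf_derive T f k t : Sinf T f -> 0 < t < T -> is_derive (fun t => f t k) t (Dtime f t k).
Proof.
  intros H Ht. destruct (H 1%nat) as [_ [f' [Hf' _]]]. apply Derive_correct.
  eexists. apply Hf', Ht.
Qed.

Lemma Sinf_Dtime T f : Sinf T f -> Sinf T (Dtime f).
Proof.
  intros H m. destruct (H (S m)) as [_ [f' [Hf' HS]]].
  apply (Sm_ext m T f'); [|exact HS]. intros t k Ht. symmetry. apply is_derive_unique, Hf', Ht.
Qed.

(** * Smoothness of the series *)

(** The [n]-th [x]-derivative of the series with coefficients [u]:
    differentiating [cas] shifts its argument by a quarter period. *)
Definition Sx (n : nat) (u : Z -> R) (x : R) : R :=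
  zser (fun k => u k * (IZR k ^ n * cas (IZR k * x + INR n * (PI / 2)))).

Lemma Sx_summable n u C x :
  (forall k, Rabs (u k) * wt k ^ S n <= C) ->
  summable (fun k => u k * (IZR k ^ n * cas (IZR k * x + INR n * (PI / 2)))) (C * 2).
Proof.
  intros H k. pose proof (H k) as Hk. simpl in Hk. pose proof (wt_pos k) as Hw.
  apply decay_div. rewrite !Rabs_mult, <- RPow_abs.
  pose proof (cas_bound (IZR k * x + INR n * (PI / 2))) as Hc.
  assert (Rabs (IZR k) ^ n <= wt k ^ n) as Hp.
  { apply pow_incr. split; [apply Rabs_pos|apply Rabs_IZR_le_wt]. }
  assert (0 <= Rabs (IZR k) ^ n) by (apply pow_le, Rabs_pos).
  apply Rle_trans with (Rabs (u k) * (wt k ^ n * 2) * wt k).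
  - apply Rmult_le_compat_r; [lra|]. apply Rmult_le_compat_l; [apply Rabs_pos|].
    apply Rmult_le_compat; auto using Rabs_pos.
  - lra.
Qed.

Lemma Sx_bound n u C x :
  (forall k, Rabs (u k) * wt k ^ S n <= C) -> Rabs (Sx n u x) <= 5 * (C * 2).
Proof. intros H. apply zser_bound, Sx_summable, H. Qed.

Lemma Sx_derive n u x : rapid u -> is_derive (Sx n u) x (Sx (S n) u x).
Proof.
  intros Hu. destruct (Hu (S n)) as [C HC]. destruct (Hu (S (S n))) as [C' HC'].
  apply (is_derive_zser (fun k x => u k * (IZR k ^ n * cas (IZR k * x + INR n * (PI / 2))))
    (fun k x => u k * (IZR k ^ S n * cas (IZR k * x + INR (S n) * (PI / 2)))) (C * 2) (C' * 2) x (mkposreal 1 Rlt_0_1)).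
  - intros y _. apply Sx_summable, HC.
  - intros y _. apply Sx_summable, HC'.
  - intros k y _. apply is_derive_scal.
    replace (IZR k ^ S n * cas (IZR k * y + INR (S n) * (PI / 2)))
      with (IZR k ^ n * (IZR k * cas (IZR k * y + (INR n * (PI / 2) + PI / 2)))).
    + apply is_derive_scal, is_derive_cas.
    + rewrite S_INR. simpl. replace ((INR n + 1) * (PI / 2)) with (INR n * (PI / 2) + PI / 2) by ring. ring.
  - intros k y _. apply continuous_Rmult; [apply continuous_const|].
    apply continuous_Rmult; [apply continuous_const|apply continuous_cas].
Qed.

Lemma Sx_continuous n u x : rapid u -> continuous (Sx n u) x.
Proof. intros Hu. eapply is_derive_cont, Sx_derive, Hu. Qed.

Lemma Sx_Derive_n n u x : rapid u -> Derive_n (Sx 0 u) n x = Sx n u x.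
Proof.
  intros Hu. revert x. induction n as [|n IH]; intros x; [reflexivity|].
  simpl. rewrite (Derive_ext _ (Sx n u)) by exact IH. apply is_derive_unique, Sx_derive, Hu.
Qed.

Lemma Sx_0 u x : Sx 0 u x = zser (fun k => u k * cas (IZR k * x)).
Proof.
  apply zser_ext. intros k. rewrite pow_O, Rmult_1_l. do 2 f_equal. simpl. ring.
Qed.

Lemma Sx_1 u x : Sx 1 u x = zser (fun k => IZR k * u k * cas (- (IZR k * x))).
Proof.
  apply zser_ext. intros k. unfold cas. simpl INR.
  replace (IZR k * x + 1 * (PI / 2)) with (PI / 2 + IZR k * x) by ring.
  rewrite cos_plus, sin_plus, cos_PI2, sin_PI2, cos_neg, sin_neg. ring.
Qed.

Lemma Sx_0_period u x : Sx 0 u (x + 2 * PI) = Sx 0 u x.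
Proof. rewrite !Sx_0. apply zser_ext. intros k. rewrite cas_period. reflexivity. Qed.

Lemma Sx_period n u x : rapid u -> Sx n u (x + 2 * PI) = Sx n u x.
Proof.
  intros Hu. revert x. induction n as [|n IH]; intros x; [apply Sx_0_period|].
  rewrite <- (is_derive_unique _ _ _ (Sx_derive n u (x + 2 * PI) Hu)).
  symmetry. rewrite <- (is_derive_unique _ _ _ (Sx_derive n u x Hu)).
  symmetry. rewrite <- (Derive_ext (fun y => Sx n u (y + 2 * PI)) (Sx n u) x IH).
  symmetry. apply is_derive_unique.
  replace (Derive (Sx n u) (x + 2 * PI)) with (1 * Derive (Sx n u) (x + 2 * PI)) by ring.
  apply (is_derive_comp (Sx n u) (fun y => y + 2 * PI)).
  - apply Derive_correct. eexists. apply Sx_derive, Hu.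
  - auto_derive; [trivial|ring].
Qed.

Lemma Cinf_T_Sx u : rapid u -> Cinf_T (Sx 0 u).
Proof.
  intros Hu. split; [intros; apply Sx_0_period|].
  intros n. split.
  - intros x. exists (Sx (S n) u x). apply is_derive_ext with (Sx n u).
    + intros y. symmetry. apply Sx_Derive_n, Hu.
    + apply Sx_derive, Hu.
  - destruct (Hu (S n)) as [C HC]. exists (5 * (C * 2)). intros x. rewrite Sx_Derive_n by exact Hu.
    apply Sx_bound, HC.
Qed.

Lemma decayT_rapid T f t : decayT T f -> 0 < t < T -> rapid (f t).
Proof. intros H Ht p. destruct (H p) as [C HC]. exists C. intros k. apply HC, Ht. Qed.

Lemma Sx_time_derive n T f x t :
  Sinf T f -> 0 < t < T -> is_derive (fun t => Sx n (f t) x) t (Sx n (Dtime f t) x).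
Proof.
  intros Hf Ht.
  pose proof (Sinf_Dtime T f Hf) as Hf'.
  destruct (Sm_decay _ _ _ (Hf 0%nat) (S n)) as [C HC].
  destruct (Sm_decay _ _ _ (Hf' 0%nat) (S n)) as [C' HC'].
  destruct (strip_ball T t Ht) as [r Hr].
  apply (is_derive_zser (fun k t => f t k * (IZR k ^ n * cas (IZR k * x + INR n * (PI / 2))))
    (fun k t => Dtime f t k * (IZR k ^ n * cas (IZR k * x + INR n * (PI / 2)))) (C * 2) (C' * 2) t r).
  - intros y Hy. apply Sx_summable. intros k. apply HC, Hr, Hy.
  - intros y Hy. apply Sx_summable. intros k. apply HC', Hr, Hy.
  - intros k y Hy. 
    apply (is_derive_scal_l (fun t => f t k) y (Dtime f y k) (IZR k ^ n * cas (IZR k * x + INR n * (PI / 2)))).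
    apply (Sinf_derive T); [exact Hf|apply Hr, Hy].
  - intros k y Hy. apply continuous_Rmult; [|apply continuous_const].
    apply (Sm_cont 0 T _ (Hf' 0%nat)), Hr, Hy.
Qed.

(** Both first derivatives are bounded on the open strip. The joint Lipschitz bound yields at once
    the joint continuity and the extension to [t = 0] that [smooth_strip] demands. *)
Lemma Sx_lipschitz n T f :
  Sinf T f -> exists L, 0 <= L /\ forall x t x' t', 0 < t < T -> 0 < t' < T ->
    Rabs (Sx n (f t) x - Sx n (f t') x') <= L * (Rabs (x - x') + Rabs (t - t')).
Proof.
  intros Hf. pose proof (Sinf_Dtime T f Hf) as Hf'.
  pose proof (Sm_decay _ _ _ (Hf 0%nat)) as Hd.
  destruct (Hd (S (S n))) as [C HC].
  destruct (Sm_decay _ _ _ (Hf' 0%nat) (S n)) as [C' HC'].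
  set (L := Rmax 0 (Rmax (5 * (C * 2)) (5 * (C' * 2)))). exists L.
  assert (0 <= L) as HL by apply Rmax_l.
  assert (5 * (C * 2) <= L) as HL1 by (eapply Rle_trans; [apply Rmax_l|apply Rmax_r]).
  assert (5 * (C' * 2) <= L) as HL2 by (eapply Rle_trans; [apply Rmax_r|apply Rmax_r]).
  split; [exact HL|].
  assert (forall t x x', 0 < t < T -> x' <= x -> Rabs (Sx n (f t) x - Sx n (f t) x') <= L * (x - x')) as H1.
  { intros t x x' Ht Hx. pose proof (decayT_rapid T f t Hd Ht) as Hr.
    apply (mvt_Rabs_le (Sx n (f t)) (Sx (S n) (f t))); auto.
    - intros y _. apply Sx_derive, Hr.
    - intros y _. eapply is_derive_continuity_pt, Sx_derive, Hr.
    - intros y _. eapply Rle_trans; [apply (Sx_bound _ _ C)|exact HL1]. intros k. apply HC, Ht. }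
  assert (forall x t t', 0 < t < T -> 0 < t' < T -> t' <= t -> Rabs (Sx n (f t) x - Sx n (f t') x) <= L * (t - t')) as H2.
  { intros x t t' Ht Ht' Htt.
    apply (mvt_Rabs_le (fun t => Sx n (f t) x) (fun t => Sx n (Dtime f t) x)); auto.
    - intros y Hy. apply (Sx_time_derive n T); [exact Hf|lra].
    - intros y Hy. eapply is_derive_continuity_pt, (Sx_time_derive n T); [exact Hf|lra].
    - intros y Hy. eapply Rle_trans; [apply (Sx_bound _ _ C')|exact HL2]. intros k. apply HC'. lra. }
  intros x t x' t' Ht Ht'.
  replace (Sx n (f t) x - Sx n (f t') x') with
    ((Sx n (f t) x - Sx n (f t) x') + (Sx n (f t) x' - Sx n (f t') x')) by ring.
  eapply Rle_trans; [apply Rabs_triang|]. rewrite Rmult_plus_distr_l.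
  apply Rplus_le_compat.
  - destruct (Rle_dec x' x) as [Hx|Hx].
    + rewrite (Rabs_pos_eq (x - x')) by lra. apply H1; assumption.
    + rewrite Rabs_minus_sym, (Rabs_left (x - x')), Ropp_minus_distr by lra. apply H1; [assumption|lra].
  - destruct (Rle_dec t' t) as [Hx|Hx].
    + rewrite (Rabs_pos_eq (t - t')) by lra. apply H2; assumption.
    + rewrite Rabs_minus_sym, (Rabs_left (t - t')), Ropp_minus_distr by lra. apply H2; auto; lra.
Qed.

Lemma lipschitz_strip_continuous (F : R -> R -> R) T L x t :
  0 <= L ->
  (forall x t x' t', 0 < t < T -> 0 < t' < T ->
    Rabs (F x t - F x' t') <= L * (Rabs (x - x') + Rabs (t - t'))) ->
  0 < t < T -> continuous (fun p : R * R => F (fst p) (snd p)) (x, t).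
Proof.
  intros HL HF Ht. apply filterlim_locally. intros eps.
  destruct (strip_ball T t Ht) as [r Hr].
  assert (0 < Rmin r (eps / (2 * L + 1))) as Hd.
  { apply Rmin_pos; [apply cond_pos|]. apply Rdiv_lt_0_compat; [apply cond_pos|lra]. }
  exists (mkposreal _ Hd). intros [y s] [Hy Hs]. simpl in Hy, Hs.
  change (Rabs (y - x) < Rmin r (eps / (2 * L + 1))) in Hy.
  change (Rabs (s - t) < Rmin r (eps / (2 * L + 1))) in Hs.
  change (Rabs (F y s - F x t) < eps).
  pose proof (Rmin_l r (eps / (2 * L + 1))). pose proof (Rmin_r r (eps / (2 * L + 1))).
  eapply Rle_lt_trans; [apply HF; [apply Hr; lra|exact Ht]|].
  set (q := eps / (2 * L + 1)) in *.
  assert (q * (2 * L + 1) = eps) by (unfold q; field; lra).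
  pose proof (Rabs_pos (y - x)). pose proof (cond_pos eps).
  assert (L * (Rabs (y - x) + Rabs (s - t)) <= L * (q + q)) by (apply Rmult_le_compat_l; lra).
  assert (0 < q) by (unfold q; apply Rdiv_lt_0_compat; lra). lra.
Qed.

(** Along the times [tn], chosen inside [(0, T)], the values are Cauchy; the Lipschitz bound passes
    to the limit and controls every approach to the boundary point. *)
Lemma lipschitz_strip_limit (F : R -> R -> R) T L x0 :
  0 < T -> 0 <= L ->
  (forall x t x' t', 0 < t < T -> 0 < t' < T ->
    Rabs (F x t - F x' t') <= L * (Rabs (x - x') + Rabs (t - t'))) ->
  exists l, filterlim (fun p : R * R => F (fst p) (snd p))
    (within (fun p : R * R => 0 < snd p) (locally (x0, 0))) (locally l).
Proof.
  intros HT HL HF.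
  set (tn := fun n => T * / 2 * / (INR n + 1)).
  assert (forall n, 0 < tn n < T) as Htn.
  { intros n. pose proof (inv_INR1_pos n). assert (/ (INR n + 1) <= 1).
    { rewrite <- Rinv_1. apply Rinv_le_contravar; [lra|]. pose proof (pos_INR n); lra. }
    unfold tn. split; [apply Rmult_lt_0_compat; lra|]. nra. }
  assert (ex_finite_lim_seq (fun n => F x0 (tn n))) as [l Hl].
  { apply ex_lim_seq_cauchy_corr. intros eps.
    destruct (inv_INR_small (L * T) eps (cond_pos eps)) as [N HN].
    exists N. intros n m Hn Hm. eapply Rle_lt_trans; [apply HF; apply Htn|].
    rewrite Rminus_diag, Rabs_R0, Rplus_0_l.
    eapply Rle_lt_trans; [|apply (HN N (Nat.le_refl N))].
    unfold Rdiv. rewrite Rmult_assoc. apply Rmult_le_compat_l; [exact HL|].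
    apply le_INR in Hn, Hm.
    assert (forall j, INR N <= INR j -> 0 < tn j <= T * / 2 * / (INR N + 1)) as Hj.
    { intros j Hj. split; [apply Htn|]. unfold tn. apply Rmult_le_compat_l; [lra|].
      pose proof (pos_INR N). apply Rinv_le_contravar; lra. }
    pose proof (Hj n Hn). pose proof (Hj m Hm).
    assert (0 <= T * / (INR N + 1)).
    { apply Rmult_le_pos; [lra|]. left; apply inv_INR1_pos. }
    apply Rabs_le. split; lra. }
  assert (forall x t, 0 < t < T -> Rabs (F x t - l) <= L * (Rabs (x - x0) + t)) as Hxl.
  { intros x t Ht.
    apply (is_lim_seq_le_loc (fun n => Rabs (F x t - F x0 (tn n)))
      (fun n => L * (Rabs (x - x0) + Rabs (t - tn n))) (Finite (Rabs (F x t - l)))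
      (Finite (L * (Rabs (x - x0) + t)))).
    - exists 0%nat. intros n _. apply HF; [exact Ht|apply Htn].
    - apply (is_lim_seq_abs _ (Finite (F x t - l))). apply is_lim_seq_minus'; [apply is_lim_seq_const|exact Hl].
    - apply (is_lim_seq_scal_l _ L (Rabs (x - x0) + t)).
      apply is_lim_seq_plus'; [apply is_lim_seq_const|].
      replace t with (Rabs (t - 0)) at 1 by (rewrite Rminus_0_r; apply Rabs_pos_eq; lra).
      apply (is_lim_seq_abs _ (Finite (t - 0))).
      apply is_lim_seq_minus'; [apply is_lim_seq_const|].
      apply is_lim_seq_of_bound with (T * / 2). intros n. rewrite Rminus_0_r, Rabs_pos_eq by (pose proof (Htn n); lra).
      unfold tn, Rdiv. lra. }
  exists l. apply filterlim_locally. intros eps.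
  set (q := eps / (2 * L + 1)). pose proof (cond_pos eps) as He.
  assert (0 < q) as Hq by (unfold q; apply Rdiv_lt_0_compat; lra).
  assert (q * (2 * L + 1) = eps) by (unfold q; field; lra).
  assert (0 < Rmin T q) as Hd by (apply Rmin_pos; lra).
  exists (mkposreal _ Hd). intros [y s] [Hy Hs] Hs0. simpl in Hy, Hs, Hs0.
  change (Rabs (y - x0) < Rmin T q) in Hy.
  change (Rabs (s - 0) < Rmin T q) in Hs. rewrite Rminus_0_r, Rabs_pos_eq in Hs by lra.
  change (Rabs (F y s - l) < eps).
  pose proof (Rmin_l T q). pose proof (Rmin_r T q).
  eapply Rle_lt_trans; [apply Hxl; lra|].
  pose proof (Rabs_pos (y - x0)).
  assert (L * (Rabs (y - x0) + s) <= L * (q + q)) by (apply Rmult_le_compat_l; lra). lra.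
Qed.

(** Space derivatives act on the [cas] factor of a term and time derivatives on its coefficient, so
    a word in [Dx] and [Dt] is determined by its number of [Dx] and by the coefficients that its
    [Dt] produce. *)
Fixpoint nDx (l : list dir) : nat :=
  match l with nil => 0 | cons Defs.Dx l => S (nDx l) | cons Defs.Dt l => nDx l end.

Fixpoint iterDt (l : list dir) (f : R -> Z -> R) : R -> Z -> R :=
  match l with nil => f | cons Defs.Dx l => iterDt l f | cons Defs.Dt l => Dtime (iterDt l f) end.

Lemma Sinf_iterDt T l f : Sinf T f -> Sinf T (iterDt l f).
Proof. intros Hf. induction l as [|[] l IH]; simpl; auto using Sinf_Dtime. Qed.

Lemma iterD_Sx T f rho l x t :
  Sinf T f -> (forall x t, 0 < t < T -> rho x t = Sx 0 (f t) x) -> 0 < t < T ->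
  iterD l rho x t = Sx (nDx l) (iterDt l f t) x.
Proof.
  intros Hf Hrho. revert x t. induction l as [|d l IH]; intros x t Ht; [apply Hrho, Ht|].
  pose proof (Sinf_iterDt T l f Hf) as Hl.
  destruct d; simpl.
  - rewrite (Derive_ext _ (Sx (nDx l) (iterDt l f t))) by (intros; apply IH, Ht).
    apply is_derive_unique, Sx_derive. apply (decayT_rapid T); [apply (Sm_decay _ _ _ (Hl 0%nat))|exact Ht].
  - rewrite (Derive_ext_loc _ (fun s => Sx (nDx l) (iterDt l f s) x)).
    + apply is_derive_unique, (Sx_time_derive _ T); assumption.
    + eapply filter_imp; [|apply (strip_locally T t Ht)]. intros s Hs. apply IH, Hs.
Qed.

Lemma smooth_strip_Sx T f rho :
  0 < T -> Sinf T f -> (forall x t, 0 < t < T -> rho x t = Sx 0 (f t) x) -> smooth_strip T rho.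
Proof.
  intros HT Hf Hrho l.
  pose proof (fun x t => iterD_Sx T f rho l x t Hf Hrho) as HD.
  pose proof (Sinf_iterDt T l f Hf) as Hl.
  set (n := nDx l) in *. set (q := iterDt l f) in *.
  destruct (Sx_lipschitz n T q Hl) as (L & HL & Hlip).
  split.
  - intros x t Ht. repeat split.
    + exists (Sx (S n) (q t) x). apply is_derive_ext with (Sx n (q t)).
      * intros y. symmetry. apply HD, Ht.
      * apply Sx_derive, (decayT_rapid T); [apply (Sm_decay _ _ _ (Hl 0%nat))|exact Ht].
    + exists (Sx n (Dtime q t) x). apply is_derive_ext_loc with (fun s => Sx n (q s) x).
      * eapply filter_imp; [|apply (strip_locally T t Ht)]. intros s Hs. symmetry. apply HD, Hs.
      * apply (Sx_time_derive n T); assumption.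
    + apply continuous_ext_loc with (fun p : R * R => Sx n (q (snd p)) (fst p)).
      * destruct (strip_locally T t Ht) as [r Hr]. exists r. intros [y s] [_ Hs]. simpl.
        symmetry. apply HD, Hr, Hs.
      * apply (lipschitz_strip_continuous (fun x t => Sx n (q t) x) T L); assumption.
  - intros x0.
    destruct (lipschitz_strip_limit (fun x t => Sx n (q t) x) T L x0 HT HL Hlip) as [lim Hlim].
    exists lim. eapply filterlim_ext_loc; [|exact Hlim].
    exists (mkposreal T HT). intros [y s] [_ Hs] Hs0. simpl in *.
    change (Rabs (s - 0) < T) in Hs. rewrite Rminus_0_r, Rabs_pos_eq in Hs by lra.
    symmetry. apply HD. lra.
Qed.

(** * The transport equation *)

Lemma rapid_summable u : rapid u -> exists C, summable u C.
Proof.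
  intros Hu. destruct (Hu 1%nat) as [C HC]. exists C. intros k. apply decay_div.
  specialize (HC k). rewrite pow_1 in HC. exact HC.
Qed.

Lemma rapid_Gop gam M h : (forall j, Rabs (gam j) <= M) -> rapid h -> rapid (Gop gam h).
Proof.
  intros HM Hh p. pose proof (gam_bound_nonneg gam M HM). destruct (Hh p) as [C HC].
  exists (M * C). intros k. unfold Gop. rewrite Rabs_mult, Rmult_assoc.
  specialize (HC (- k)%Z). rewrite wt_opp in HC.
  apply Rmult_le_compat; auto using Rabs_pos.
  apply Rmult_le_pos; [apply Rabs_pos|]. apply pow_le. left; apply wt_pos.
Qed.

Lemma rapid_Qinf gam M h : (forall j, Rabs (gam j) <= M) -> rapid h -> rapid (Qinf gam h).
Proof.
  intros HM Hh p. destruct (Hh p) as [Ca HCa]. destruct (Hh (p + 2)%nat) as [Cb HCb].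
  eexists. intros k. apply (Qb_decay gam M h h p Ca Cb k HM HCa HCb).
Qed.

Lemma fc_Sx u k : rapid u -> fc (Sx 0 u) k = u k.
Proof.
  intros Hu. destruct (rapid_summable u Hu) as [C HC].
  rewrite <- (fc_zser u C k HC). apply fc_ext. intros x _. apply Sx_0.
Qed.

Lemma fc_transport gam M h k :
  (forall j, Rabs (gam j) <= M) -> rapid h ->
  fc (fun x => Sx 0 (Gop gam h) x * Sx 1 h x) k = - Qinf gam h k.
Proof.
  intros HM Hh. pose proof (rapid_Gop gam M h HM Hh) as HG.
  destruct (HG 1%nat) as [B HB]. destruct (Hh 2%nat) as [C HC].
  assert (summable (fun l => IZR l * h l) C) as HV.
  { intros l. apply (decay_lip1_term _ _ _ 2); auto. }
  rewrite (fc_ext _ (fun x => Sx 0 (Gop gam h) x * zser (fun l => IZR l * h l * cas (- (IZR l * x)))))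
    by (intros; rewrite Sx_1; reflexivity).
  rewrite (fc_mult_zser _ _ C (5 * (B * 2))).
  - unfold Qinf, Qb. rewrite Ropp_involutive. apply zser_ext. intros l. rewrite Rmult_comm. f_equal.
    apply Amat_ext. intros j. apply fc_Sx, HG.
  - intros x. apply Sx_continuous, HG.
  - intros x. apply Sx_bound, HB.
  - exact HV.
Qed.

Lemma is_derive_Rmult (f g : R -> R) x f' g' :
  is_derive f x f' -> is_derive g x g' -> is_derive (fun x => f x * g x) x (f' * g x + f x * g').
Proof. intros Hf Hg. apply (is_derive_mult f g); auto. intros; apply Rmult_comm. Qed.

Lemma is_derive_Rplus (f g : R -> R) x f' g' :
  is_derive f x f' -> is_derive g x g' -> is_derive (fun x => f x + g x) x (f' + g').
Proof. intros Hf Hg. apply (is_derive_plus f g); auto. Qed.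

(** All Hartley coefficients of the left-hand side vanish. *)
Lemma transport_equation gam M h x :
  (forall j, Rabs (gam j) <= M) -> rapid h ->
  Sx 0 (Qinf gam h) x + Sx 0 (Gop gam h) x * Sx 1 h x = 0.
Proof.
  intros HM Hh. pose proof (rapid_Gop gam M h HM Hh) as HG.
  pose proof (rapid_Qinf gam M h HM Hh) as HQ.
  set (q := Qinf gam h) in *. set (U := Gop gam h) in *.
  set (f := fun x => Sx 0 q x + Sx 0 U x * Sx 1 h x).
  set (f' := fun x => Sx 1 q x + (Sx 1 U x * Sx 1 h x + Sx 0 U x * Sx 2 h x)).
  set (f'' := fun x => Sx 2 q x + ((Sx 2 U x * Sx 1 h x + Sx 1 U x * Sx 2 h x)
     + (Sx 1 U x * Sx 2 h x + Sx 0 U x * Sx 3 h x))).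
  assert (forall n u, rapid u -> exists C, forall x, Rabs (Sx n u x) <= C) as Hb.
  { intros n u Hu. destruct (Hu (S n)) as [C HC]. eexists. intros y. apply Sx_bound, HC. }
  destruct (Hb 2%nat q HQ) as [C1 H1]. destruct (Hb 0%nat U HG) as [C2 H2].
  destruct (Hb 1%nat U HG) as [C3 H3]. destruct (Hb 2%nat U HG) as [C4 H4].
  destruct (Hb 1%nat h Hh) as [C5 H5]. destruct (Hb 2%nat h Hh) as [C6 H6]. destruct (Hb 3%nat h Hh) as [C7 H7].
  assert (is_lim_seq (fun N => zsum N (fun k => fc f k * cas (IZR k * x))) (f x)) as Hlim.
  { apply (fourier_inversion f f' f'' (C1 + ((C4 * C5 + C3 * C6) + (C3 * C6 + C2 * C7)))).
    - intros y. apply is_derive_Rplus; [|apply is_derive_Rmult]; apply Sx_derive; assumption.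
    - intros y. apply is_derive_Rplus; [|apply is_derive_Rplus; apply is_derive_Rmult];
        apply Sx_derive; assumption.
    - intros y. unfold f''.
      assert (forall u v C D : R, Rabs u <= C -> Rabs v <= D -> Rabs (u + v) <= C + D) as Hp.
      { intros u v C D Hu Hv. eapply Rle_trans; [apply Rabs_triang|]. lra. }
      assert (forall u v C D : R, Rabs u <= C -> Rabs v <= D -> Rabs (u * v) <= C * D) as Hm.
      { intros u v C D Hu Hv. rewrite Rabs_mult. apply Rmult_le_compat; auto using Rabs_pos. }
      apply Hp; [apply H1|]. apply Hp; apply Hp; apply Hm; auto.
    - intros y. unfold f. rewrite !Sx_period by assumption. reflexivity. }
  assert (forall k, fc f k = 0) as H0.
  { intros k. unfold f. rewrite (fc_plus (Sx 0 q) (fun x => Sx 0 U x * Sx 1 h x)).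
    - rewrite fc_Sx by exact HQ. pose proof (fc_transport gam M h k HM Hh) as Ht.
      fold U q in Ht. change (q k + fc (fun x : R => Sx 0 U x * Sx 1 h x) k = 0). rewrite Ht. ring.
    - intros y. apply Sx_continuous, HQ.
    - intros y. apply continuous_Rmult; apply Sx_continuous; assumption. }
  assert (is_lim_seq (fun N => zsum N (fun k => fc f k * cas (IZR k * x))) 0) as Hlim0.
  { apply is_lim_seq_ext with (fun _ => 0); [|apply is_lim_seq_const].
    intros N. rewrite <- (zsum_0 N). apply zsum_ext. intros k _. rewrite H0. ring. }
  apply is_lim_seq_unique in Hlim, Hlim0. rewrite Hlim in Hlim0. injection Hlim0. auto.
Qed.

(** The velocity is the sum of [- g mu_k h_k cas (- k x)]; putting [j = - k] moves the reflection
    from the function to the index, in the form required by [Gop]. *)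
Definition gamma (a g : R) (j : Z) : R := - (g * mu a (- j)).

Lemma gamma_bound a g j : 0 < a -> 0 < g -> Rabs (gamma a g j) <= 3 * g.
Proof.
  intros Ha Hg. unfold gamma. rewrite Rabs_Ropp, Rabs_mult, (Rabs_pos_eq g) by lra.
  pose proof (mu_bound a Ha (- j)). nra.
Qed.

Lemma velocity_Sx a g h x :
  0 < a -> rapid h ->
  g * zser (fun k => h k * (- mu a k * cas (- (IZR k * x)))) = Sx 0 (Gop (gamma a g) h) x.
Proof.
  intros Ha Hh. destruct (rapid_summable h Hh) as [C HC].
  rewrite <- (zser_scal _ _ (C * (3 * 2))).
  2:{ apply summable_mult_bounded; [exact HC|]. intros k. rewrite Rabs_mult, Rabs_Ropp.
      apply Rmult_le_compat; auto using Rabs_pos, cas_bound, mu_bound. }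
  rewrite <- zser_reflect, Sx_0. apply zser_ext. intros k. unfold Gop, gamma.
  rewrite opp_IZR. replace (- (- IZR k * x)) with (IZR k * x) by ring. ring.
Qed.

Lemma is_Ha_ext a f f' x v : (forall y, f y = f' y) -> is_Ha a f x v -> is_Ha a f' x v.
Proof.
  intros Hff (I & HI & Hl). exists I. split; [|exact Hl]. intros e He.
  destruct (HI e He) as (I1 & I2 & H1 & H2 & H3). exists I1, I2. split; [|split; [|exact H3]].
  - eapply is_RInt_gen_ext; [|exact H1]. apply filter_forall. intros [u w] y _. rewrite Hff. reflexivity.
  - eapply is_RInt_gen_ext; [|exact H2]. apply filter_forall. intros [u w] y _. rewrite Hff. reflexivity.
Qed.

Lemma is_Ha_Sx a h x :
  0 < a -> rapid h ->
  is_Ha a (Sx 0 h) x (zser (fun k => h k * (- mu a k * cas (- (IZR k * x))))).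
Proof.
  intros Ha Hh. destruct (Hh 2%nat) as [C HC].
  pose proof (is_Ha_zser a Ha h C x HC) as H.
  eapply is_Ha_ext; [|exact H]. intros y. simpl. symmetry. apply Sx_0.
Qed.

(** * Coefficients of smooth periodic functions *)

Lemma Cinf_T_Derive f : Cinf_T f -> Cinf_T (Derive f).
Proof.
  intros [Hp Hs]. split.
  - intros x. destruct (Hs 0%nat) as [Hd _]. simpl in Hd.
    symmetry. rewrite <- (Derive_ext (fun y => f (y + 2 * PI)) f x Hp). apply is_derive_unique.
    replace (Derive f (x + 2 * PI)) with (1 * Derive f (x + 2 * PI)) by ring.
    apply (is_derive_comp f (fun y => y + 2 * PI)).
    + apply Derive_correct, Hd.
    + auto_derive; [trivial|ring].
  - intros n. assert (forall x, Derive_n (Derive f) n x = Derive_n f (S n) x) as Heq.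
    { intros x. change (Derive f) with (Derive_n f 1). rewrite Derive_n_comp. f_equal. lia. }
    destruct (Hs (S n)) as [Hd [M HM]]. split.
    + intros x. apply ex_derive_ext with (Derive_n f (S n)); [intros; symmetry; apply Heq|apply Hd].
    + exists M. intros x. rewrite Heq. apply HM.
Qed.

Lemma Cinf_T_is_derive f x : Cinf_T f -> is_derive f x (Derive f x).
Proof. intros [_ Hs]. apply Derive_correct. apply (proj1 (Hs 0%nat)). Qed.

Lemma Cinf_T_continuous f x : Cinf_T f -> continuous f x.
Proof. intros H. eapply is_derive_cont, Cinf_T_is_derive, H. Qed.

(** [n] integrations by parts; the reflection of the frequency at each one leaves the absolute
    values unchanged. *)
Lemma fc_smooth_bound n f M k :
  Cinf_T f -> (forall x, - PI <= x <= PI -> Rabs (Derive_n f n x) <= M) ->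
  Rabs (IZR k) ^ n * Rabs (fc f k) <= 2 * M.
Proof.
  revert f k. induction n as [|n IH]; intros f k Hf HM.
  - simpl. rewrite Rmult_1_l. apply fc_bound; [intros; apply Cinf_T_continuous, Hf|exact HM].
  - pose proof (Cinf_T_Derive f Hf) as Hf'.
    assert (Rabs (fc (Derive f) (- k)) = Rabs (IZR k) * Rabs (fc f k)) as Heq.
    { rewrite (fc_derive f (Derive f)).
      - rewrite opp_IZR, Ropp_involutive, Z.opp_involutive. apply Rabs_mult.
      - intros x. apply Cinf_T_is_derive, Hf.
      - intros x. apply Cinf_T_continuous, Hf'.
      - apply Hf. }
    replace (Rabs (IZR k) ^ S n * Rabs (fc f k)) with (Rabs (IZR (- k)) ^ n * Rabs (fc (Derive f) (- k))).
    + apply IH; [exact Hf'|]. intros x Hx. change (Derive f) with (Derive_n f 1). rewrite Derive_n_comp.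
      replace (n + 1)%nat with (S n) by lia. apply HM, Hx.
    + rewrite Heq, Rabs_IZR_opp. simpl. ring.
Qed.

(** Bounds are asked for on one period only, which is where compactness supplies them uniformly in
    time for an arbitrary solution. *)
Lemma fc_smooth_decay p f M0 M1 k :
  Cinf_T f -> (forall x, - PI <= x <= PI -> Rabs (f x) <= M0) ->
  (forall x, - PI <= x <= PI -> Rabs (Derive_n f (2 * p) x) <= M1) ->
  Rabs (fc f k) * wt k ^ p <= 2 ^ p * (2 * M0 + 2 * M1).
Proof.
  intros Hf H0 H1.
  pose proof (fc_smooth_bound 0 f M0 k Hf H0) as Hb0. rewrite pow_O, Rmult_1_l in Hb0.
  pose proof (fc_smooth_bound (2 * p) f M1 k Hf H1) as Hb1.
  assert (0 <= IZR k * IZR k) as Hkk by apply Rle_0_sqr.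
  rewrite pow_mult in Hb1.
  replace (Rabs (IZR k) ^ 2) with (IZR k * IZR k) in Hb1
    by (simpl; rewrite Rmult_1_r; apply Rsqr_abs).
  pose proof (pow_plus_bound p 1 (IZR k * IZR k) ltac:(lra) Hkk) as Hp. rewrite pow1 in Hp. fold (wt k) in Hp.
  apply Rle_trans with (Rabs (fc f k) * (2 ^ p * (1 + (IZR k * IZR k) ^ p))).
  { apply Rmult_le_compat_l; [apply Rabs_pos|exact Hp]. }
  replace (Rabs (fc f k) * (2 ^ p * (1 + (IZR k * IZR k) ^ p)))
    with (2 ^ p * (Rabs (fc f k) + (IZR k * IZR k) ^ p * Rabs (fc f k))) by ring.
  apply Rmult_le_compat_l; [apply pow_le; lra|]. lra.
Qed.

Lemma rapid_fc f : Cinf_T f -> rapid (fc f).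
Proof.
  intros Hf p. destruct (proj2 (proj2 Hf 0%nat)) as [M0 HM0].
  destruct (proj2 (proj2 Hf (2 * p)%nat)) as [M1 HM1].
  exists (2 ^ p * (2 * M0 + 2 * M1)). intros k. apply fc_smooth_decay; auto.
Qed.

Lemma Cinf_T_Sx_fc f x : Cinf_T f -> f x = Sx 0 (fc f) x.
Proof.
  intros Hf. rewrite Sx_0. symmetry. apply zser_unique.
  pose proof (Cinf_T_Derive f Hf) as Hf'.
  destruct (proj2 (proj2 Hf 2%nat)) as [M HM].
  apply (fourier_inversion f (Derive f) (Derive (Derive f)) M).
  - intros y. apply Cinf_T_is_derive, Hf.
  - intros y. apply Cinf_T_is_derive, Hf'.
  - exact HM.
  - apply Hf.
Qed.

(** * Coefficients of an arbitrary solution *)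

Lemma Sx_ext n u v x : (forall k, u k = v k) -> Sx n u x = Sx n v x.
Proof. intros H. apply zser_ext. intros k. rewrite H. reflexivity. Qed.

(** Uniform decay makes the tail small for all times at once; the finitely many remaining terms are
    Lipschitz in time. *)
Lemma Sx_right_limit T (h : R -> Z -> R) C L x :
  0 < T ->
  (forall t k, 0 <= t <= T -> Rabs (h t k) * wt k <= C) ->
  (forall k s t, 0 <= s <= T -> 0 <= t <= T -> Rabs (h t k - h s k) <= L * Rabs (t - s)) ->
  filterlim (fun t => Sx 0 (h t) x) (at_right 0) (locally (Sx 0 (h 0) x)).
Proof.
  intros HT HC HL.
  assert (forall t, 0 <= t <= T ->
    summable (fun k => h t k * (IZR k ^ 0 * cas (IZR k * x + INR 0 * (PI / 2)))) (C * 2)) as Hs.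
  { intros t Ht. apply Sx_summable. intros k. rewrite pow_1. apply HC, Ht. }
  assert (0 <= L) as HL0.
  { pose proof (HL 0%Z 0 T ltac:(lra) ltac:(lra)) as H. rewrite Rminus_0_r, (Rabs_pos_eq T) in H by lra.
    pose proof (Rabs_pos (h T 0%Z - h 0 0%Z)). nra. }
  apply filterlim_locally. intros eps. pose proof (cond_pos eps) as He.
  destruct (inv_INR_small (4 * (C * 2)) (eps / 3) ltac:(lra)) as [N HN].
  specialize (HN N (Nat.le_refl N)).
  set (W := (2 * INR N + 1) * (2 * L) + 1). pose proof (pos_INR N) as HNp.
  assert (1 <= W) as HW by (unfold W; nra).
  assert (0 < Rmin T (eps / 3 / W)) as Hd.
  { apply Rmin_pos; [lra|]. apply Rdiv_lt_0_compat; lra. }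
  exists (mkposreal _ Hd). intros t Ht Ht0.
  change (Rabs (t - 0) < Rmin T (eps / 3 / W)) in Ht. rewrite Rminus_0_r, Rabs_pos_eq in Ht by lra.
  pose proof (Rmin_l T (eps / 3 / W)). pose proof (Rmin_r T (eps / 3 / W)).
  change (Rabs (Sx 0 (h t) x - Sx 0 (h 0) x) < eps).
  pose proof (zser_tail N _ _ (Hs t ltac:(lra))) as H1.
  pose proof (zser_tail N _ _ (Hs 0 ltac:(lra))) as H2.
  fold (Sx 0 (h t) x) in H1. fold (Sx 0 (h 0) x) in H2.
  assert (Rabs (zsum N (fun k => h t k * (IZR k ^ 0 * cas (IZR k * x + INR 0 * (PI / 2)))) -
    zsum N (fun k => h 0 k * (IZR k ^ 0 * cas (IZR k * x + INR 0 * (PI / 2))))) <= W * t) as H3.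
  { rewrite <- zsum_minus. eapply Rle_trans; [apply zsum_Rabs|].
    apply Rle_trans with (zsum N (fun _ => 2 * L * t)).
    - apply zsum_le. intros k _. rewrite <- Rmult_minus_distr_r, Rabs_mult.
      rewrite pow_O, Rmult_1_l. pose proof (cas_bound (IZR k * x + INR 0 * (PI / 2))).
      pose proof (HL k 0 t ltac:(lra) ltac:(lra)) as Hk. rewrite Rminus_0_r, (Rabs_pos_eq t) in Hk by lra.
      replace (2 * L * t) with (L * t * 2) by ring. apply Rmult_le_compat; auto using Rabs_pos.
    - rewrite zsum_const. unfold W. nra. }
  assert (W * t < eps / 3).
  { apply Rlt_le_trans with (W * (eps / 3 / W)); [apply Rmult_lt_compat_l; lra|]. right. field. lra. }
  apply Rabs_le_between in H1, H2, H3. apply Rabs_lt_between. lra.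
Qed.

(** Local boundedness, from continuity inside and from the limit at [t = 0], is made uniform by
    compactness of [[- PI, PI]] times [[0, t0]]. No behaviour is prescribed as [t] tends to [T],
    hence [t0 < T]. *)
Lemma strip_bounded (F : R -> R -> R) T t0 :
  0 < t0 < T ->
  (forall x t, 0 < t < T -> continuous (fun p : R * R => F (fst p) (snd p)) (x, t)) ->
  (forall x0, exists l, filterlim (fun p : R * R => F (fst p) (snd p))
     (within (fun p : R * R => 0 < snd p) (locally (x0, 0))) (locally l)) ->
  exists M, forall x t, - PI <= x <= PI -> 0 < t <= t0 -> Rabs (F x t) <= M.
Proof.
  intros Ht0 Hc Hl.
  assert (forall u v, exists d : posreal, 0 <= v <= t0 ->
    forall x t, Rabs (x - u) < d -> Rabs (t - v) < d -> 0 < t -> Rabs (F x t) <= / d) as Hloc.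
  { intros u v. destruct (Rle_dec 0 v) as [Hv0|Hv0]; [|exists (mkposreal 1 Rlt_0_1); intros; exfalso; lra].
    destruct (Rle_dec v t0) as [Hv|Hv]; [|exists (mkposreal 1 Rlt_0_1); intros; exfalso; lra].
    assert (exists l (r : posreal), forall x t, Rabs (x - u) < r -> Rabs (t - v) < r -> 0 < t ->
      Rabs (F x t - l) < 1) as (l & r & Hr).
    { destruct (Req_dec v 0) as [->|Hvn].
      - destruct (Hl u) as [l Hlu]. exists l.
        destruct (proj1 (filterlim_locally _ _) Hlu (mkposreal 1 Rlt_0_1)) as [r Hr].
        exists r. intros x t Hx Ht Htp. apply (Hr (x, t)); [split; assumption|exact Htp].
      - exists (F u v). assert (0 < v < T) as HvT by lra.
        destruct (proj1 (filterlim_locally _ _) (Hc u v HvT) (mkposreal 1 Rlt_0_1)) as [r Hr].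
        exists r. intros x t Hx Ht _. apply (Hr (x, t)). split; assumption. }
    pose proof (Rabs_pos l).
    (* One number serves as the radius of the neighbourhood and, inverted, as a bound for [F] there;
       a positive lower bound on the radii then bounds [F] everywhere. *)
    assert (0 < Rmin r (/ (Rabs l + 1))) as Hd.
    { apply Rmin_pos; [apply cond_pos|]. apply Rinv_0_lt_compat; lra. }
    exists (mkposreal _ Hd). intros _ x t Hx Ht Htp. simpl in *.
    pose proof (Rmin_l r (/ (Rabs l + 1))). pose proof (Rmin_r r (/ (Rabs l + 1))).
    specialize (Hr x t ltac:(lra) ltac:(lra) Htp).
    apply Rle_trans with (Rabs l + 1).
    - pose proof (Rabs_triang (F x t - l) l) as Htr. replace (F x t - l + l) with (F x t) in Htr by ring. lra.
    - rewrite <- (Rinv_inv (Rabs l + 1)) at 1. apply Rinv_le_contravar; lra. }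
  set (delta := fun u v => proj1_sig (constructive_indefinite_description _ (Hloc u v))).
  assert (forall u v, 0 <= v <= t0 -> forall x t, Rabs (x - u) < delta u v -> Rabs (t - v) < delta u v ->
    0 < t -> Rabs (F x t) <= / delta u v) as Hdel.
  { intros u v. unfold delta. destruct constructive_indefinite_description as [d Hd]. exact Hd. }
  destruct (compactness_value_2d (- PI) PI 0 t0 delta) as [d Hd].
  exists (/ d). intros x t Hx Ht.
  (* [compactness_value_2d] delivers the covering point under a double negation. *)
  apply NNPP. intros Hn. apply (Hd x t Hx ltac:(lra)). intros (u & v & Hu & Hv & H1 & H2 & H3).
  apply Hn. eapply Rle_trans; [apply (Hdel u v); auto; lra|].
  apply Rinv_le_contravar; [apply cond_pos|exact H3].
Qed.

Section Uniqueness.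

Variables (a g T : R) (rho0 : R -> R) (sigma : R -> R -> R).
Hypothesis ha : 0 < a.
Hypothesis hg : 0 < g.
Hypothesis Hsol : is_solution a g rho0 T sigma.
Hypothesis h0 : Cinf_T rho0.

Let d (t : R) (k : Z) : R := fc (fun x => sigma x t) k.

Lemma sol_smooth t : 0 <= t < T -> Cinf_T (fun x => sigma x t).
Proof. apply Hsol. Qed.

Lemma sol_coeff_rapid t : 0 < t < T -> rapid (d t).
Proof. intros Ht. apply rapid_fc, sol_smooth. lra. Qed.

Lemma sol_series x t : 0 < t < T -> sigma x t = Sx 0 (d t) x.
Proof. intros Ht. apply (Cinf_T_Sx_fc (fun x => sigma x t)), sol_smooth. lra. Qed.

Lemma sol_time_derivative x t :
  0 < t < T ->
  Derive (fun s => sigma x s) t = - (Sx 0 (Gop (gamma a g) (d t)) x * Sx 1 (d t) x).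
Proof.
  intros Ht. pose proof (sol_coeff_rapid t Ht) as Hr.
  destruct Hsol as (_ & _ & _ & _ & _ & Hpde).
  destruct (Hpde x t Ht) as (v & Hv & Heq).
  assert (is_Ha a (fun y => sigma y t) x (zser (fun k => d t k * (- mu a k * cas (- (IZR k * x)))))) as Hv'.
  { apply is_Ha_ext with (Sx 0 (d t)).
    - intros y. symmetry. apply sol_series, Ht.
    - apply is_Ha_Sx; assumption. }
  rewrite (is_Ha_unique _ _ _ _ _ Hv Hv') in Heq.
  rewrite velocity_Sx in Heq by assumption.
  rewrite (Derive_ext (fun y => sigma y t) (Sx 0 (d t))) in Heq by (intros; apply sol_series, Ht).
  rewrite (is_derive_unique _ _ _ (Sx_derive 0 (d t) x Hr)) in Heq. lra.
Qed.

Lemma sol_coeff_time_derivative k t :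
  0 < t < T -> fc (fun x => Derive (fun s => sigma x s) t) k = Qinf (gamma a g) (d t) k.
Proof.
  intros Ht. pose proof (sol_coeff_rapid t Ht) as Hr.
  pose proof (fun j => gamma_bound a g j ha hg) as HM.
  rewrite (fc_ext _ (fun x => -1 * (Sx 0 (Gop (gamma a g) (d t)) x * Sx 1 (d t) x)))
    by (intros; rewrite sol_time_derivative by exact Ht; ring).
  rewrite (fc_scal (-1) (fun x => Sx 0 (Gop (gamma a g) (d t)) x * Sx 1 (d t) x)).
  - rewrite (fc_transport _ (3 * g)) by assumption. ring.
  - intros x. apply continuous_Rmult; apply Sx_continuous; [|assumption].
    apply (rapid_Gop _ (3 * g)); assumption.
Qed.

Lemma sol_strip_continuity l x t :
  0 < t < T -> continuity_2d_pt (fun u v => iterD l sigma v u) t x.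
Proof.
  intros Ht. destruct Hsol as (Hs & _). destruct (Hs l) as [H _].
  destruct (H x t Ht) as (_ & _ & Hc).
  assert (continuity_2d_pt (iterD l sigma) x t) as Hc2 by (apply continuity_2d_pt_filterlim; exact Hc).
  intros eps. destruct (Hc2 eps) as [r Hr]. exists r. intros u v Hu Hv. apply Hr; assumption.
Qed.

(** Differentiation under the integral sign, justified by the joint continuity of the time
    derivative on the open strip. *)
Lemma sol_coeff_derive k t :
  0 < t < T -> is_derive (fun t => d t k) t (Qinf (gamma a g) (d t) k).
Proof.
  intros Ht. rewrite <- sol_coeff_time_derivative by exact Ht. unfold d, fc.
  apply is_derive_scal.
  rewrite (RInt_ext (fun x => Derive (fun s => sigma x s) t * cas (IZR k * x))
    (fun x => Derive (fun s => sigma x s * cas (IZR k * x)) t))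
    by (intros; symmetry; apply Derive_scal_l).
  destruct Hsol as (Hs & _ & _).
  apply (is_derive_RInt_param (fun s x => sigma x s * cas (IZR k * x))).
  - eapply filter_imp; [|apply (strip_locally T t Ht)]. intros s Hs0 x _.
    destruct (Hs nil) as [H _]. destruct (H x s Hs0) as (_ & [l Hl] & _).
    exists (l * cas (IZR k * x)). apply (is_derive_scal_l (fun s => sigma x s) s l (cas (IZR k * x))). exact Hl.
  - intros x _.
    apply continuity_2d_pt_ext_loc with (fun u v => Derive (fun z => sigma v z) u * cas (IZR k * v)).
    { exists (mkposreal 1 Rlt_0_1). intros u v _ _. symmetry. apply Derive_scal_l. }
    apply continuity_2d_pt_mult.
    + apply (sol_strip_continuity (cons Defs.Dt nil)), Ht.
    + apply (continuity_1d_2d_pt_comp (fun v => cas (IZR k * v)) (fun u v => v)).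
      * apply continuity_pt_filterlim, continuous_cas0.
      * apply continuity_2d_pt_id2.
  - eapply filter_imp; [|apply (strip_locally T t Ht)]. intros s Hs0.
    apply ex_RInt_cont. intros x. apply continuous_Rmult; [|apply continuous_cas0].
    apply (Cinf_T_continuous (fun x => sigma x s)), sol_smooth. lra.
Qed.

Lemma sol_derivative_bound l t0 :
  0 < t0 < T -> exists M, forall x t, - PI <= x <= PI -> 0 < t <= t0 -> Rabs (iterD l sigma x t) <= M.
Proof.
  intros Ht0. destruct Hsol as (Hs & _). destruct (Hs l) as [H1 H2].
  apply (strip_bounded (iterD l sigma) T t0 Ht0).
  - intros x t Ht. apply (H1 x t Ht).
  - exact H2.
Qed.

Lemma iterD_Dx n x t : iterD (repeat Defs.Dx n) sigma x t = Derive_n (fun y => sigma y t) n x.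
Proof.
  revert x. induction n as [|n IH]; intros x; simpl; [reflexivity|]. apply Derive_ext. exact IH.
Qed.

Lemma sol_coeff_decay p t0 :
  0 < t0 < T -> exists C, forall t k, 0 < t <= t0 -> Rabs (d t k) * wt k ^ p <= C.
Proof.
  intros Ht0. destruct (sol_derivative_bound nil t0 Ht0) as [M0 HM0].
  destruct (sol_derivative_bound (repeat Defs.Dx (2 * p)) t0 Ht0) as [M1 HM1].
  exists (2 ^ p * (2 * M0 + 2 * M1)). intros t k Ht. apply fc_smooth_decay.
  - apply sol_smooth. lra.
  - intros x Hx. apply HM0; assumption.
  - intros x Hx. rewrite <- iterD_Dx. apply HM1; assumption.
Qed.

(** [smooth_strip] constrains [sigma] only for [t > 0]; the right-limit clause of [is_solution] ties
    it to the data, and the bound on the time derivative turns the limit into a rate uniform in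
    [x]. *)
Lemma sol_initial_rate t0 :
  0 < t0 < T -> exists M, 0 <= M /\ forall x t, - PI <= x <= PI -> 0 < t <= t0 ->
    Rabs (sigma x t - rho0 x) <= M * t.
Proof.
  intros Ht0. destruct (sol_derivative_bound (cons Defs.Dt nil) t0 Ht0) as [M HM].
  assert (0 <= M) as HM0.
  { pose proof PI_RGT_0. pose proof (HM 0 t0 ltac:(lra) ltac:(lra)) as H1.
    eapply Rle_trans; [apply Rabs_pos|exact H1]. }
  exists M. split; [exact HM0|]. intros x t Hx Ht.
  destruct Hsol as (Hs & _ & _ & _ & Hlim & _).
  apply le_epsilon. intros eps Heps.
  destruct (proj1 (filterlim_locally _ _) (Hlim x) (mkposreal eps Heps)) as [r Hr].
  (* At time [s] the solution is within [eps] of the data; the derivative bound carries the estimate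
     from [s] to [t]. *)
  set (s := Rmin (r / 2) t).
  assert (0 < s <= t) as Hst.
  { pose proof (cond_pos r). unfold s. split; [apply Rmin_pos; lra|apply Rmin_r]. }
  assert (s <= r / 2) by apply Rmin_l. pose proof (cond_pos r).
  assert (Rabs (sigma x s - rho0 x) < eps) as H1.
  { apply (Hr s); [|lra]. change (Rabs (s - 0) < r). rewrite Rminus_0_r, Rabs_pos_eq; lra. }
  assert (Rabs (sigma x t - sigma x s) <= M * (t - s)) as H2.
  { assert (forall u, 0 < u < T -> is_derive (fun u => sigma x u) u (Derive (fun u => sigma x u) u)) as Hd.
    { intros u Hu. apply Derive_correct. destruct (Hs nil) as [H1' _]. apply (H1' x u Hu). }
    apply (mvt_Rabs_le (fun u => sigma x u) (fun u => Derive (fun u => sigma x u) u)); [lra| | |].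
    - intros u Hu. apply Hd; lra.
    - intros u Hu. eapply is_derive_continuity_pt, Hd; lra.
    - intros u Hu. apply (HM x u Hx). lra. }
  pose proof (Rabs_triang (sigma x t - sigma x s) (sigma x s - rho0 x)) as H3.
  replace (sigma x t - sigma x s + (sigma x s - rho0 x)) with (sigma x t - rho0 x) in H3 by ring.
  nra.
Qed.

Lemma sol_coeff_initial t0 k :
  0 < t0 < T -> exists M, 0 <= M /\ forall t, 0 < t <= t0 -> Rabs (d t k - fc rho0 k) <= M * t.
Proof.
  intros Ht0. destruct (sol_initial_rate t0 Ht0) as (M & HM0 & HM).
  exists (2 * M). split; [lra|]. intros t Ht. unfold d.
  assert (forall x, continuous (fun x => sigma x t) x) as Hc
    by (intros x; apply (Cinf_T_continuous (fun x => sigma x t)), sol_smooth; lra).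
  assert (forall x, continuous rho0 x) as Hc0 by (intros; apply Cinf_T_continuous, h0).
  rewrite <- (fc_minus (fun x => sigma x t) rho0) by assumption.
  rewrite Rmult_assoc. apply fc_bound.
  - intros x. apply continuous_Rminus; auto.
  - intros x Hx. apply HM; assumption.
Qed.

End Uniqueness.

Theorem theorem1p1 (a g : R) (ha : 0 < a) (hg : 0 < g) (rho0 : R -> R)
  (h0 : Cinf_T rho0) :
  exists T : R, 0 < T /\
  exists rho : R -> R -> R,
    is_solution a g rho0 T rho /\
    (forall (T' : R) (sigma : R -> R -> R), 0 < T' ->
       is_solution a g rho0 T' sigma ->
       forall x t, 0 <= t < Rmin T T' -> sigma x t = rho x t).
Proof.
  pose proof (fun j => gamma_bound a g j ha hg) as HM.
  destruct (fourier_solution (gamma a g) (3 * g) (fc rho0) HM (rapid_fc rho0 h0))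
    as (T & HT & h & Hh0 & Hdec & Hode & [L HL] & Huniq).
  assert (decayT T h) as HdT.
  { intros p. destruct (Hdec p) as [C HC]. exists C. intros t k Ht. apply HC. lra. }
  assert (Sinf T h) as Hinf by (intros m; apply (Sm_solution (gamma a g) (3 * g)); assumption).
  assert (forall t, 0 <= t <= T -> rapid (h t)) as Hrap.
  { intros t Ht p. destruct (Hdec p) as [C HC]. exists C. intros k. apply HC, Ht. }
  assert (forall x, Sx 0 (h 0) x = rho0 x) as Hinit.
  { intros x. rewrite (Cinf_T_Sx_fc rho0 x h0). apply Sx_ext, Hh0. }
  exists T. split; [exact HT|]. exists (fun x t => Sx 0 (h t) x). split.
  - split; [|split; [|split; [|split; [|split]]]].
    + apply (smooth_strip_Sx T h); auto.
    + destruct (Hdec 1%nat) as [C HC]. exists (5 * (C * 2)). intros x t Ht.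
      apply Sx_bound. intros k. apply HC. lra.
    + intros t Ht. apply (Cinf_T_Sx (h t)), Hrap. lra.
    + exact Hinit.
    + intros x. rewrite <- Hinit. destruct (Hdec 1%nat) as [C HC].
      apply (Sx_right_limit T h C L); auto.
      intros t k Ht. specialize (HC t k Ht). rewrite pow_1 in HC. exact HC.
    + intros x t Ht. pose proof (Hrap t ltac:(lra)) as Hr.
      exists (zser (fun k => h t k * (- mu a k * cas (- (IZR k * x))))). split.
      * apply is_Ha_Sx; assumption.
      * rewrite velocity_Sx by assumption.
        assert (Derive (fun s : R => Sx 0 (h s) x) t = Sx 0 (Dtime h t) x) as ->
          by (apply is_derive_unique, (Sx_time_derive 0 T); assumption).
        assert (Derive (fun y : R => Sx 0 (h t) y) x = Sx 1 (h t) x) as ->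
          by (apply is_derive_unique, Sx_derive, Hr).
        rewrite (Sx_ext 0 (Dtime h t) (Qinf (gamma a g) (h t)))
          by (intros k; apply is_derive_unique, Hode, Ht).
        apply (transport_equation _ (3 * g)); assumption.
  - intros T' sigma HT' Hsol x t Ht.
    assert (t < T /\ t < T') as [HtT HtT'].
    { pose proof (Rmin_l T T'). pose proof (Rmin_r T T'). lra. }
    destruct (Req_dec t 0) as [->|Hne].
    { rewrite Hinit. apply Hsol. }
    (* The coefficients are frozen for [s <= 0], where [sigma] is not controlled, because the
       uniqueness clause asks for two-sided continuity at [0]. *)
    set (d := fun s k => if Rle_dec s 0 then fc rho0 k else fc (fun x => sigma x s) k).
    assert (forall s k, 0 < s -> d s k = fc (fun x => sigma x s) k) as Hd.
    { intros s k Hs. unfold d. destruct (Rle_dec s 0); [lra|reflexivity]. }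
    assert (forall k s, 0 < s < T' -> is_derive (fun s => d s k) s (Qinf (gamma a g) (d s) k)) as Hdd.
    { intros k s Hs. apply is_derive_ext_loc with (fun s => fc (fun x => sigma x s) k).
      - eapply filter_imp; [|apply (strip_locally T' s Hs)]. intros u Hu. symmetry. apply Hd. lra.
      - replace (Qinf (gamma a g) (d s) k) with (Qinf (gamma a g) (fc (fun x => sigma x s)) k).
        + apply (sol_coeff_derive a g T' rho0 sigma ha hg Hsol); exact Hs.
        + unfold Qinf, Qb. f_equal. apply zser_ext. intros l. rewrite Hd by lra. f_equal.
          apply Amat_ext. intros j. unfold Gop. rewrite Hd by lra. reflexivity. }
    assert (forall k, d t k = h t k) as Heq.
    (* Uniqueness is applied on [[0, t]] itself: decay of the coefficients of [sigma] is uniform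
       only on intervals that stop before [T']. *)
    { intros k. apply (Huniq t d); try lra.
      - destruct (sol_coeff_decay a g T' rho0 sigma Hsol 3 t ltac:(lra)) as [C HC].
        exists C. intros s j Hs. rewrite Hd by lra. apply HC. lra.
      - intros j s Hs. apply Hdd. lra.
      - intros j s Hs. destruct (Req_dec s 0) as [->|Hs0].
        + destruct (sol_coeff_initial a g T' rho0 sigma Hsol h0 t j ltac:(lra)) as (M & HM0 & HMd).
          apply continuity_pt_filterlim.
          apply filterlim_locally. intros eps. pose proof (cond_pos eps).
          assert (0 < Rmin t (eps / (M + 1))) as Hdel.
          { apply Rmin_pos; [lra|]. apply Rdiv_lt_0_compat; lra. }
          exists (mkposreal _ Hdel). intros u Hu. change (Rabs (u - 0) < Rmin t (eps / (M + 1))) in Hu.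
          rewrite Rminus_0_r in Hu. change (Rabs (d u j - d 0 j) < eps).
          assert (d 0 j = fc rho0 j) as -> by (unfold d; destruct (Rle_dec 0 0); [reflexivity|lra]).
          destruct (Rle_dec u 0) as [Hu0|Hu0].
          * unfold d. destruct (Rle_dec u 0); [|lra]. rewrite Rminus_diag, Rabs_R0. lra.
          * rewrite Hd by lra. rewrite Rabs_pos_eq in Hu by lra.
            pose proof (Rmin_l t (eps / (M + 1))). pose proof (Rmin_r t (eps / (M + 1))).
            eapply Rle_lt_trans; [apply HMd; lra|].
            apply Rle_lt_trans with (M * (eps / (M + 1))); [apply Rmult_le_compat_l; lra|].
            apply Rmult_lt_reg_r with (M + 1); [lra|].
            replace (M * (eps / (M + 1)) * (M + 1)) with (M * eps) by (field; lra). nra.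
        + eapply is_derive_continuity_pt, Hdd. lra.
      - intros j. unfold d. destruct (Rle_dec 0 0); [reflexivity|lra]. }
    rewrite (sol_series a g T' rho0 sigma Hsol x t ltac:(lra)).
    apply Sx_ext. intros k. rewrite <- Heq, Hd by lra. reflexivity.
Qed.
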